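(* Let $S\subset\mathbb P^3$ be a smooth cubic surface and $X=\mathbb P(K_S\oplus\mathcal O)$. Let $\bar{\mathcal H}(X)$ be the $D$-module obtained by analytic continuation of the ambient part quantum $D$-module $\mathcal H(X)$ over the extended Kähler moduli, and let $E$ and $\bar{\mathcal H}^E(X)\subseteq\bar{\mathcal H}(X)$ be the divisor and the submodule with maximum trivial $E$-monodromy whose restriction to $E$ is isomorphic to the ambient part quantum $D$-module $\mathcal H(Y)$ of a smooth cubic threefold $Y\subset\mathbb P^4$. Then there is another divisor $F$ in the extended Kähler moduli and a submodule $\bar{\mathcal H}^F(X)\subseteq\bar{\mathcal H}(X)$ with maximum trivial $F$-monodromy such that $$\bar{\mathcal H}^F(X)/\bar{\mathcal H}^E(X)|_F\simeq\mathcal L(W),$$ where $\mathcal L(W)$ is the FJRW $D$-module of the pair $(W,G)$, with $W=x^3+y^3+z^3+u^3$ and $G=\langle J_W\rangle$.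
   Context: **$D$-module of $X$.** $X$ is the zero locus of a section of $\pi^*\mathcal O_{\mathbb P^3}(3)$ in $\widetilde X=\mathbb P(\mathcal O_{\mathbb P^3}\oplus\mathcal O_{\mathbb P^3}(-1))\xrightarrow{\pi}\mathbb P^3$. Let $h=c_1(\pi^*\mathcal O_{\mathbb P^3}(1))$, $\xi=c_1(\mathcal O_{\widetilde X}(1))$ (anti-tautological bundle), so $h^4=h\xi-\xi^2=0$; $q_1,q_2$ are the small parameters corresponding to $h,\xi$. Write $z\delta_q=zq\,\partial_q$. The ambient part quantum $D$-module $\mathcal H(X)$ is the cyclic $D$-module generated by $\mathbf e(\mathcal V)$ times the small twisted $J$-function of the pair $(\widetilde X,\mathcal V)$, $\mathcal V=\pi^*\mathcal O_{\mathbb P^3}(3)$. By the Coates–Givental mirror theorem it is identified with the cyclic $D$-module, over the ring generated by $z\delta_{q_1},z\delta_{q_2}$ over $\mathbb C[q_1^{\pm1},q_2^{\pm1},z]$, generated by $$I^X(q_1,q_2)=(3h)q_1^{h/z}q_2^{\xi/z}\sum_{d_1,d_2\ge0}q_1^{d_1}q_2^{d_2}\frac{\prod_{m=-\infty}^0(\xi-h+mz)\prod_{m=1}^{3d_1}(3h+mz)}{\prod_{m=1}^{d_1}(h+mz)^4\prod_{m=1}^{d_2}(\xi+mz)\prod_{m=-\infty}^{d_2-d_1}(\xi-h+mz)}.$$ Likewise $\mathcal H(Y)$ is identified with the $D$-module generated by $I^Y(y)=(3p)y^{p/z}\sum_{d\ge0}y^d\frac{\prod_{m=1}^{3d}(3p+mz)}{\prod_{m=1}^d(p+mz)^5}$,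 $p^5=0$, where $p$ is the hyperplane class of $\mathbb P^4$. One switches freely between such $D$-modules and the local systems attached to them, spanned by components of the $I$-functions. **Continuation.** The extended Kähler moduli adds the region near $(x,y)=(0,0)$, where $x=q_1^{-1}$, $y=q_1q_2$. In these coordinates $\bar{\mathcal H}(X)$ is the rank 6 $D$-module of the system $\triangle_1'I=\triangle_2'I=0$, where $$\triangle_1'=x(z\delta_y-z\delta_x)^3-3\big(3(z\delta_y-z\delta_x)+z\big)\big(3(z\delta_y-z\delta_x)+2z\big)(z\delta_x),\qquad \triangle_2'=(z\delta_y)(z\delta_x)-xy.$$ Here $E$ is the divisor $x=0$, and $\bar{\mathcal H}^E(X)$ is spanned by the solutions with trivial monodromy around $x=0$. A submodule (sub-local system) has maximum trivial $D$-monodromy, for a divisor $D$, if continuation around $D$ acts trivially on it and it is maximal with this property. The notation $\bar{\mathcal H}^F(X)/\bar{\mathcal H}^E(X)|_F$ means: take $\bar{\mathcal H}^F(X)$ modulo those solutions in it that lie in $\bar{\mathcal H}^E(X)$, and restrict the result to $F$. **FJRW $D$-module.** $J_W=(e^{2\pi\sqrt{-1}/3},e^{2\pi\sqrt{-1}/3},e^{2\pi\sqrt{-1}/3},e^{2\pi\sqrt{-1}/3})$ and $G$ is the group it generates. Let $\phi_0,\phi_1$ be the generators of the narrow sector of the FJRW state space of $(W,G)$. The regularized FJRW $I$-function is $$I^{reg}_{FJRW}(\tau)=\sum_{l\ge0}\frac{\tau^{l+\frac13}(-1)^{3l+1}\Gamma(l+\frac13)^4}{(3l)!\,\Gamma(l+\frac43)\Gamma(\frac13)^4}\phi_0+\sum_{l\ge0}\frac{\tau^{l+\frac23}(-1)^{3l+2}\Gamma(l+\frac23)^4}{(3l+1)!\,\Gamma(l+\frac53)\Gamma(\frac23)^4}\phi_1,$$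 and $\mathcal L(W)$ is the $D$-module (or local system) attached to its components. *)

(* Defs.v *)
From Stdlib Require Import Reals Factorial.
From Coquelicot Require Import Coquelicot.

Open Scope R_scope.

(* Stdlib reals with Coquelicot's complex numbers.

   Near (x,y) = (0,0), write x = e^s and y = e^t.  A multivalued holomorphic
   function on the punctured polydisc 0 < |x|, |y| < r is a function of (s,t) on
   the universal cover Re s, Re t < ln r.  There the operators x d/dx and y d/dy
   are d/ds and d/dt, and continuation around x = 0 (resp. y = 0) is the
   translation of s (resp. t) by 2 pi i.  D-modules are represented by their
   local systems of solutions: spaces of such functions, where only the values on
   the universal cover matter. *)

Definition Cexp (w : C) : C := (exp (fst w) * cos (snd w), exp (fst w) * sin (snd w)).

Definition two_pi_i : C := (0, 2 * PI).

Definition Cseries (a : nat -> C) : C :=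
  (Series (fun n => fst (a n)), Series (fun n => snd (a n))).

Definition cover (r : R) (w : C) : Prop := exp (fst w) < r.

Definition eq1 (r : R) (g h : C -> C) : Prop :=
  forall u, cover r u -> g u = h u.

Definition eq2 (r : R) (f g : C -> C -> C) : Prop :=
  forall s t, cover r s -> cover r t -> f s t = g s t.

(* Existence and continuity of all iterated complex partial derivatives
   (F i j is the derivative of order i in s and j in t); by Cauchy's theory this
   is the same as holomorphy in two variables. *)
Definition holomorphic2 (r : R) (f : C -> C -> C) : Prop :=
  exists F : nat -> nat -> C -> C -> C,
    eq2 r (F O O) f /\
    forall (i j : nat) (s t : C), cover r s -> cover r t ->
      continuous (fun p : C * C => F i j (fst p) (snd p)) (s, t) /\
      is_derive (fun s' => F i j s' t) s (F (S i) j s t) /\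
      is_derive (fun t' => F i j s t') t (F i (S j) s t).

Definition zdx (z : C) (f : C -> C -> C) : C -> C -> C :=
  fun s t => (z * C_derive (fun s' => f s' t) s)%C.

Definition zdy (z : C) (f : C -> C -> C) : C -> C -> C :=
  fun s t => (z * C_derive (fun t' => f s t') t)%C.

(* Since q1 = 1/x and q2 = x y, this is z q1 d/dq1. *)
Definition zdq1 (z : C) (f : C -> C -> C) : C -> C -> C :=
  fun s t => (zdy z f s t - zdx z f s t)%C.

Definition affine_zdq1 (z a b : C) (f : C -> C -> C) : C -> C -> C :=
  fun s t => (a * zdq1 z f s t + b * f s t)%C.

Definition Delta1 (z : C) (f : C -> C -> C) : C -> C -> C :=
  fun s t =>
    (Cexp s * zdq1 z (zdq1 z (zdq1 z f)) s t
     - 3 * affine_zdq1 z 3 z (affine_zdq1 z 3 (2 * z) (zdx z f)) s t)%C.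

Definition Delta2 (z : C) (f : C -> C -> C) : C -> C -> C :=
  fun s t => (zdy z (zdx z f) s t - Cexp s * Cexp t * f s t)%C.

(* The continued D-module of X.  The singular locus of the system is
   x = 0, y = 0 and x = -27, so this is a local system when 0 < r <= 27. *)
Definition Hbar (z : C) (r : R) (f : C -> C -> C) : Prop :=
  holomorphic2 r f /\
  forall s t, cover r s -> cover r t -> Delta1 z f s t = 0 /\ Delta2 z f s t = 0.

(* The divisors x = 0 and y = 0 through the point (0,0). *)
Inductive divisor : Type := div_x | div_y.

Definition loop (D : divisor) (f : C -> C -> C) : C -> C -> C :=
  match D with
  | div_x => fun s t => f (s + two_pi_i)%C t
  | div_y => fun s t => f s (t + two_pi_i)%C
  end.

Definition loop1 (g : C -> C) : C -> C := fun u => g (u + two_pi_i)%C.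

(* The generator of the fundamental group of the punctured divisor D is the loop
   around the other divisor. *)
Definition transverse (D : divisor) : divisor :=
  match D with div_x => div_y | div_y => div_x end.

Definition add2 (f g : C -> C -> C) : C -> C -> C := fun s t => (f s t + g s t)%C.
Definition scal2 (c : C) (f : C -> C -> C) : C -> C -> C := fun s t => (c * f s t)%C.
Definition sub2 (f g : C -> C -> C) : C -> C -> C := fun s t => (f s t - g s t)%C.

Definition vanishing (r : R) (f : C -> C -> C) : Prop := eq2 r f (fun _ _ => RtoC 0).

Record sub_local_system (z : C) (r : R) (M : (C -> C -> C) -> Prop) : Prop := {
  sls_sol : forall f, M f -> Hbar z r f;
  sls_ext : forall f g, eq2 r f g -> M f -> M g;
  sls_zero : M (fun _ _ => RtoC 0);
  sls_add : forall f g, M f -> M g -> M (add2 f g);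
  sls_scal : forall c f, M f -> M (scal2 c f);
  sls_loop : forall D f, M f <-> M (loop D f)
}.

Definition trivial_monodromy (r : R) (D : divisor) (M : (C -> C -> C) -> Prop) : Prop :=
  forall f, M f -> eq2 r (loop D f) f.

Definition max_trivial_monodromy (z : C) (r : R) (D : divisor)
    (M : (C -> C -> C) -> Prop) : Prop :=
  sub_local_system z r M /\ trivial_monodromy r D M /\
  forall M' : (C -> C -> C) -> Prop,
    sub_local_system z r M' -> trivial_monodromy r D M' ->
    (forall f, M f -> M' f) -> forall f, M' f -> M f.

Definition coords (D : divisor) (f : C -> C -> C) (u v : C) : C :=
  match D with div_x => f v u | div_y => f u v end.

(* The multivalued function f extends across D (the transverse coordinate tends
   to 0 as Re v -> -oo), and its restriction to D is g, as a function of the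
   logarithm u of the coordinate of D. *)
Definition is_restriction (r : R) (D : divisor) (f : C -> C -> C) (g : C -> C) : Prop :=
  forall u, cover r u ->
  forall eps : R, 0 < eps ->
  exists A : R, forall v, fst v < A -> Cmod (coords D f u v - g u) < eps.

(* An isomorphism from (V / (V \cap V0))|_D to the local system W on the punctured
   disc 0 < |w| < r of D: a linear map on V with kernel V \cap V0 and image W that
   commutes with the monodromy, and such that phi f is the restriction to D of a
   representative of the class of f.  By the last clause, phi is compatible with
   the differential operators on D, not only with the monodromy. *)
Record is_restriction_iso (r : R) (D : divisor) (V V0 : (C -> C -> C) -> Prop)
    (W : (C -> C) -> Prop) (phi : (C -> C -> C) -> C -> C) : Prop := {
  ri_image : forall f, V f -> W (phi f);
  ri_add : forall f g, V f -> V g ->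
    eq1 r (phi (add2 f g)) (fun u => (phi f u + phi g u)%C);
  ri_scal : forall c f, V f -> eq1 r (phi (scal2 c f)) (fun u => (c * phi f u)%C);
  ri_loop : forall f, V f -> eq1 r (phi (loop (transverse D) f)) (loop1 (phi f));
  ri_kernel : forall f, V f -> (eq1 r (phi f) (fun _ => RtoC 0) <-> V0 f);
  ri_onto : forall g, W g -> exists f, V f /\ eq1 r (phi f) g;
  ri_restr : forall f, V f ->
    exists f0, V f0 /\ V0 f0 /\ is_restriction r D (sub2 f f0) (phi f)
}.

Definition quotient_restriction_iso (r : R) (D : divisor)
    (V V0 : (C -> C -> C) -> Prop) (W : (C -> C) -> Prop) : Prop :=
  exists phi, is_restriction_iso r D V V0 W phi.

Definition restriction_iso (r : R) (D : divisor) (V : (C -> C -> C) -> Prop)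
    (W : (C -> C) -> Prop) : Prop :=
  quotient_restriction_iso r D V (vanishing r) W.

(* Elements of C[p]/(p^5) are given by their coefficient sequences; only the
   coefficients of index at most 4 are used. *)
Definition pmul (a b : nat -> C) : nat -> C :=
  fun n => sum_n (fun k => (a k * b (n - k)%nat)%C) n.

Definition pone : nat -> C := fun k => match k with O => RtoC 1 | _ => RtoC 0 end.

(* a + b p *)
Definition plin (a b : C) : nat -> C :=
  fun k => match k with O => a | S O => b | _ => RtoC 0 end.

(* (a + p)^(-1) = sum_k (-1)^k p^k / a^(k+1) *)
Definition plin_inv (a : C) : nat -> C :=
  fun k => (RtoC ((-1) ^ k) / a ^ (S k))%C.

(* exp (c p) *)
Definition pexp (c : C) : nat -> C := fun k => (c ^ k / RtoC (INR (fact k)))%C.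

Fixpoint ppow (a : nat -> C) (n : nat) : nat -> C :=
  match n with O => pone | S n' => pmul a (ppow a n') end.

(* prod_(m = 1)^n a_m *)
Fixpoint pprod (a : nat -> nat -> C) (n : nat) : nat -> C :=
  match n with O => pone | S n' => pmul (pprod a n') (a n) end.

Definition IY_coef (z : C) (d : nat) : nat -> C :=
  pmul (pprod (fun m => plin (RtoC (INR m) * z)%C (RtoC 3)) (3 * d))
       (pprod (fun m => ppow (plin_inv (RtoC (INR m) * z)%C) 5) d).

(* The coefficient of p^k in I^Y, at y = e^t. *)
Definition IY (z : C) (k : nat) (t : C) : C :=
  Cseries (fun d =>
    (Cexp (RtoC (INR d) * t) *
     pmul (plin (RtoC 0) (RtoC 3)) (pmul (pexp (t / z)) (IY_coef z d)) k)%C).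

Definition H_Y (z : C) (r : R) (g : C -> C) : Prop :=
  exists c : nat -> C, eq1 r g (fun t => sum_n (fun k => (c k * IY z k t)%C) 4).

Definition Gamma (a : R) : R :=
  RInt_gen (fun t => Rpower t (a - 1) * exp (- t)) (at_right 0) (Rbar_locally p_infty).

(* The coefficients of phi_0 and phi_1 in the regularized FJRW I-function, at
   tau = e^u; both series converge for |tau| < 27. *)
Definition I_FJRW_0 (u : C) : C :=
  Cseries (fun l =>
    (RtoC ((-1) ^ (3 * l + 1) * Gamma (INR l + 1 / 3) ^ 4
           / (INR (fact (3 * l)) * Gamma (INR l + 4 / 3) * Gamma (1 / 3) ^ 4))
     * Cexp (RtoC (INR l + 1 / 3) * u))%C).

Definition I_FJRW_1 (u : C) : C :=
  Cseries (fun l =>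
    (RtoC ((-1) ^ (3 * l + 2) * Gamma (INR l + 2 / 3) ^ 4
           / (INR (fact (3 * l + 1)) * Gamma (INR l + 5 / 3) * Gamma (2 / 3) ^ 4))
     * Cexp (RtoC (INR l + 2 / 3) * u))%C).

Definition L_W (r : R) (g : C -> C) : Prop :=
  exists a b : C, eq1 r g (fun u => (a * I_FJRW_0 u + b * I_FJRW_1 u)%C).

(* Main.v *)
Require Import Defs.
From Stdlib Require Import Reals Lra Lia List Factorial ClassicalEpsilon.
From Coquelicot Require Import Coquelicot.

(** Write x = e^s, y = e^t, T_x and T_y for the continuations around x = 0 and
    y = 0, and D = d/dt - d/ds. By maximality, H^E is the space of all solutions
    invariant around E, and the same description serves as definition of H^F.

    The divisor E must be x = 0. The system has a solution (frob) of the form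
    x^(1/3) times a function of x and y that is holomorphic at the origin. If E were
    y = 0 this solution would lie in H^E and be an eigenvector of T_x for a primitive
    cube root of unity, but the monodromy of H(Y) is unipotent, its only
    multivaluedness being the logarithms in the factor y^(p/z) (IY_logs, IY_eigen,
    not_div_y). So F is y = 0.

    There is a second such solution with x^(2/3). They are the double series
    sum_l a_l x^(l + al) 0F1(l + al + 1; x y / z^2), al = 1/3 or 2/3: the second
    equation of the system is the differential equation of 0F1 in w = x y, and the
    first one is the two-term recurrence of the a_l (frob_system). By the functional
    equation of Gamma this is the recurrence satisfied by the coefficients of the
    regularized FJRW I-function (fjrw_rec_0, fjrw_rec_1). Putting y = 0 replaces 0F1
    by 1, so the two solutions restrict to the two components of that I-function
    (frob_restriction), and both are invariant around y = 0.

    The system is equivalent to a Pfaffian system for six of the derivatives of the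
    unknown function, regular on 0 < |x|, |y| < 27; hence solutions are determined
    by six numbers (jet_unique_x, jet_unique_y) and any seven solutions are linearly
    dependent (Hbar_dependence). On the other hand H^E contains four independent
    solutions, the preimages of the four components of I^Y, all fixed by T_x, and the
    two fractional solutions are T_x-eigenvectors for the other eigenvalues
    e^(2 pi i / 3) and e^(4 pi i / 3). These six solutions are independent
    (eigen_independence), so they span, and every solution is uniquely h + b G0 + c G1
    with h in H^E and G0, G1 the fractional solutions (decomposition).

    The isomorphism sends such a solution in H^F to the corresponding combination of
    the two FJRW components. Its kernel is the intersection of H^F and H^E, and
    subtracting the representative h, which is again in H^F, leaves b G0 + c G1,
    whose restriction to y = 0 is the image. *)

Lemma Cmod_fst (w : C) : Rabs (fst w) <= Cmod w.
Proof. eapply Rle_trans; [apply Rmax_l | apply Rmax_Cmod]. Qed.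

Lemma Cmod_snd (w : C) : Rabs (snd w) <= Cmod w.
Proof. eapply Rle_trans; [apply Rmax_r | apply Rmax_Cmod]. Qed.

Lemma Cmod_le_sum (w : C) : Cmod w <= Rabs (fst w) + Rabs (snd w).
Proof.
  unfold Cmod. rewrite <- (pow2_abs (fst w)), <- (pow2_abs (snd w)).
  apply Rsqr_incr_0_var.
  - rewrite Rsqr_sqrt by nra. unfold Rsqr.
    pose proof (Rabs_pos (fst w)). pose proof (Rabs_pos (snd w)). nra.
  - pose proof (Rabs_pos (fst w)). pose proof (Rabs_pos (snd w)). lra.
Qed.

(** * The complex exponential *)

Lemma Cexp_add (a b : C) : Cexp (a + b) = (Cexp a * Cexp b)%C.
Proof.
  unfold Cexp, Cmult; simpl. rewrite exp_plus, cos_plus, sin_plus.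
  apply injective_projections; simpl; ring.
Qed.

Lemma Cexp_0 : Cexp 0 = 1.
Proof.
  unfold Cexp; simpl. rewrite exp_0, cos_0, sin_0.
  apply injective_projections; simpl; ring.
Qed.

Lemma Cmod_Cexp (w : C) : Cmod (Cexp w) = exp (fst w).
Proof.
  unfold Cmod, Cexp; simpl.
  replace (exp (fst w) * cos (snd w) * (exp (fst w) * cos (snd w) * 1) +
     exp (fst w) * sin (snd w) * (exp (fst w) * sin (snd w) * 1))
    with (Rsqr (exp (fst w)) * (Rsqr (sin (snd w)) + Rsqr (cos (snd w))))
    by (unfold Rsqr; ring).
  rewrite sin2_cos2, Rmult_1_r. apply sqrt_Rsqr. left; apply exp_pos.
Qed.

Lemma Cexp_neq_0 (w : C) : Cexp w <> 0.
Proof. apply Cmod_gt_0. rewrite Cmod_Cexp. apply exp_pos. Qed.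

Lemma Cexp_two_pi_i : Cexp two_pi_i = 1.
Proof.
  unfold Cexp, two_pi_i; simpl. rewrite exp_0, cos_2PI, sin_2PI.
  apply injective_projections; simpl; ring.
Qed.

Lemma Cexp_nat_two_pi_i (n : nat) : Cexp (INR n * two_pi_i) = 1.
Proof.
  induction n as [|n IH].
  - replace (INR 0 * two_pi_i)%C with (RtoC 0) by (simpl; ring). apply Cexp_0.
  - rewrite S_INR, RtoC_plus.
    replace ((INR n + 1) * two_pi_i)%C with (INR n * two_pi_i + two_pi_i)%C by ring.
    rewrite Cexp_add, IH, Cexp_two_pi_i. ring.
Qed.

Lemma second_order_mvt (p p1 p2 : R -> R) (M : R) :
  (forall t, 0 <= t <= 1 -> is_derive p t (p1 t)) ->
  (forall t, 0 <= t <= 1 -> is_derive p1 t (p2 t)) ->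
  (forall t, 0 <= t <= 1 -> Rabs (p2 t) <= M) ->
  Rabs (p 1 - p 0 - p1 0) <= M.
Proof.
  intros H1 H2 HM.
  set (q := fun t => p t - t * p1 0).
  assert (Hq : forall t, 0 <= t <= 1 -> is_derive q t (p1 t - p1 0)).
  { intros t Ht. unfold q. specialize (H1 t Ht).
    auto_derive. now exists (p1 t). change (Derive (fun x => p x) t) with (Derive p t).
    rewrite (is_derive_unique _ _ _ H1). ring. }
  destruct (MVT_gen q 0 1 (fun t => p1 t - p1 0)) as (c & Hc & E).
  - rewrite Rmin_left, Rmax_right by lra. intros; apply Hq; lra.
  - rewrite Rmin_left, Rmax_right by lra. intros x Hx.
    apply derivable_continuous_pt. exists (p1 x - p1 0).
    apply is_derive_Reals. apply Hq; lra.
  - rewrite Rmin_left, Rmax_right in Hc by lra.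
    destruct (MVT_gen p1 0 c p2) as (c' & Hc' & E').
    + rewrite Rmin_left, Rmax_right by lra. intros; apply H2; lra.
    + rewrite Rmin_left, Rmax_right by lra. intros x Hx.
      apply derivable_continuous_pt. exists (p2 x).
      apply is_derive_Reals. apply H2; lra.
    + rewrite Rmin_left, Rmax_right in Hc' by lra.
      unfold q in E. simpl in E.
      replace (p 1 - p 0 - p1 0) with (p2 c' * c) by lra.
      rewrite Rabs_mult, (Rabs_right c) by lra.
      specialize (HM c' ltac:(lra)). pose proof (Rabs_pos (p2 c')). nra.
Qed.

Lemma Cexp_second_order (w : C) :
  Cmod (Cexp w - 1 - w) <= 2 * (Cmod w ^ 2 * exp (Cmod w)).
Proof.
  destruct w as [a b].
  (* The path tau |-> exp (tau w) has second derivative w^2 exp (tau w); the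
     mean value theorem is applied to its two real components. *)
  set (g := fun (c : C) (t : R) => (c * Cexp (t * (a, b)))%C).
  assert (Hb : forall t, 0 <= t <= 1 ->
     Cmod (g (1 * (a,b) * (a,b))%C t) <= Cmod (a,b) ^ 2 * exp (Cmod (a,b))).
  { intros t Ht. unfold g. rewrite Cmult_1_l, !Cmod_mult, Cmod_Cexp.
    replace (Cmod (a,b) * Cmod (a,b)) with (Cmod (a,b) ^ 2) by ring.
    apply Rmult_le_compat_l. apply pow_le, Cmod_ge_0.
    assert (fst (t * (a, b))%C <= Cmod (a, b)) as Hle.
    { simpl. pose proof (Cmod_fst (a,b)) as H. simpl in H.
      pose proof (Rle_abs a). pose proof (Rabs_pos a). nra. }
    destruct Hle as [Hl | ->]; [left; now apply exp_increasing | right; reflexivity]. }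
  assert (Hf : forall c t, is_derive (fun t => fst (g c t)) t (fst (g (c * (a,b))%C t))).
  { intros [c d] t. unfold g, Cexp, Cmult, RtoC; simpl.
    auto_derive. auto. unfold Rminus. ring. }
  assert (Hs : forall c t, is_derive (fun t => snd (g c t)) t (snd (g (c * (a,b))%C t))).
  { intros [c d] t. unfold g, Cexp, Cmult, RtoC; simpl.
    auto_derive. auto. unfold Rminus. ring. }
  assert (E0 : forall c, g c 0 = c).
  { intros c. unfold g. rewrite Cmult_0_l, Cexp_0. ring. }
  assert (E1 : g 1 1 = Cexp (a,b)).
  { unfold g. rewrite !Cmult_1_l. reflexivity. }
  pose proof (second_order_mvt _ _ _ _ (fun t _ => Hf 1 t) (fun t _ => Hf _ t)
    (fun t Ht => Rle_trans _ _ _ (Cmod_fst _) (Hb t Ht))) as B1.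
  pose proof (second_order_mvt _ _ _ _ (fun t _ => Hs 1 t) (fun t _ => Hs _ t)
    (fun t Ht => Rle_trans _ _ _ (Cmod_snd _) (Hb t Ht))) as B2.
  cbv beta in B1, B2. rewrite !E0, E1, Cmult_1_l in B1, B2.
  eapply Rle_trans; [apply Cmod_le_sum|].
  simpl in B1, B2 |- *. unfold Rminus in *. lra.
Qed.

(** * Complex derivatives *)

Lemma is_C_derive_eps (f : C -> C) (x l : C) :
  is_derive f x l <->
  forall eps : posreal, exists del : posreal, forall y,
    Cmod (y - x) < del -> Cmod (f y - f x - (y - x) * l) <= eps * Cmod (y - x).
Proof.
  split.
  - intros [_ H] eps. specialize (H x (fun P h => h) eps).
    destruct (locally_le_locally_norm _ _ H) as [d Hd].
    exists d. intros y Hy. exact (Hd y Hy).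
  - intros H. split; [apply is_linear_scal_l|].
    intros x' Hx' eps. destruct (H eps) as [d Hd].
    assert (E : x = x')
      by exact (is_filter_lim_locally_unique (V := AbsRing_NormedModule C_AbsRing) x x' Hx').
    subst x'.
    exists d. intros y Hy. exact (Hd y Hy).
Qed.

Lemma is_C_derive_ring (f : C -> C) (x l : C) :
  is_derive f x l <-> is_derive (V := AbsRing_NormedModule C_AbsRing) f x l.
Proof.
  split.
  - intros [_ H]. split; [apply is_linear_scal_l|]. exact H.
  - intros [_ H]. split; [apply is_linear_scal_l|]. exact H.
Qed.

Lemma is_C_derive_mult (f g : C -> C) (x df dg : C) :
  is_derive f x df -> is_derive g x dg ->
  is_derive (fun y => f y * g y)%C x (df * g x + f x * dg)%C.
Proof.
  intros Hf Hg. apply is_C_derive_ring in Hf, Hg. apply is_C_derive_ring.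
  exact (is_derive_mult f g x df dg Hf Hg Cmult_comm).
Qed.

Lemma is_C_derive_plus (f g : C -> C) (x df dg : C) :
  is_derive f x df -> is_derive g x dg ->
  is_derive (fun y => f y + g y)%C x (df + dg)%C.
Proof. intros Hf Hg. exact (is_derive_plus f g x df dg Hf Hg). Qed.

Lemma is_C_derive_const (c x : C) : is_derive (fun _ : C => c) x (RtoC 0).
Proof. exact (is_derive_const (V := C_NormedModule) c x). Qed.

Lemma is_C_derive_scal (f : C -> C) (c x df : C) :
  is_derive f x df -> is_derive (fun y => c * f y)%C x (c * df)%C.
Proof.
  intros Hf.
  replace (c * df)%C with (0 * f x + c * df)%C by ring.
  apply is_C_derive_mult; [apply is_C_derive_const | assumption].
Qed.

(** A quadratic remainder is all that the derivatives below need. *)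
Lemma is_C_derive_quadratic (f : C -> C) (x l : C) (K del : R) :
  0 < del ->
  (forall h, Cmod h <= del -> Cmod (f (x + h)%C - f x - h * l) <= K * Cmod h ^ 2) ->
  is_derive f x l.
Proof.
  intros Hd H. apply is_C_derive_eps. intros eps.
  assert (HK : 0 < Rabs K + 1) by (pose proof (Rabs_pos K); lra).
  assert (Hm : 0 < Rmin del (eps / (Rabs K + 1))).
  { apply Rmin_pos; auto. apply Rdiv_lt_0_compat; auto. apply cond_pos. }
  exists (mkposreal _ Hm). simpl. intros y Hy.
  assert (Hy1 := Rlt_le_trans _ _ _ Hy (Rmin_l _ _)).
  assert (Hy2 := Rlt_le_trans _ _ _ Hy (Rmin_r _ _)).
  specialize (H (y - x)%C (Rlt_le _ _ Hy1)).
  replace (x + (y - x))%C with y in H by ring.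
  eapply Rle_trans; [exact H|].
  pose proof (Cmod_ge_0 (y - x)). pose proof (Rle_abs K).
  apply (Rmult_lt_compat_r (Rabs K + 1)) in Hy2; auto.
  unfold Rdiv in Hy2. rewrite Rmult_assoc, Rinv_l, Rmult_1_r in Hy2 by lra.
  nra.
Qed.

Lemma is_C_derive_Cexp (w : C) : is_derive Cexp w (Cexp w).
Proof.
  apply (is_C_derive_quadratic _ _ _ (exp (fst w) * (2 * exp 1)) 1); [lra|].
  intros h Hh. rewrite Cexp_add.
  replace (Cexp w * Cexp h - Cexp w - h * Cexp w)%C
    with (Cexp w * (Cexp h - 1 - h))%C by ring.
  rewrite Cmod_mult, Cmod_Cexp, Rmult_assoc.
  apply Rmult_le_compat_l; [left; apply exp_pos|].
  eapply Rle_trans; [apply Cexp_second_order|].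
  assert (exp (Cmod h) <= exp 1).
  { destruct Hh as [Hh | ->]; [left; now apply exp_increasing | right; reflexivity]. }
  pose proof (pow_le _ 2 (Cmod_ge_0 h)). nra.
Qed.

(** The chain rule along a real segment, in components, for use with real
    differential inequalities. *)
Lemma is_C_derive_along (f : C -> C) (x d l : C) (tau : R) :
  is_derive f (x + tau * d)%C l ->
  is_derive (fun t : R => fst (f (x + t * d)%C)) tau (fst (l * d)%C) /\
  is_derive (fun t : R => snd (f (x + t * d)%C)) tau (snd (l * d)%C).
Proof.
  intros H. rewrite is_C_derive_eps in H.
  assert (K : forall eps : posreal, exists del : posreal, forall y : R,
     Rabs (y - tau) < del ->
     Cmod (f (x + y * d)%C - f (x + tau * d)%C - (y - tau) * (l * d)) <=
       eps * Rabs (y - tau)).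
  { intros eps. set (m := Cmod d + 1).
    assert (Hm : 0 < m) by (pose proof (Cmod_ge_0 d); unfold m; lra).
    destruct (H (mkposreal _ (Rdiv_lt_0_compat _ _ (cond_pos eps) Hm))) as [del Hdel].
    exists (mkposreal _ (Rdiv_lt_0_compat _ _ (cond_pos del) Hm)).
    simpl. intros y Hy.
    assert (Ey : Cmod (x + y * d - (x + tau * d))%C = Rabs (y - tau) * Cmod d).
    { rewrite <- Cmod_R, <- Cmod_mult. f_equal. rewrite RtoC_minus. ring. }
    apply (Rmult_lt_compat_r m) in Hy; auto.
    unfold Rdiv in Hy. rewrite Rmult_assoc, Rinv_l, Rmult_1_r in Hy by lra.
    pose proof (Rabs_pos (y - tau)). pose proof (Cmod_ge_0 d).
    specialize (Hdel (x + y * d)%C). rewrite Ey in Hdel.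
    replace ((y - tau) * (l * d))%C with ((x + y * d - (x + tau * d)) * l)%C
      by ring.
    eapply Rle_trans; [apply Hdel|]. unfold m in *; nra.
    simpl. unfold Rdiv. pose proof (cond_pos eps).
    assert (Cmod d <= m) by (unfold m; lra).
    replace (eps * / m * (Rabs (y - tau) * Cmod d))
      with (eps * Rabs (y - tau) * (Cmod d * / m)) by ring.
    assert (Cmod d * / m <= 1).
    { apply (Rmult_le_reg_r m); auto. rewrite Rmult_assoc, Rinv_l by lra. lra. }
    assert (0 <= eps * Rabs (y - tau)) by nra. nra. }
  split; (split; [apply is_linear_scal_l|]); intros x' Hx' eps;
    assert (E : tau = x') by exact (is_filter_lim_locally_unique tau x' Hx'); subst x';
    destruct (K eps) as [del Hdel]; exists del; intros y Hy;
    specialize (Hdel y Hy).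
  - eapply Rle_trans; [|exact Hdel].
    eapply Rle_trans; [|apply Cmod_fst].
    right. unfold norm; simpl. unfold abs, minus, plus, opp, scal; simpl.
    unfold mult; simpl. f_equal. ring.
  - eapply Rle_trans; [|exact Hdel].
    eapply Rle_trans; [|apply Cmod_snd].
    right. unfold norm; simpl. unfold abs, minus, plus, opp, scal; simpl.
    unfold mult; simpl. f_equal. ring.
Qed.

(** Sums and derivatives live in canonical structures on C that the field
    tactics do not recognize. *)
Ltac toC := match goal with |- @eq _ ?a ?b => change (@eq C a b) end.

(** * The system in terms of iterated derivatives *)

Lemma cover_open (r : R) (s : C) :
  cover r s -> exists d : posreal, forall h, Cmod h < d -> cover r (s + h)%C.
Proof.
  unfold cover. intros H.
  assert (Hr : 0 < r) by (pose proof (exp_pos (fst s)); lra).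
  assert (Hd : 0 < ln r - fst s).
  { apply Rlt_0_minus. rewrite <- (ln_exp (fst s)). apply ln_increasing; auto.
    apply exp_pos. }
  exists (mkposreal _ Hd). simpl. intros h Hh.
  rewrite <- (exp_ln r) by auto. apply exp_increasing.
  pose proof (Cmod_fst h). pose proof (Rle_abs (fst h)). lra.
Qed.

Lemma cover_locally (r : R) (s : C) : cover r s -> locally (T := AbsRing_UniformSpace C_AbsRing) s (cover r).
Proof.
  intros H. destruct (cover_open r s H) as [d Hd].
  exists d. intros y Hy.
  replace y with (s + (y - s))%C by ring. apply Hd. exact Hy.
Qed.

Definition jet (r : R) (F : nat -> nat -> C -> C -> C) : Prop :=
  forall (i j : nat) (s t : C), cover r s -> cover r t ->
    is_derive (fun s' => F i j s' t) s (F (S i) j s t) /\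
    is_derive (fun t' => F i j s t') t (F i (S j) s t).

(** A differential operator with coefficients constant in s and t, as the list
    of its terms (coefficient, order in s, order in t). *)
Definition symbol : Type := list (C * nat * nat).

Fixpoint jet_eval (F : nat -> nat -> C -> C -> C) (p : symbol) (s t : C) : C :=
  match p with
  | nil => 0
  | (c, i, j) :: p' => (c * F i j s t + jet_eval F p' s t)%C
  end.

Definition sym_dx (z : C) (p : symbol) : symbol :=
  map (fun a => match a with (c, i, j) => (z * c, S i, j)%C end) p.
Definition sym_dy (z : C) (p : symbol) : symbol :=
  map (fun a => match a with (c, i, j) => (z * c, i, S j)%C end) p.
Definition sym_scal (b : C) (p : symbol) : symbol :=
  map (fun a => match a with (c, i, j) => (b * c, i, j)%C end) p.
Definition sym_dq1 (z : C) (p : symbol) : symbol :=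
  sym_dy z p ++ sym_scal (-1) (sym_dx z p).
Definition sym_affine (z a b : C) (p : symbol) : symbol :=
  sym_scal a (sym_dq1 z p) ++ sym_scal b p.

Lemma jet_eval_app F p q s t :
  jet_eval F (p ++ q) s t = (jet_eval F p s t + jet_eval F q s t)%C.
Proof. induction p as [|[[c i] j] p IH]; simpl; [|rewrite IH]; ring. Qed.

Lemma jet_eval_scal F b p s t :
  jet_eval F (sym_scal b p) s t = (b * jet_eval F p s t)%C.
Proof. induction p as [|[[c i] j] p IH]; simpl; [|rewrite IH]; ring. Qed.

Lemma jet_eval_derive_x r F z p s t : jet r F -> cover r s -> cover r t ->
  exists l, is_derive (fun s' => jet_eval F p s' t) s l /\
    (z * l)%C = jet_eval F (sym_dx z p) s t.
Proof.
  intros HF Hs Ht. induction p as [|[[c i] j] p [l [IH1 IH2]]]; simpl.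
  - exists (RtoC 0). split; [apply is_C_derive_const | ring].
  - exists (c * F (S i) j s t + l)%C. split.
    + apply is_C_derive_plus; auto. apply is_C_derive_scal. now apply HF.
    + rewrite <- IH2. ring.
Qed.

Lemma jet_eval_derive_y r F z p s t : jet r F -> cover r s -> cover r t ->
  exists l, is_derive (fun t' => jet_eval F p s t') t l /\
    (z * l)%C = jet_eval F (sym_dy z p) s t.
Proof.
  intros HF Hs Ht. induction p as [|[[c i] j] p [l [IH1 IH2]]]; simpl.
  - exists (RtoC 0). split; [apply is_C_derive_const | ring].
  - exists (c * F i (S j) s t + l)%C. split.
    + apply is_C_derive_plus; auto. apply is_C_derive_scal. now apply HF.
    + rewrite <- IH2. ring.
Qed.

Lemma is_derive_cover (r : R) (f g : C -> C) (x l : C) :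
  cover r x -> (forall y, cover r y -> f y = g y) -> is_derive f x l -> is_derive g x l.
Proof.
  intros Hx E H. apply (is_derive_ext_loc f); auto.
  apply (filter_imp (cover r)); [exact E|]. now apply cover_locally.
Qed.

Lemma zdx_jet r F z g p : jet r F ->
  eq2 r g (jet_eval F p) -> eq2 r (zdx z g) (jet_eval F (sym_dx z p)).
Proof.
  intros HF E s t Hs Ht. unfold zdx.
  destruct (jet_eval_derive_x r F z p s t HF Hs Ht) as (l & H & <-). f_equal.
  apply is_C_derive_unique. apply (is_derive_cover r) with (3 := H); auto.
  intros y Hy. symmetry. now apply E.
Qed.

Lemma zdy_jet r F z g p : jet r F ->
  eq2 r g (jet_eval F p) -> eq2 r (zdy z g) (jet_eval F (sym_dy z p)).
Proof.
  intros HF E s t Hs Ht. unfold zdy.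
  destruct (jet_eval_derive_y r F z p s t HF Hs Ht) as (l & H & <-). f_equal.
  apply is_C_derive_unique. apply (is_derive_cover r) with (3 := H); auto.
  intros y Hy. symmetry. now apply E.
Qed.

Lemma zdq1_jet r F z g p : jet r F ->
  eq2 r g (jet_eval F p) -> eq2 r (zdq1 z g) (jet_eval F (sym_dq1 z p)).
Proof.
  intros HF E s t Hs Ht. unfold zdq1, sym_dq1.
  rewrite jet_eval_app, jet_eval_scal.
  rewrite (zdx_jet r F z g p HF E s t Hs Ht), (zdy_jet r F z g p HF E s t Hs Ht).
  ring.
Qed.

Lemma affine_jet r F z a b g p : jet r F ->
  eq2 r g (jet_eval F p) -> eq2 r (affine_zdq1 z a b g) (jet_eval F (sym_affine z a b p)).
Proof.
  intros HF E s t Hs Ht. unfold affine_zdq1, sym_affine.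
  rewrite jet_eval_app, !jet_eval_scal.
  now rewrite (zdq1_jet r F z g p HF E s t Hs Ht), (E s t Hs Ht).
Qed.

(** The powers of z in the first operator cancel: the equations are
    e^s D^3 = 3 (3 D + 1) (3 D + 2) d/ds with D = d/dt - d/ds, and
    d/ds d/dt = e^(s+t) / z^2. *)
Definition jet_system (z : C) (r : R) (F : nat -> nat -> C -> C -> C) : Prop :=
  forall s t, cover r s -> cover r t ->
  (Cexp s * (F 0%nat 3%nat s t - 3 * F 1%nat 2%nat s t + 3 * F 2%nat 1%nat s t
             - F 3%nat 0%nat s t)
   = 3 * (9 * (F 1%nat 2%nat s t - 2 * F 2%nat 1%nat s t + F 3%nat 0%nat s t)
          + 9 * (F 1%nat 1%nat s t - F 2%nat 0%nat s t) + 2 * F 1%nat 0%nat s t))%C /\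
  (F 1%nat 1%nat s t = Cexp s * Cexp t / z ^ 2 * F 0%nat 0%nat s t)%C.

Lemma Delta1_jet r F z f s t : jet r F -> eq2 r (F 0%nat 0%nat) f ->
  cover r s -> cover r t ->
  Delta1 z f s t = (z ^ 3 *
   (Cexp s * (F 0%nat 3%nat s t - 3 * F 1%nat 2%nat s t + 3 * F 2%nat 1%nat s t
             - F 3%nat 0%nat s t)
   - 3 * (9 * (F 1%nat 2%nat s t - 2 * F 2%nat 1%nat s t + F 3%nat 0%nat s t)
          + 9 * (F 1%nat 1%nat s t - F 2%nat 0%nat s t) + 2 * F 1%nat 0%nat s t)))%C.
Proof.
  intros HF E Hs Ht.
  assert (E0 : eq2 r f (jet_eval F ((RtoC 1, 0%nat, 0%nat) :: nil))).
  { intros s' t' Hs' Ht'. simpl. rewrite <- (E s' t' Hs' Ht'). ring. }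
  unfold Delta1.
  rewrite (zdq1_jet r F z _ _ HF (zdq1_jet r F z _ _ HF (zdq1_jet r F z _ _ HF E0))
    s t Hs Ht).
  rewrite (affine_jet r F z _ _ _ _ HF (affine_jet r F z _ _ _ _ HF
    (zdx_jet r F z _ _ HF E0)) s t Hs Ht).
  simpl. ring.
Qed.

Lemma Delta2_jet r F z f s t : jet r F -> eq2 r (F 0%nat 0%nat) f ->
  cover r s -> cover r t ->
  Delta2 z f s t = (z ^ 2 * F 1%nat 1%nat s t - Cexp s * Cexp t * F 0%nat 0%nat s t)%C.
Proof.
  intros HF E Hs Ht.
  assert (E0 : eq2 r f (jet_eval F ((RtoC 1, 0%nat, 0%nat) :: nil))).
  { intros s' t' Hs' Ht'. simpl. rewrite <- (E s' t' Hs' Ht'). ring. }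
  unfold Delta2.
  rewrite (zdy_jet r F z _ _ HF (zdx_jet r F z _ _ HF E0) s t Hs Ht).
  rewrite <- (E s t Hs Ht). simpl. ring.
Qed.

Lemma Hbar_jet (z : C) (r : R) f : z <> RtoC 0 ->
  Hbar z r f <->
  exists F, eq2 r (F 0%nat 0%nat) f /\ jet r F /\ jet_system z r F /\
    forall i j s t, cover r s -> cover r t ->
      continuous (fun p : C * C => F i j (fst p) (snd p)) (s, t).
Proof.
  intros Hz. split.
  - intros [(F & E & HF) Hsys].
    assert (HJ : jet r F) by (intros i j s t Hs Ht; now apply HF).
    exists F. split; [exact E|]. split; [exact HJ|].
    split; [intros s t H H0; split|].
    + destruct (Hsys s t H H0) as [H1 _].
      rewrite (Delta1_jet r F z f s t HJ E H H0) in H1.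
      apply Ceq_minus. destruct (Ceq_dec
        (Cexp s * (F 0%nat 3%nat s t - 3 * F 1%nat 2%nat s t + 3 * F 2%nat 1%nat s t
             - F 3%nat 0%nat s t)
   - 3 * (9 * (F 1%nat 2%nat s t - 2 * F 2%nat 1%nat s t + F 3%nat 0%nat s t)
          + 9 * (F 1%nat 1%nat s t - F 2%nat 0%nat s t) + 2 * F 1%nat 0%nat s t))%C 0)
        as [E1|N]; [exact E1|].
      exfalso. exact (Cmult_neq_0 _ _ (Cpow_nz z 3 Hz) N H1).
    + destruct (Hsys s t H H0) as [_ H2].
      rewrite (Delta2_jet r F z f s t HJ E H H0) in H2.
      apply Ceq_minus in H2.
      replace (Cexp s * Cexp t / z ^ 2 * F 0%nat 0%nat s t)%C
        with ((Cexp s * Cexp t * F 0%nat 0%nat s t) / z ^ 2)%C by (field; auto).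
      rewrite <- H2. field; auto.
    + intros i j s t Hs Ht. now apply HF.
  - intros (F & E & HJ & Hsys & HC). split.
    + exists F. split; [exact E|]. intros i j s t Hs Ht. split; [|split].
      * now apply HC.
      * now apply HJ.
      * now apply HJ.
    + intros s t Hs Ht. destruct (Hsys s t Hs Ht) as [H1 H2]. split.
      * rewrite (Delta1_jet r F z f s t HJ E Hs Ht), H1. ring.
      * rewrite (Delta2_jet r F z f s t HJ E Hs Ht), H2. field; auto.
Qed.

(** * The solution space *)

Lemma Hbar_ext (z : C) (r : R) f g : z <> RtoC 0 -> eq2 r f g -> Hbar z r f -> Hbar z r g.
Proof.
  intros Hz E H. apply Hbar_jet in H; auto. apply Hbar_jet; auto.
  destruct H as (F & E0 & H). exists F. split; auto.
  intros s t Hs Ht. rewrite (E0 s t Hs Ht). now apply E.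
Qed.

Lemma Hbar_lincomb (z : C) (r : R) a b f g : z <> RtoC 0 -> Hbar z r f -> Hbar z r g ->
  Hbar z r (fun s t => a * f s t + b * g s t)%C.
Proof.
  intros Hz Hf Hg. apply Hbar_jet in Hf, Hg; auto. apply Hbar_jet; auto.
  destruct Hf as (F & EF & JF & SF & CF). destruct Hg as (G & EG & JG & SG & CG).
  exists (fun i j s t => a * F i j s t + b * G i j s t)%C.
  split; [|split; [|split]];
    [|intros i j s t H H0; split|intros s t H H0; split|].
  - intros s t Hs Ht. now rewrite (EF s t Hs Ht), (EG s t Hs Ht).
  - apply is_C_derive_plus; apply is_C_derive_scal; [apply JF|apply JG]; auto.
  - apply is_C_derive_plus; apply is_C_derive_scal; [apply JF|apply JG]; auto.
  - destruct (SF s t H H0) as [H1 _], (SG s t H H0) as [H2 _].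
    match type of H1 with ?L = ?R => match type of H2 with ?L' = ?R' =>
      transitivity (a * L + b * L')%C; [ring | rewrite H1, H2; ring] end end.
  - destruct (SF s t H H0) as [_ H1], (SG s t H H0) as [_ H2].
    rewrite H1, H2. unfold Cdiv. ring.
  - intros i j s t Hs Ht.
    exact (continuous_plus (fun p : C * C => a * F i j (fst p) (snd p))%C
       (fun p : C * C => b * G i j (fst p) (snd p))%C (s, t)
       (continuous_scal_r (V := C_NormedModule) a _ _ (CF i j s t Hs Ht))
       (continuous_scal_r (V := C_NormedModule) b _ _ (CG i j s t Hs Ht))).
Qed.

Lemma Hbar_zero (z : C) (r : R) : z <> RtoC 0 -> Hbar z r (fun _ _ => RtoC 0).
Proof.
  intros Hz. apply Hbar_jet; auto. exists (fun _ _ _ _ => RtoC 0).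
  split; [|split; [|split]];
    [|intros i j s t H H0; split|intros s t H H0; split|].
  - intros s t _ _. reflexivity.
  - apply is_C_derive_const.
  - apply is_C_derive_const.
  - ring.
  - unfold Cdiv; ring.
  - intros. apply continuous_const.
Qed.

Lemma cover_shift (r : R) (s a : C) : fst a = 0 -> (cover r (s + a)%C <-> cover r s).
Proof. intros Ha. unfold cover; simpl. now rewrite Ha, Rplus_0_r. Qed.

Lemma is_C_derive_shift (f : C -> C) (x a l : C) :
  is_derive f (x + a)%C l -> is_derive (fun y => f (y + a)%C) x l.
Proof.
  intros H. rewrite is_C_derive_eps in H |- *. intros eps.
  destruct (H eps) as [d Hd]. exists d. intros y Hy.
  specialize (Hd (y + a)%C).
  replace (y + a - (x + a))%C with (y - x)%C in Hd by ring. auto.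
Qed.

(** The coefficients of the system involve s and t only through e^s and e^t, so it
    is invariant under the deck transformations of the universal cover. *)
Lemma Hbar_shift (z : C) (r : R) (a b : C) f : z <> RtoC 0 ->
  fst a = 0 -> Cexp a = 1 -> fst b = 0 -> Cexp b = 1 ->
  Hbar z r f -> Hbar z r (fun s t => f (s + a)%C (t + b)%C).
Proof.
  intros Hz Ha Ea Hb Eb H. apply Hbar_jet in H; auto. apply Hbar_jet; auto.
  destruct H as (F & EF & JF & SF & CF).
  exists (fun i j s t => F i j (s + a)%C (t + b)%C).
  assert (Hca : forall s, cover r s -> cover r (s + a)%C)
    by (intros; now apply cover_shift).
  assert (Hcb : forall s, cover r s -> cover r (s + b)%C)
    by (intros; now apply cover_shift).
  split; [|split; [|split]];
    [|intros i j s t H H0; split|intros s t H H0; split|].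
  - intros s t Hs Ht. apply EF; auto.
  - apply (is_C_derive_shift (fun s => F i j s (t + b)%C)). apply JF; auto.
  - apply (is_C_derive_shift (fun t => F i j (s + a)%C t)). apply JF; auto.
  - destruct (SF (s + a)%C (t + b)%C) as [H1 _]; auto.
    rewrite <- H1, Cexp_add, Ea. ring.
  - destruct (SF (s + a)%C (t + b)%C) as [_ H1]; auto.
    rewrite H1, !Cexp_add, Ea, Eb. unfold Cdiv; ring.
  - intros i j s t Hs Ht.
    apply (continuous_comp_2 (fun p : C * C => fst p + a)%C (fun p : C * C => snd p + b)%C
      (F i j) (s, t)); [| |apply (CF i j (s + a)%C (t + b)%C); auto].
    + exact (continuous_plus (fun p : C * C => fst p) (fun _ => a) (s, t)
        (continuous_fst s t) (continuous_const a (s,t))).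
    + exact (continuous_plus (fun p : C * C => snd p) (fun _ => b) (s, t)
        (continuous_snd s t) (continuous_const b (s,t))).
Qed.

(** * A solution is determined by six of its derivatives at a point *)

Lemma sum_n_nonneg (a : nat -> R) (n : nat) :
  (forall k, (k <= n)%nat -> 0 <= a k) -> 0 <= sum_n a n.
Proof.
  intros H. induction n as [|n IH].
  - rewrite sum_O. apply H; lia.
  - rewrite sum_Sn. apply Rplus_le_le_0_compat; [apply IH; intros; apply H; lia|apply H; lia].
Qed.

Lemma sum_n_le_loc (a b : nat -> R) (n : nat) :
  (forall k, (k <= n)%nat -> a k <= b k) -> sum_n a n <= sum_n b n.
Proof.
  intros H. induction n as [|n IH].
  - rewrite !sum_O. apply H; lia.
  - rewrite !sum_Sn. apply Rplus_le_compat; [apply IH; intros; apply H; lia|apply H; lia].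
Qed.

Lemma sum_n_ge_term (a : nat -> R) (n k : nat) :
  (forall k, (k <= n)%nat -> 0 <= a k) -> (k <= n)%nat -> a k <= sum_n a n.
Proof.
  intros H Hk. induction n as [|n IH].
  - rewrite sum_O. replace k with 0%nat by lia. lra.
  - rewrite sum_Sn. change plus with Rplus.
    destruct (Nat.eq_dec k (S n)) as [->|N].
    + pose proof (sum_n_nonneg a n ltac:(intros; apply H; lia)). lra.
    + specialize (IH ltac:(intros; apply H; lia) ltac:(lia)).
      pose proof (H (S n) ltac:(lia)). lra.
Qed.

Lemma sum_n_R_mult (a : nat -> R) (c : R) (n : nat) :
  sum_n (fun k => c * a k) n = c * sum_n a n.
Proof. exact (sum_n_mult_l (K := R_Ring) c a n). Qed.

Lemma Cmod_sqr (w : C) : Cmod w ^ 2 = fst w ^ 2 + snd w ^ 2.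
Proof. exact (Cmod2_alt w). Qed.

Lemma is_derive_sum_sqr (p q : R -> R) (x p' q' : R) :
  is_derive p x p' -> is_derive q x q' ->
  is_derive (fun t => p t ^ 2 + q t ^ 2) x (2 * (p x * p' + q x * q')).
Proof.
  intros H1 H2. auto_derive.
  - split; [eexists; exact H1|]. split; [eexists; exact H2|auto].
  - change (Derive (fun x => p x) x) with (Derive p x).
    change (Derive (fun x => q x) x) with (Derive q x).
    rewrite (is_derive_unique _ _ _ H1), (is_derive_unique _ _ _ H2). ring.
Qed.

Lemma is_derive_mult_exp (p : R -> R) (L x p' : R) :
  is_derive p x p' ->
  is_derive (fun t => p t * exp (- (L * t))) x ((p' - L * p x) * exp (- (L * x))).
Proof.
  intros H. auto_derive.
  - eexists; exact H.
  - change (Derive (fun x => p x) x) with (Derive p x).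
    rewrite (is_derive_unique _ _ _ H). ring.
Qed.

(** The sum N of the squared moduli satisfies N' <= L N, so N e^(- L tau) cannot
    grow from its initial value 0. *)
Lemma gronwall_zero (n : nat) (phi psi : nat -> R -> C) (K : R) :
  (forall k tau, (k <= n)%nat -> 0 <= tau <= 1 ->
     is_derive (fun t => fst (phi k t)) tau (fst (psi k tau)) /\
     is_derive (fun t => snd (phi k t)) tau (snd (psi k tau)) /\
     Cmod (psi k tau) <= K * sum_n (fun j => Cmod (phi j tau)) n) ->
  (forall k, (k <= n)%nat -> phi k 0 = 0) ->
  forall k, (k <= n)%nat -> phi k 1 = 0.
Proof.
  intros H H0.
  set (N := fun tau => sum_n (fun k => fst (phi k tau) ^ 2 + snd (phi k tau) ^ 2) n).
  set (N' := fun tau => sum_n (fun k => 2 * (fst (phi k tau) * fst (psi k tau)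
                                   + snd (phi k tau) * snd (psi k tau))) n).
  assert (HN0 : forall tau, 0 <= N tau).
  { intros tau. apply sum_n_nonneg. intros; nra. }
  assert (HN : forall tau, 0 <= tau <= 1 -> is_derive N tau (N' tau)).
  { intros tau Ht. apply (is_derive_sum_n (K := R_AbsRing) (V := R_NormedModule)).
    intros k Hk. destruct (H k tau Hk Ht) as (H1 & H2 & _).
    exact (is_derive_sum_sqr _ _ _ _ _ H1 H2). }
  set (m := INR (S n)).
  set (L := 2 * Rabs K * m ^ 2).
  assert (HL : forall tau, 0 <= tau <= 1 -> N' tau <= L * N tau).
  { intros tau Ht. set (S1 := sum_n (fun j => Cmod (phi j tau)) n).
    assert (HS0 : 0 <= S1) by (apply sum_n_nonneg; intros; apply Cmod_ge_0).
    assert (HS : S1 <= m * sqrt (N tau)).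
    { unfold m. rewrite <- sum_n_const. apply sum_n_le_loc. intros k Hk.
      rewrite <- (sqrt_pow2 (Cmod (phi k tau))) by apply Cmod_ge_0.
      apply sqrt_le_1_alt. rewrite Cmod_sqr.
      apply (sum_n_ge_term (fun k => fst (phi k tau) ^ 2 + snd (phi k tau) ^ 2)); auto.
      intros; nra. }
    assert (HS2 : S1 ^ 2 <= m ^ 2 * N tau).
    { rewrite <- (pow2_sqrt (N tau)) by auto. pose proof (sqrt_pos (N tau)).
      rewrite <- Rpow_mult_distr. apply pow_incr. lra. }
    apply Rle_trans with (2 * Rabs K * S1 ^ 2).
    - replace (2 * Rabs K * S1 ^ 2) with (2 * Rabs K * S1 * S1) by ring.
      unfold S1 at 2.
      rewrite <- sum_n_R_mult. apply sum_n_le_loc. intros k Hk.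
      destruct (H k tau Hk Ht) as (_ & _ & H3). fold S1 in H3.
      set (a := fst (phi k tau)). set (b := snd (phi k tau)).
      set (c := fst (psi k tau)) in *. set (d := snd (psi k tau)) in *.
      assert (a * c + b * d <= Cmod (phi k tau) * Cmod (psi k tau)).
      { eapply Rle_trans; [|apply Rle_trans with
          (1 := Cmod_fst (Cconj (phi k tau) * psi k tau)%C)].
        - replace (a * c + b * d) with (fst (Cconj (phi k tau) * psi k tau)%C).
          apply Rle_abs. unfold a, b, c, d, Cconj, Cmult; simpl. ring.
        - rewrite Cmod_mult, Cmod_conj. lra. }
      assert (Cmod (psi k tau) <= Rabs K * S1).
      { eapply Rle_trans; [exact H3|]. apply Rmult_le_compat_r; auto. apply Rle_abs. }
      pose proof (Cmod_ge_0 (phi k tau)). nra.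
    - unfold L. pose proof (Rabs_pos K). nra. }
  set (M := fun tau => N tau * exp (- (L * tau))).
  assert (HM : forall tau, 0 <= tau <= 1 ->
     is_derive M tau ((N' tau - L * N tau) * exp (- (L * tau)))).
  { intros tau Ht. unfold M. pose proof (HN tau Ht) as D.
    exact (is_derive_mult_exp _ _ _ _ D). }
  assert (HM1 : M 1 <= 0).
  { destruct (MVT_gen M 0 1 (fun tau => (N' tau - L * N tau) * exp (- (L * tau))))
      as (c & Hc & E).
    - rewrite Rmin_left, Rmax_right by lra. intros; apply HM; lra.
    - rewrite Rmin_left, Rmax_right by lra. intros x Hx.
      apply derivable_continuous_pt.
      exists ((N' x - L * N x) * exp (- (L * x))).
      apply is_derive_Reals. apply HM; lra.
    - rewrite Rmin_left, Rmax_right in Hc by lra.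
      assert (EM : M 0 = 0).
      { unfold M. replace (N 0) with 0; [ring|]. unfold N.
        rewrite (sum_n_ext_loc _ (fun _ => 0)).
        - rewrite sum_n_const. ring.
        - intros k Hk. rewrite (H0 k Hk). simpl. ring. }
      specialize (HL c Hc). pose proof (exp_pos (- (L * c))).
      rewrite EM in E. nra. }
  assert (HN1 : N 1 = 0).
  { unfold M in HM1. pose proof (exp_pos (- (L * 1))). specialize (HN0 1). nra. }
  intros k Hk. apply Cmod_eq_0.
  assert (Cmod (phi k 1) ^ 2 <= 0).
  { rewrite Cmod_sqr, <- HN1.
    apply (sum_n_ge_term (fun k => fst (phi k 1) ^ 2 + snd (phi k 1) ^ 2)); auto.
    intros; nra. }
  pose proof (Cmod_ge_0 (phi k 1)). nra.
Qed.

Lemma is_derive_cover_eq (r : R) (f g : C -> C) (x l l' : C) :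
  cover r x -> (forall y, cover r y -> f y = g y) ->
  is_derive f x l -> is_derive g x l' -> l = l'.
Proof.
  intros Hx E Hf Hg. apply (is_derive_cover r _ g) in Hf; auto.
  rewrite <- (is_C_derive_unique _ _ _ Hf). now apply is_C_derive_unique.
Qed.

Definition coef_w (z s t : C) : C := (Cexp s * Cexp t / z ^ 2)%C.

Lemma coef_w_derive_x z s t g l : is_derive g s l ->
  is_derive (fun s => coef_w z s t * g s)%C s (coef_w z s t * (g s + l))%C.
Proof.
  intros H. replace (coef_w z s t * (g s + l))%C
    with (coef_w z s t * g s + coef_w z s t * l)%C by ring.
  apply (is_C_derive_mult (fun s => coef_w z s t) g s (coef_w z s t) l); auto.
  apply (is_derive_ext (fun s => Cexp t / z ^ 2 * Cexp s)%C).
  - intros u. unfold coef_w, Cdiv. toC. ring.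
  - unfold coef_w. replace (Cexp s * Cexp t / z ^ 2)%C with (Cexp t / z ^ 2 * Cexp s)%C
      by (unfold Cdiv; ring).
    apply is_C_derive_scal, is_C_derive_Cexp.
Qed.

Lemma coef_w_derive_y z s t g l : is_derive g t l ->
  is_derive (fun t => coef_w z s t * g t)%C t (coef_w z s t * (g t + l))%C.
Proof.
  intros H. replace (coef_w z s t * (g t + l))%C
    with (coef_w z s t * g t + coef_w z s t * l)%C by ring.
  apply (is_C_derive_mult (fun t => coef_w z s t) g t (coef_w z s t) l); auto.
  apply (is_derive_ext (fun t => Cexp s / z ^ 2 * Cexp t)%C).
  - intros u. unfold coef_w, Cdiv. toC. ring.
  - unfold coef_w. replace (Cexp s * Cexp t / z ^ 2)%C with (Cexp s / z ^ 2 * Cexp t)%C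
      by (unfold Cdiv; ring).
    apply is_C_derive_scal, is_C_derive_Cexp.
Qed.

Local Open Scope nat_scope.

Lemma jet_11 z r F : jet r F -> jet_system z r F -> forall s t, cover r s -> cover r t ->
  F 1 1 s t = (coef_w z s t * F 0 0 s t)%C.
Proof. intros HJ HS s t Hs Ht. now apply HS. Qed.

(** Differentiating the second equation eliminates every mixed derivative. *)
Lemma jet_21 z r F : jet r F -> jet_system z r F -> forall s t, cover r s -> cover r t ->
  F 2 1 s t = (coef_w z s t * (F 0 0 s t + F 1 0 s t))%C.
Proof.
  intros HJ HS s t Hs Ht.
  apply (is_derive_cover_eq r (fun s => F 1 1 s t) (fun s => coef_w z s t * F 0 0 s t)%C s);
    auto.
  - intros y Hy. now apply (jet_11 z r F).
  - now apply HJ.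
  - apply (coef_w_derive_x z s t (fun s => F 0 0 s t)). now apply HJ.
Qed.

Lemma jet_12 z r F : jet r F -> jet_system z r F -> forall s t, cover r s -> cover r t ->
  F 1 2 s t = (coef_w z s t * (F 0 0 s t + F 0 1 s t))%C.
Proof.
  intros HJ HS s t Hs Ht.
  apply (is_derive_cover_eq r (F 1 1 s) (fun t => coef_w z s t * F 0 0 s t)%C t); auto.
  - intros y Hy. now apply (jet_11 z r F).
  - now apply HJ.
  - apply (coef_w_derive_y z s t (fun t => F 0 0 s t)). now apply HJ.
Qed.

Lemma jet_13 z r F : jet r F -> jet_system z r F -> forall s t, cover r s -> cover r t ->
  F 1 3 s t = (coef_w z s t * (F 0 0 s t + RtoC 2 * F 0 1 s t + F 0 2 s t))%C.
Proof.
  intros HJ HS s t Hs Ht.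
  replace (F 0 0 s t + RtoC 2 * F 0 1 s t + F 0 2 s t)%C
    with ((F 0 0 s t + F 0 1 s t) + (F 0 1 s t + F 0 2 s t))%C by ring.
  apply (is_derive_cover_eq r (F 1 2 s)
    (fun t => coef_w z s t * (F 0 0 s t + F 0 1 s t))%C t); auto.
  - intros y Hy. now apply (jet_12 z r F).
  - now apply HJ.
  - apply (coef_w_derive_y z s t (fun t => F 0 0 s t + F 0 1 s t)%C).
    apply is_C_derive_plus; now apply HJ.
Qed.

Lemma jet_31 z r F : jet r F -> jet_system z r F -> forall s t, cover r s -> cover r t ->
  F 3 1 s t = (coef_w z s t * (F 0 0 s t + RtoC 2 * F 1 0 s t + F 2 0 s t))%C.
Proof.
  intros HJ HS s t Hs Ht.
  replace (F 0 0 s t + RtoC 2 * F 1 0 s t + F 2 0 s t)%C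
    with ((F 0 0 s t + F 1 0 s t) + (F 1 0 s t + F 2 0 s t))%C by ring.
  apply (is_derive_cover_eq r (fun s => F 2 1 s t)
    (fun s => coef_w z s t * (F 0 0 s t + F 1 0 s t))%C s); auto.
  - intros y Hy. now apply (jet_21 z r F).
  - now apply HJ.
  - apply (coef_w_derive_x z s t (fun s => F 0 0 s t + F 1 0 s t)%C).
    apply is_C_derive_plus; now apply HJ.
Qed.

Lemma jet_22 z r F : jet r F -> jet_system z r F -> forall s t, cover r s -> cover r t ->
  F 2 2 s t = (coef_w z s t * (F 0 0 s t + F 1 0 s t + F 0 1 s t
                               + coef_w z s t * F 0 0 s t))%C.
Proof.
  intros HJ HS s t Hs Ht. rewrite <- (jet_11 z r F HJ HS s t Hs Ht).
  replace (F 0 0 s t + F 1 0 s t + F 0 1 s t + F 1 1 s t)%C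
    with ((F 0 0 s t + F 1 0 s t) + (F 0 1 s t + F 1 1 s t))%C by ring.
  apply (is_derive_cover_eq r (F 2 1 s)
    (fun t => coef_w z s t * (F 0 0 s t + F 1 0 s t))%C t); auto.
  - intros y Hy. now apply (jet_21 z r F).
  - now apply HJ.
  - apply (coef_w_derive_y z s t (fun t => F 0 0 s t + F 1 0 s t)%C).
    apply is_C_derive_plus; now apply HJ.
Qed.

(** The coefficient 27 + e^s of the highest x-derivative does not vanish, since
    |e^s| < r <= 27. *)
Lemma jet_30 z r F : (r <= 27)%R -> jet r F -> jet_system z r F ->
  forall s t, cover r s -> cover r t ->
  F 3 0 s t = (/ (RtoC 27 + Cexp s) *
    (Cexp s * (F 0 3 s t - RtoC 3 * F 1 2 s t + RtoC 3 * F 2 1 s t)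
     - RtoC 27 * F 1 2 s t + RtoC 54 * F 2 1 s t - RtoC 27 * F 1 1 s t + RtoC 27 * F 2 0 s t - RtoC 6 * F 1 0 s t))%C.
Proof.
  intros Hr HJ HS s t Hs Ht.
  assert (N : (RtoC 27 + Cexp s)%C <> RtoC 0).
  { intros E. assert (E' : Cexp s = (- RtoC 27)%C).
    { replace (Cexp s) with (RtoC 27 + Cexp s - RtoC 27)%C by ring. rewrite E. ring. }
    apply (f_equal Cmod) in E'. rewrite Cmod_Cexp, Cmod_opp, Cmod_R in E'.
    rewrite Rabs_right in E' by lra. unfold cover in Hs. lra. }
  destruct (HS s t Hs Ht) as [H1 _].
  set (X := (Cexp s * (F 0 3 s t - RtoC 3 * F 1 2 s t + RtoC 3 * F 2 1 s t)
     - RtoC 27 * F 1 2 s t + RtoC 54 * F 2 1 s t - RtoC 27 * F 1 1 s t + RtoC 27 * F 2 0 s t - RtoC 6 * F 1 0 s t)%C).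
  assert (E : X = ((RtoC 27 + Cexp s) * F 3 0 s t)%C).
  { apply Ceq_minus. apply Ceq_minus in H1.
    unfold X. rewrite <- H1. ring. }
  rewrite E. field. exact N.
Qed.

(** This is the t-derivative of the first equation, divided by its leading
    coefficient e^s. *)
Lemma jet_04 z r F : jet r F -> jet_system z r F ->
  forall s t, cover r s -> cover r t ->
  F 0 4 s t = (RtoC 3 * F 1 3 s t - RtoC 3 * F 2 2 s t + F 3 1 s t
    + / Cexp s * (RtoC 27 * (F 1 3 s t - RtoC 2 * F 2 2 s t + F 3 1 s t)
       + RtoC 27 * (F 1 2 s t - F 2 1 s t) + RtoC 6 * F 1 1 s t))%C.
Proof.
  intros HJ HS s t Hs Ht.
  assert (H1 : (Cexp s * (F 0 4 s t + RtoC (-3) * F 1 3 s t + RtoC 3 * F 2 2 s t + RtoC (-1) * F 3 1 s t)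
    = RtoC 27 * F 1 3 s t + RtoC (-54) * F 2 2 s t + RtoC 27 * F 3 1 s t
          + RtoC 27 * F 1 2 s t + RtoC (-27) * F 2 1 s t + RtoC 6 * F 1 1 s t)%C).
  { apply (is_derive_cover_eq r
     (fun t => Cexp s * (F 0 3 s t + RtoC (-3) * F 1 2 s t + RtoC 3 * F 2 1 s t + RtoC (-1) * F 3 0 s t))%C
     (fun t => RtoC 27 * F 1 2 s t + RtoC (-54) * F 2 1 s t + RtoC 27 * F 3 0 s t
          + RtoC 27 * F 1 1 s t + RtoC (-27) * F 2 0 s t + RtoC 6 * F 1 0 s t)%C t); auto.
    - intros y Hy. destruct (HS s y Hs Hy) as [H1 _].
      apply Ceq_minus. apply Ceq_minus in H1. rewrite <- H1. ring.
    - apply is_C_derive_scal.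
      repeat apply is_C_derive_plus; try apply is_C_derive_scal; now apply HJ.
    - repeat apply is_C_derive_plus; try apply is_C_derive_scal; now apply HJ. }
  pose proof (Cexp_neq_0 s) as N.
  replace (RtoC 27 * (F 1 3 s t - RtoC 2 * F 2 2 s t + F 3 1 s t)
       + RtoC 27 * (F 1 2 s t - F 2 1 s t) + RtoC 6 * F 1 1 s t)%C with
    (Cexp s * (F 0 4 s t + RtoC (-3) * F 1 3 s t + RtoC 3 * F 2 2 s t + RtoC (-1) * F 3 1 s t))%C
    by (rewrite H1; ring).
  field. exact N.
Qed.

(** The unknown vector of the equivalent Pfaffian system: the first equation
    eliminates F 3 0 and its t-derivative eliminates F 0 4. *)
Definition basic (F : nat -> nat -> C -> C -> C) (k : nat) : C -> C -> C :=
  match k with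
  | 0 => F 0 0 | 1 => F 1 0 | 2 => F 0 1 | 3 => F 2 0 | 4 => F 0 2 | _ => F 0 3
  end.

Definition basic_dx (F : nat -> nat -> C -> C -> C) (k : nat) : C -> C -> C :=
  match k with
  | 0 => F 1 0 | 1 => F 2 0 | 2 => F 1 1 | 3 => F 3 0 | 4 => F 1 2 | _ => F 1 3
  end.

Definition basic_dy (F : nat -> nat -> C -> C -> C) (k : nat) : C -> C -> C :=
  match k with
  | 0 => F 0 1 | 1 => F 1 1 | 2 => F 0 2 | 3 => F 2 1 | 4 => F 0 3 | _ => F 0 4
  end.

Local Open Scope R_scope.

Definition bounded (c : R -> C) : Prop :=
  exists M, forall tau, 0 <= tau <= 1 -> Cmod (c tau) <= M.

Definition dominated (N : R -> R) (x : R -> C) : Prop :=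
  exists K, forall tau, 0 <= tau <= 1 -> Cmod (x tau) <= K * N tau.

Lemma bounded_const c : bounded (fun _ => c).
Proof. exists (Cmod c). intros. lra. Qed.

Lemma bounded_mult c d : bounded c -> bounded d -> bounded (fun tau => c tau * d tau)%C.
Proof.
  intros [M1 H1] [M2 H2]. exists (M1 * M2). intros tau Ht. rewrite Cmod_mult.
  apply Rmult_le_compat; auto using Cmod_ge_0.
Qed.

Lemma dominated_plus N x y : dominated N x -> dominated N y ->
  dominated N (fun tau => x tau + y tau)%C.
Proof.
  intros [K1 H1] [K2 H2]. exists (K1 + K2). intros tau Ht.
  eapply Rle_trans; [apply Cmod_triangle|].
  specialize (H1 tau Ht). specialize (H2 tau Ht). lra.
Qed.

Lemma dominated_mult N c x : bounded c -> dominated N x ->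
  dominated N (fun tau => c tau * x tau)%C.
Proof.
  intros [M H1] [K H2]. exists (M * K). intros tau Ht.
  rewrite Cmod_mult, Rmult_assoc.
  apply Rmult_le_compat; auto using Cmod_ge_0.
Qed.

Lemma dominated_minus N x y : dominated N x -> dominated N y ->
  dominated N (fun tau => x tau - y tau)%C.
Proof.
  intros [K1 H1] [K2 H2]. exists (K1 + K2). intros tau Ht.
  eapply Rle_trans; [apply Cmod_triangle|]. rewrite Cmod_opp.
  specialize (H1 tau Ht). specialize (H2 tau Ht). lra.
Qed.

Lemma dominated_ext N x y : (forall tau, 0 <= tau <= 1 -> x tau = y tau) ->
  dominated N x -> dominated N y.
Proof. intros E [K H]. exists K. intros tau Ht. rewrite <- E; auto. Qed.

Lemma dominated_sum (n k : nat) (phi : nat -> R -> C) : (k <= n)%nat ->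
  dominated (fun tau => sum_n (fun j => Cmod (phi j tau)) n) (phi k).
Proof.
  intros Hk. exists 1. intros tau _. rewrite Rmult_1_l.
  apply (sum_n_ge_term (fun j => Cmod (phi j tau))); auto.
  intros; apply Cmod_ge_0.
Qed.

Lemma dominated_uniform (n : nat) N (psi : nat -> R -> C) :
  (forall tau, 0 <= N tau) ->
  (forall k, (k <= n)%nat -> dominated N (psi k)) ->
  exists K, forall k tau, (k <= n)%nat -> 0 <= tau <= 1 -> Cmod (psi k tau) <= K * N tau.
Proof.
  intros HN. induction n as [|n IH]; intros H.
  - destruct (H 0%nat (le_n _)) as [K HK]. exists K. intros k tau Hk.
    replace k with 0%nat by lia. auto.
  - destruct IH as [K1 HK1]; [intros; apply H; lia|].
    destruct (H (S n) (le_n _)) as [K2 HK2].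
    exists (Rmax K1 K2). intros k tau Hk Ht.
    destruct (Nat.eq_dec k (S n)) as [->|Nk].
    + eapply Rle_trans; [now apply HK2|]. apply Rmult_le_compat_r; auto. apply Rmax_r.
    + eapply Rle_trans; [apply HK1; auto; lia|].
      apply Rmult_le_compat_r; auto. apply Rmax_l.
Qed.

(** The coefficients of the Pfaffian system are polynomials in e^s, e^t, e^(-s) and
    1 / (27 + e^s), and these are bounded along the path. *)
Lemma pfaffian_dominated z r F (sg th : R -> C) :
  r <= 27 -> jet r F -> jet_system z r F ->
  (forall tau, 0 <= tau <= 1 -> cover r (sg tau)) ->
  (forall tau, 0 <= tau <= 1 -> cover r (th tau)) ->
  bounded (fun tau => Cexp (sg tau)) -> bounded (fun tau => Cexp (th tau)) ->
  bounded (fun tau => / (27 + Cexp (sg tau)))%C ->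
  bounded (fun tau => / Cexp (sg tau))%C ->
  forall k, (k <= 5)%nat ->
  dominated (fun tau => sum_n (fun j => Cmod (basic F j (sg tau) (th tau))) 5)
    (fun tau => basic_dx F k (sg tau) (th tau)) /\
  dominated (fun tau => sum_n (fun j => Cmod (basic F j (sg tau) (th tau))) 5)
    (fun tau => basic_dy F k (sg tau) (th tau)).
Proof.
  intros Hr HJ HS Hsg Hth B1 B2 B3 B4.
  set (N := fun tau => sum_n (fun j => Cmod (basic F j (sg tau) (th tau))) 5).
  assert (Hb : forall k, (k <= 5)%nat -> dominated N (fun tau => basic F k (sg tau) (th tau))).
  { intros k Hk. exact (dominated_sum 5 k (fun k tau => basic F k (sg tau) (th tau)) Hk). }
  pose proof (Hb 0%nat ltac:(lia)) as D00. pose proof (Hb 1%nat ltac:(lia)) as D10.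
  pose proof (Hb 2%nat ltac:(lia)) as D01. pose proof (Hb 3%nat ltac:(lia)) as D20.
  pose proof (Hb 4%nat ltac:(lia)) as D02. pose proof (Hb 5%nat ltac:(lia)) as D03.
  simpl in D00, D10, D01, D20, D02, D03.
  assert (BW : bounded (fun tau => coef_w z (sg tau) (th tau))).
  { unfold coef_w, Cdiv. apply bounded_mult; [|apply bounded_const].
    now apply bounded_mult. }
  assert (D11 : dominated N (fun tau => F 1%nat 1%nat (sg tau) (th tau))).
  { eapply dominated_ext; [intros tau Ht; symmetry; apply (jet_11 z r F); auto|].
    now apply dominated_mult. }
  assert (D21 : dominated N (fun tau => F 2%nat 1%nat (sg tau) (th tau))).
  { eapply dominated_ext; [intros tau Ht; symmetry; apply (jet_21 z r F); auto|].
    apply dominated_mult; auto. now apply dominated_plus. }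
  assert (D12 : dominated N (fun tau => F 1%nat 2%nat (sg tau) (th tau))).
  { eapply dominated_ext; [intros tau Ht; symmetry; apply (jet_12 z r F); auto|].
    apply dominated_mult; auto. now apply dominated_plus. }
  assert (D13 : dominated N (fun tau => F 1%nat 3%nat (sg tau) (th tau))).
  { eapply dominated_ext; [intros tau Ht; symmetry; apply (jet_13 z r F); auto|].
    repeat first [apply dominated_plus | apply dominated_mult | apply bounded_const]; auto. }
  assert (D31 : dominated N (fun tau => F 3%nat 1%nat (sg tau) (th tau))).
  { eapply dominated_ext; [intros tau Ht; symmetry; apply (jet_31 z r F); auto|].
    repeat first [apply dominated_plus | apply dominated_mult | apply bounded_const]; auto. }
  assert (D22 : dominated N (fun tau => F 2%nat 2%nat (sg tau) (th tau))).
  { eapply dominated_ext; [intros tau Ht; symmetry; apply (jet_22 z r F); auto|].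
    repeat first [apply dominated_plus | apply dominated_mult]; auto. }
  assert (D30 : dominated N (fun tau => F 3%nat 0%nat (sg tau) (th tau))).
  { eapply dominated_ext; [intros tau Ht; symmetry; apply (jet_30 z r F); auto|].
    repeat first [apply dominated_minus | apply dominated_plus
      | apply dominated_mult | apply bounded_const]; auto. }
  assert (D04 : dominated N (fun tau => F 0%nat 4%nat (sg tau) (th tau))).
  { eapply dominated_ext; [intros tau Ht; symmetry; apply (jet_04 z r F); auto|].
    repeat first [apply dominated_minus | apply dominated_plus
      | apply dominated_mult | apply bounded_const]; auto. }
  intros k Hk. do 6 (destruct k as [|k]; [split; simpl; assumption|]). lia.
Qed.

Lemma exp_le (a b : R) : a <= b -> exp a <= exp b.
Proof. intros [H | ->]; [left; now apply exp_increasing | right; reflexivity]. Qed.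

Lemma bounded_Cexp_segment (s d : C) : bounded (fun tau => Cexp (s + tau * d)).
Proof.
  exists (exp (Rabs (fst s) + Rabs (fst d))). intros tau Ht. rewrite Cmod_Cexp.
  apply exp_le. simpl. pose proof (Rle_abs (fst s)). pose proof (Rle_abs (fst d)).
  pose proof (Rabs_pos (fst d)). nra.
Qed.

Lemma bounded_inv_Cexp_segment (s d : C) : bounded (fun tau => / Cexp (s + tau * d))%C.
Proof.
  exists (exp (Rabs (fst s) + Rabs (fst d))). intros tau Ht.
  rewrite Cmod_inv, Cmod_Cexp by apply Cexp_neq_0. rewrite <- exp_Ropp.
  apply exp_le. simpl. pose proof (Rle_abs (- fst s)). pose proof (Rle_abs (- fst d)).
  rewrite Rabs_Ropp in *. pose proof (Rabs_pos (fst d)). nra.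
Qed.

Lemma cover_segment (r : R) (s s' : C) (tau : R) : 0 <= tau <= 1 ->
  cover r s -> cover r s' -> cover r (s + tau * (s' - s))%C.
Proof.
  unfold cover. intros Ht H H'. simpl.
  destruct (Rle_dec (fst s) (fst s')).
  - eapply Rle_lt_trans; [|exact H']. apply exp_le. nra.
  - eapply Rle_lt_trans; [|exact H]. apply exp_le. nra.
Qed.

Lemma Cmod_27_Cexp (s : C) : 27 - exp (fst s) <= Cmod (27 + Cexp s).
Proof.
  pose proof (Cmod_triangle (27 + Cexp s) (- Cexp s)) as H.
  replace (27 + Cexp s + - Cexp s)%C with (RtoC 27) in H by ring.
  rewrite Cmod_opp, Cmod_Cexp, Cmod_R, Rabs_right in H by lra. lra.
Qed.

Lemma bounded_inv_27_segment (r : R) (s s' : C) : r <= 27 -> cover r s -> cover r s' ->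
  bounded (fun tau => / (27 + Cexp (s + tau * (s' - s))))%C.
Proof.
  unfold cover. intros Hr H H'.
  exists (/ (27 - exp (Rmax (fst s) (fst s')))). intros tau Ht.
  assert (E : exp (fst (s + tau * (s' - s))%C) <= exp (Rmax (fst s) (fst s'))).
  { apply exp_le. simpl.
    pose proof (Rmax_l (fst s) (fst s')). pose proof (Rmax_r (fst s) (fst s')). nra. }
  assert (exp (Rmax (fst s) (fst s')) < 27).
  { unfold Rmax. destruct Rle_dec; lra. }
  pose proof (Cmod_27_Cexp (s + tau * (s' - s))%C).
  rewrite Cmod_inv; [apply Rinv_le_contravar; lra|].
  apply Cmod_gt_0. lra.
Qed.

Lemma basic_derive_x r F k s t : (k <= 5)%nat -> jet r F -> cover r s -> cover r t ->
  is_derive (fun s => basic F k s t) s (basic_dx F k s t).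
Proof. intros Hk HJ Hs Ht. do 6 (destruct k as [|k]; [now apply HJ|]). lia. Qed.

Lemma basic_derive_y r F k s t : (k <= 5)%nat -> jet r F -> cover r s -> cover r t ->
  is_derive (basic F k s) t (basic_dy F k s t).
Proof. intros Hk HJ Hs Ht. do 6 (destruct k as [|k]; [now apply HJ|]). lia. Qed.

(** Gronwall's inequality along the segment from s to s'. *)
Lemma jet_unique_x z r F s s' t :
  r <= 27 -> jet r F -> jet_system z r F ->
  cover r s -> cover r s' -> cover r t ->
  (forall k, (k <= 5)%nat -> basic F k s t = 0) ->
  forall k, (k <= 5)%nat -> basic F k s' t = 0.
Proof.
  intros Hr HJ HS Hs Hs' Ht H0.
  set (sg := fun tau : R => (s + tau * (s' - s))%C).
  assert (Hsg : forall tau, 0 <= tau <= 1 -> cover r (sg tau))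
    by (intros; now apply cover_segment).
  pose proof (pfaffian_dominated z r F sg (fun _ => t) Hr HJ HS Hsg (fun _ _ => Ht)
    (bounded_Cexp_segment _ _) (bounded_const _)
    (bounded_inv_27_segment r s s' Hr Hs Hs') (bounded_inv_Cexp_segment _ _)) as D.
  set (N := fun tau => sum_n (fun j => Cmod (basic F j (sg tau) t)) 5) in *.
  destruct (dominated_uniform 5 N (fun k tau => basic_dx F k (sg tau) t * (s' - s))%C)
    as [K HK].
  { intros tau. apply sum_n_nonneg. intros; apply Cmod_ge_0. }
  { intros k Hk. eapply dominated_ext;
      [|exact (dominated_mult N _ _ (bounded_const (s' - s)%C) (proj1 (D k Hk)))].
    intros tau _. apply Cmult_comm. }
  assert (E1 : sg 1 = s') by (unfold sg; ring).
  rewrite <- E1.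
  apply (gronwall_zero 5 (fun k tau => basic F k (sg tau) t)
    (fun k tau => basic_dx F k (sg tau) t * (s' - s))%C K).
  - intros k tau Hk Htau.
    pose proof (is_C_derive_along (fun s => basic F k s t) s (s' - s) _ tau
      (basic_derive_x r F k (sg tau) t Hk HJ (Hsg tau Htau) Ht)) as [A B].
    split; [exact A|]. split; [exact B|]. now apply HK.
  - intros k Hk. replace (sg 0) with s by (unfold sg; ring). auto.
Qed.

Lemma jet_unique_y z r F s t t' :
  r <= 27 -> jet r F -> jet_system z r F ->
  cover r s -> cover r t -> cover r t' ->
  (forall k, (k <= 5)%nat -> basic F k s t = 0) ->
  forall k, (k <= 5)%nat -> basic F k s t' = 0.
Proof.
  intros Hr HJ HS Hs Ht Ht' H0.
  set (th := fun tau : R => (t + tau * (t' - t))%C).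
  assert (Hth : forall tau, 0 <= tau <= 1 -> cover r (th tau))
    by (intros; now apply cover_segment).
  assert (B3 : bounded (fun _ : R => / (27 + Cexp s))%C) by apply bounded_const.
  assert (B4 : bounded (fun _ : R => / Cexp s)%C) by apply bounded_const.
  pose proof (pfaffian_dominated z r F (fun _ => s) th Hr HJ HS (fun _ _ => Hs) Hth
    (bounded_const _) (bounded_Cexp_segment _ _) B3 B4) as D.
  set (N := fun tau => sum_n (fun j => Cmod (basic F j s (th tau))) 5) in *.
  destruct (dominated_uniform 5 N (fun k tau => basic_dy F k s (th tau) * (t' - t))%C)
    as [K HK].
  { intros tau. apply sum_n_nonneg. intros; apply Cmod_ge_0. }
  { intros k Hk. eapply dominated_ext;
      [|exact (dominated_mult N _ _ (bounded_const (t' - t)%C) (proj2 (D k Hk)))].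
    intros tau _. apply Cmult_comm. }
  assert (E1 : th 1 = t') by (unfold th; ring).
  rewrite <- E1.
  apply (gronwall_zero 5 (fun k tau => basic F k s (th tau))
    (fun k tau => basic_dy F k s (th tau) * (t' - t))%C K).
  - intros k tau Hk Htau.
    pose proof (is_C_derive_along (basic F k s) t (t' - t) _ tau
      (basic_derive_y r F k s (th tau) Hk HJ Hs (Hth tau Htau))) as [A B].
    split; [exact A|]. split; [exact B|]. now apply HK.
  - intros k Hk. replace (th 0) with t by (unfold th; ring). auto.
Qed.

(** * The solution space has dimension at most six *)

Lemma sum_n_C_eq0 (a : nat -> C) (n : nat) :
  (forall k, (k <= n)%nat -> a k = RtoC 0) -> sum_n a n = RtoC 0.
Proof.
  intros H. induction n as [|n IH].
  - rewrite sum_O. apply H; lia.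
  - rewrite sum_Sn, IH, H by (intros; try apply H; lia). exact (Cplus_0_l 0).
Qed.

Lemma sum_n_C_mult (a : nat -> C) (c : C) (n : nat) :
  sum_n (fun k => c * a k)%C n = (c * sum_n a n)%C.
Proof. exact (sum_n_mult_l (K := C_Ring) c a n). Qed.

Lemma sum_n_C_plus (a b : nat -> C) (n : nat) :
  sum_n (fun k => a k + b k)%C n = (sum_n a n + sum_n b n)%C.
Proof. exact (sum_n_plus (G := C_AbelianMonoid) a b n). Qed.

Lemma sum_n_C_S (a : nat -> C) (n : nat) :
  sum_n a (S n) = (sum_n a n + a (S n))%C.
Proof. exact (sum_Sn (G := C_AbelianMonoid) a n). Qed.

(** Elimination of one coordinate with the last vector as pivot. *)
Lemma linear_dependence (n : nat) (v : nat -> nat -> C) :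
  exists c : nat -> C, (exists i, (i <= n)%nat /\ c i <> 0) /\
    forall j, (j < n)%nat -> sum_n (fun i => c i * v i j)%C n = RtoC 0.
Proof.
  revert v. induction n as [|n IH]; intros v.
  - exists (fun _ => RtoC 1). split; [exists 0%nat; split; [lia|apply C1_nz]|].
    intros j Hj; lia.
  - destruct (excluded_middle_informative (exists j, (j < S n)%nat /\ v (S n) j <> 0))
      as [(j0 & Hj0 & Hv) | Hz].
    + set (skip := fun j => if Compare_dec.lt_dec j j0 then j else S j).
      destruct (IH (fun i j => v i (skip j) - v i j0 / v (S n) j0 * v (S n) (skip j))%C)
        as (c & (i & Hi & Hci) & Hc).
      set (cl := (- (sum_n (fun i => c i * v i j0) n / v (S n) j0))%C).
      exists (fun i => if Nat.eq_dec i (S n) then cl else c i). split.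
      { exists i. split; [lia|]. destruct (Nat.eq_dec i (S n)); [lia|auto]. }
      intros j Hj. rewrite sum_n_C_S.
      rewrite (sum_n_ext_loc _ (fun i => c i * v i j)%C)
        by (intros m Hm; destruct (Nat.eq_dec m (S n)); [lia|reflexivity]).
      destruct (Nat.eq_dec (S n) (S n)) as [_|]; [|lia].
      destruct (Nat.eq_dec j j0) as [->|Nj].
      { unfold cl. toC. field. auto. }
      assert (exists j', (j' < n)%nat /\ skip j' = j) as (j' & Hj' & <-).
      { unfold skip. destruct (Compare_dec.lt_dec j j0).
        - exists j. split; [lia|]. destruct (Compare_dec.lt_dec j j0); lia.
        - exists (pred j). split; [lia|]. destruct (Compare_dec.lt_dec (pred j) j0); lia. }
      specialize (Hc j' Hj').
      rewrite (sum_n_ext _ (fun i => c i * v i (skip j') +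
        (- (v (S n) (skip j') / v (S n) j0)) * (c i * v i j0))%C) in Hc
        by (intros m; unfold Cdiv; toC; ring).
      rewrite sum_n_C_plus, sum_n_C_mult in Hc. rewrite <- Hc.
      unfold cl. toC. field. auto.
    + exists (fun i => if Nat.eq_dec i (S n) then RtoC 1 else RtoC 0). split.
      { exists (S n). split; [lia|]. destruct (Nat.eq_dec (S n) (S n)); [apply C1_nz|lia]. }
      intros j Hj. rewrite sum_n_C_S, sum_n_C_eq0.
      * destruct (Nat.eq_dec (S n) (S n)); [|lia].
        replace (v (S n) j) with (RtoC 0); [toC; ring|].
        destruct (Ceq_dec (v (S n) j) 0) as [->|N]; auto.
        exfalso; apply Hz. now exists j.
      * intros k Hk. destruct (Nat.eq_dec k (S n)); [lia|]. toC. ring.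
Qed.

Lemma jet_sum r (F : nat -> nat -> nat -> C -> C -> C) (c : nat -> C) (n : nat) :
  (forall k, jet r (F k)) ->
  jet r (fun i j s t => sum_n (fun k => c k * F k i j s t)%C n).
Proof.
  intros H i j s t Hs Ht. induction n as [|n [IH1 IH2]].
  - rewrite !sum_O. split.
    + apply (is_derive_ext (fun s => c 0%nat * F 0%nat i j s t)%C).
      * intros u. now rewrite sum_O.
      * apply is_C_derive_scal. now apply H.
    + apply (is_derive_ext (fun t => c 0%nat * F 0%nat i j s t)%C).
      * intros u. now rewrite sum_O.
      * apply is_C_derive_scal. now apply H.
  - rewrite !sum_n_C_S. split.
    + apply (is_derive_ext (fun s => sum_n (fun k => c k * F k i j s t)%C n
         + c (S n) * F (S n) i j s t)%C).
      * intros u. now rewrite sum_n_C_S.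
      * apply is_C_derive_plus; [exact IH1|]. apply is_C_derive_scal. now apply H.
    + apply (is_derive_ext (fun t => sum_n (fun k => c k * F k i j s t)%C n
         + c (S n) * F (S n) i j s t)%C).
      * intros u. now rewrite sum_n_C_S.
      * apply is_C_derive_plus; [exact IH2|]. apply is_C_derive_scal. now apply H.
Qed.

Lemma jet_system_sum z r (F : nat -> nat -> nat -> C -> C -> C) (c : nat -> C) (n : nat) :
  (forall k, jet_system z r (F k)) ->
  jet_system z r (fun i j s t => sum_n (fun k => c k * F k i j s t)%C n).
Proof.
  intros H s t Hs Ht. induction n as [|n [IH1 IH2]].
  - rewrite !sum_O. destruct (H 0%nat s t Hs Ht) as [H1 H2]. split.
    + match type of H1 with ?L = ?R =>
        transitivity (c 0%nat * L)%C; [toC; ring | rewrite H1; toC; ring] end.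
    + rewrite H2. unfold Cdiv; toC; ring.
  - rewrite !sum_n_C_S. destruct (H (S n) s t Hs Ht) as [H1 H2]. split.
    + match type of H1 with ?L = ?R => match type of IH1 with ?L' = ?R' =>
        transitivity (L' + c (S n) * L)%C; [toC; ring | rewrite IH1, H1; toC; ring] end end.
    + rewrite IH2, H2. unfold Cdiv; toC; ring.
Qed.

(** Seven vectors of six derivatives at a base point are dependent, and the
    dependence propagates from the base point by uniqueness. *)
Lemma Hbar_dependence (z : C) (r : R) (f : nat -> C -> C -> C) :
  z <> RtoC 0 -> 0 < r <= 27 -> (forall k, Hbar z r (f k)) ->
  exists c : nat -> C, (exists i, (i <= 6)%nat /\ c i <> 0) /\
    forall s t, cover r s -> cover r t -> sum_n (fun k => c k * f k s t)%C 6 = RtoC 0.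
Proof.
  intros Hz [Hr0 Hr] Hf.
  assert (HF : forall k, exists F, eq2 r (F 0%nat 0%nat) (f k) /\ jet r F /\ jet_system z r F).
  { intros k. destruct (proj1 (Hbar_jet z r (f k) Hz) (Hf k)) as (F & A & B & D & _).
    now exists F. }
  set (F := fun k => proj1_sig (constructive_indefinite_description _ (HF k))).
  assert (HE : forall k, eq2 r (F k 0%nat 0%nat) (f k)).
  { intros k. unfold F. now destruct constructive_indefinite_description as (G & A & B & D). }
  assert (HJ : forall k, jet r (F k)).
  { intros k. unfold F. now destruct constructive_indefinite_description as (G & A & B & D). }
  assert (HS : forall k, jet_system z r (F k)).
  { intros k. unfold F. now destruct constructive_indefinite_description as (G & A & B & D). }
  set (p := (ln (r / 2), 0) : C).
  assert (Hp : cover r p) by (unfold cover, p; simpl; rewrite exp_ln; lra).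
  destruct (linear_dependence 6 (fun k j => basic (F k) j p p)) as (c & Hc0 & Hc).
  exists c. split; auto. intros s t Hs Ht.
  set (G := fun i j s t => sum_n (fun k => c k * F k i j s t)%C 6).
  assert (JG : jet r G) by (apply (jet_sum r (fun k => F k)); auto).
  assert (SG : jet_system z r G) by (apply (jet_system_sum z r (fun k => F k)); auto).
  assert (H0 : forall k, (k <= 5)%nat -> basic G k p p = 0).
  { intros k Hk. rewrite <- (Hc k) by lia.
    do 6 (destruct k as [|k]; [reflexivity|]). lia. }
  assert (H1 := jet_unique_y z r G s p t Hr JG SG Hs Hp Ht
    (jet_unique_x z r G p s p Hr JG SG Hp Hs Hp H0) 0%nat ltac:(lia)).
  unfold basic, G in H1. rewrite <- H1. apply sum_n_ext. intros k.
  f_equal. symmetry. now apply HE.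
Qed.

(** * Absolutely convergent complex series *)

Lemma ex_series_Rmult_l (c : R) (a : nat -> R) :
  ex_series a -> ex_series (fun n => c * a n).
Proof. exact (ex_series_scal (K := R_AbsRing) (V := R_NormedModule) c a). Qed.

Lemma ex_series_Rmult_r (c : R) (a : nat -> R) :
  ex_series a -> ex_series (fun n => a n * c).
Proof.
  intros H. apply (ex_series_ext (fun n => c * a n)); [intros n; apply Rmult_comm|].
  now apply ex_series_Rmult_l.
Qed.

Definition Csummable (a : nat -> C) : Prop := ex_series (fun n => Cmod (a n)).

Lemma Csummable_le (a : nat -> C) (u : nat -> R) :
  (forall n, Cmod (a n) <= u n) -> ex_series u -> Csummable a.
Proof.
  intros H Hu. apply (ex_series_le (V := R_CompleteNormedModule) _ u); auto.
  intros n. unfold norm; simpl. unfold abs; simpl.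
  rewrite Rabs_pos_eq by apply Cmod_ge_0. apply H.
Qed.

Lemma Csummable_fst a : Csummable a -> ex_series (fun n => fst (a n)).
Proof.
  intros H. apply (ex_series_le (V := R_CompleteNormedModule) _ (fun n => Cmod (a n))); auto.
  intros n. apply Cmod_fst.
Qed.

Lemma Csummable_snd a : Csummable a -> ex_series (fun n => snd (a n)).
Proof.
  intros H. apply (ex_series_le (V := R_CompleteNormedModule) _ (fun n => Cmod (a n))); auto.
  intros n. apply Cmod_snd.
Qed.

Lemma Csummable_plus a b : Csummable a -> Csummable b -> Csummable (fun n => a n + b n)%C.
Proof.
  intros Ha Hb. apply (Csummable_le _ (fun n => Cmod (a n) + Cmod (b n))).
  - intros n. apply Cmod_triangle.
  - exact (ex_series_plus (K := R_AbsRing) (V := R_NormedModule) _ _ Ha Hb).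
Qed.

Lemma Csummable_mult c a : Csummable a -> Csummable (fun n => c * a n)%C.
Proof.
  intros Ha. apply (Csummable_le _ (fun n => Cmod c * Cmod (a n))).
  - intros n. rewrite Cmod_mult. lra.
  - exact (ex_series_Rmult_l (Cmod c) _ Ha).
Qed.

Lemma Cseries_ext (a b : nat -> C) : (forall n, a n = b n) -> Cseries a = Cseries b.
Proof.
  intros H. unfold Cseries. f_equal; apply Series_ext; intros n; now rewrite H.
Qed.

Lemma Cseries_plus a b : Csummable a -> Csummable b ->
  Cseries (fun n => a n + b n)%C = (Cseries a + Cseries b)%C.
Proof.
  intros Ha Hb. unfold Cseries, Cplus; simpl. f_equal; apply Series_plus;
    auto using Csummable_fst, Csummable_snd.
Qed.

Lemma Cseries_mult c a : Csummable a -> Cseries (fun n => c * a n)%C = (c * Cseries a)%C.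
Proof.
  intros Ha. pose proof (Csummable_fst a Ha) as H1. pose proof (Csummable_snd a Ha) as H2.
  unfold Cseries, Cmult; simpl. f_equal.
  - rewrite Series_minus, !Series_scal_l; auto;
      apply (ex_series_Rmult_l); auto.
  - rewrite Series_plus, !Series_scal_l; auto;
      apply (ex_series_Rmult_l); auto.
Qed.

Lemma Cseries_incr_1 a : Csummable a -> Cseries a = (a 0%nat + Cseries (fun n => a (S n)))%C.
Proof.
  intros Ha. unfold Cseries, Cplus; simpl. f_equal; apply Series_incr_1;
    auto using Csummable_fst, Csummable_snd.
Qed.

Lemma Cseries_incr_1_aux (a : nat -> C) : a 0%nat = 0 -> Cseries a = Cseries (fun n => a (S n)).
Proof.
  intros E. unfold Cseries. f_equal; apply Series_incr_1_aux; now rewrite E.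
Qed.

(** The sum is rotated onto the positive real axis to bound its modulus. *)
Lemma Cmod_Cseries_le (a : nat -> C) (u : nat -> R) :
  (forall n, Cmod (a n) <= u n) -> ex_series u -> Cmod (Cseries a) <= Series u.
Proof.
  intros H Hu. pose proof (Csummable_le a u H Hu) as Ha.
  set (S0 := Cseries a).
  assert (Hu0 : forall n, 0 <= u n).
  { intros n. eapply Rle_trans; [apply Cmod_ge_0|apply H]. }
  destruct (Ceq_dec S0 0) as [E|N].
  - rewrite E, Cmod_0. replace 0 with (Series (fun _ => 0 * 0)).
    + apply Series_le; auto. intros n; specialize (Hu0 n); lra.
    + rewrite Series_scal_l. ring.
  - assert (Hm : 0 < Cmod S0) by now apply Cmod_gt_0.
    set (e := (Cconj S0 / Cmod S0)%C).
    assert (He : Cmod e = 1).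
    { unfold e. rewrite Cmod_div, Cmod_conj, Cmod_R, Rabs_right by
        (try (intros K; apply RtoC_inj in K); lra). field. lra. }
    assert (E : (e * S0)%C = RtoC (Cmod S0)).
    { unfold e. assert (K : (Cconj S0 * S0)%C = RtoC (Cmod S0 ^ 2)).
      { rewrite RtoC_pow, <- RtoC_pow. rewrite Cmod2_conj. ring. }
      transitivity (Cconj S0 * S0 / Cmod S0)%C; [unfold Cdiv; ring|].
      rewrite K, RtoC_pow. field. intros K'; apply RtoC_inj in K'; lra. }
    replace (Cmod S0) with (fst (e * S0)%C) by now rewrite E.
    unfold S0. rewrite <- Cseries_mult by auto.
    change (Series (fun n => fst (e * a n)%C) <= Series u).
    eapply Rle_trans; [|apply (Series_le (fun n => Cmod (a n)) u); auto].
    + apply Rle_trans with (Rabs (Series (fun n => fst (e * a n)%C))); [apply Rle_abs|].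
      assert (Hs : ex_series (fun n => Rabs (fst (e * a n)%C))).
      { apply (ex_series_le (V := R_CompleteNormedModule) _ (fun n => Cmod (a n))); auto.
        intros n. change (Rabs (Rabs (fst (e * a n)%C)) <= Cmod (a n)). rewrite Rabs_Rabsolu.
        eapply Rle_trans; [apply Cmod_fst|]. rewrite Cmod_mult, He. lra. }
      eapply Rle_trans; [apply Series_Rabs; exact Hs|].
      apply Series_le; auto. intros n. split; [apply Rabs_pos|].
      eapply Rle_trans; [apply Cmod_fst|]. rewrite Cmod_mult, He. lra.
    + intros n. split; [apply Cmod_ge_0|auto].
Qed.

(** * Double series dominated by a product *)

Definition dsum (A : nat -> nat -> C) : C := Cseries (fun l => Cseries (fun n => A l n)).

Definition product_bound (A : nat -> nat -> C) (u v : nat -> R) : Prop :=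
  (forall l, 0 <= u l) /\ (forall n, 0 <= v n) /\ ex_series u /\ ex_series v /\
  forall l n, Cmod (A l n) <= u l * v n.

(** A majorant that is a product keeps both iterated sums absolutely convergent and
    is stable under sums and under shifts of either index. *)
Definition summable2 (A : nat -> nat -> C) : Prop := exists u v, product_bound A u v.

Lemma product_bound_row A u v : product_bound A u v -> forall l, Csummable (A l).
Proof.
  intros (Hu & Hv & Su & Sv & H) l. apply (Csummable_le _ (fun n => u l * v n)); auto.
  now apply (ex_series_Rmult_l).
Qed.

Lemma product_bound_row_sum A u v : product_bound A u v ->
  forall l, Cmod (Cseries (A l)) <= u l * Series v.
Proof.
  intros (Hu & Hv & Su & Sv & H) l. rewrite <- Series_scal_l.
  apply Cmod_Cseries_le; auto. now apply (ex_series_Rmult_l).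
Qed.

Lemma product_bound_rows A u v : product_bound A u v -> Csummable (fun l => Cseries (A l)).
Proof.
  intros H. pose proof (product_bound_row_sum A u v H) as Hr.
  destruct H as (Hu & Hv & Su & Sv & H).
  apply (Csummable_le _ (fun l => u l * Series v)); auto.
  now apply (ex_series_Rmult_r).
Qed.

Lemma dsum_bound A u v : product_bound A u v -> Cmod (dsum A) <= Series u * Series v.
Proof.
  intros H. rewrite <- Series_scal_r. apply Cmod_Cseries_le.
  - exact (product_bound_row_sum A u v H).
  - apply (ex_series_Rmult_r). apply H.
Qed.

Lemma dsum_ext (A B : nat -> nat -> C) : (forall l n, A l n = B l n) -> dsum A = dsum B.
Proof. intros H. apply Cseries_ext; intros l. apply Cseries_ext; intros n. apply H. Qed.

Lemma dsum_plus A B : summable2 A -> summable2 B ->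
  dsum (fun l n => A l n + B l n)%C = (dsum A + dsum B)%C.
Proof.
  intros (u & v & HA) (u' & v' & HB). unfold dsum.
  rewrite <- Cseries_plus by eauto using product_bound_rows.
  apply Cseries_ext. intros l. apply Cseries_plus; eauto using product_bound_row.
Qed.

Lemma dsum_mult c A : summable2 A -> dsum (fun l n => c * A l n)%C = (c * dsum A)%C.
Proof.
  intros (u & v & HA). unfold dsum. rewrite <- Cseries_mult by eauto using product_bound_rows.
  apply Cseries_ext. intros l. apply Cseries_mult. eauto using product_bound_row.
Qed.

Lemma summable2_plus A B : summable2 A -> summable2 B ->
  summable2 (fun l n => A l n + B l n)%C.
Proof.
  intros (u & v & Hu & Hv & Su & Sv & H) (u' & v' & Hu' & Hv' & Su' & Sv' & H').
  exists (fun l => u l + u' l), (fun n => v n + v' n). repeat split.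
  - intros l. specialize (Hu l); specialize (Hu' l); lra.
  - intros l. specialize (Hv l); specialize (Hv' l); lra.
  - exact (ex_series_plus (K := R_AbsRing) (V := R_NormedModule) _ _ Su Su').
  - exact (ex_series_plus (K := R_AbsRing) (V := R_NormedModule) _ _ Sv Sv').
  - intros l n. eapply Rle_trans; [apply Cmod_triangle|].
    specialize (H l n); specialize (H' l n).
    specialize (Hu l); specialize (Hu' l); specialize (Hv n); specialize (Hv' n). nra.
Qed.

Lemma summable2_mult c A : summable2 A -> summable2 (fun l n => c * A l n)%C.
Proof.
  intros (u & v & Hu & Hv & Su & Sv & H).
  exists (fun l => Cmod c * u l), v. repeat split; auto.
  - intros l. apply Rmult_le_pos; auto using Cmod_ge_0.
  - now apply (ex_series_Rmult_l).
  - intros l n. rewrite Cmod_mult, Rmult_assoc.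
    apply Rmult_le_compat_l; auto using Cmod_ge_0.
Qed.

Lemma dsum_shift_l (A : nat -> nat -> C) : (forall n, A 0%nat n = 0) -> dsum A = dsum (fun l n => A (S l) n).
Proof.
  intros E. apply (Cseries_incr_1_aux (fun l => Cseries (A l))).
  unfold Cseries. rewrite (Series_ext _ (fun _ => 0 * 0)), (Series_ext (fun n => snd _) (fun _ => 0 * 0)).
  - rewrite Series_scal_l. apply injective_projections; simpl; ring.
  - intros n. rewrite E. simpl. ring.
  - intros n. rewrite E. simpl. ring.
Qed.

Lemma dsum_shift_n (A : nat -> nat -> C) : (forall l, A l 0%nat = 0) -> dsum A = dsum (fun l n => A l (S n)).
Proof.
  intros E. apply Cseries_ext. intros l. now apply (Cseries_incr_1_aux (A l)).
Qed.

(** * Series of exponentials *)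

(** The exponents lam need not be integers: the series live on the universal cover;
    i and j are the orders of differentiation. *)
Definition expterm (c : nat -> nat -> C) (lam mu : nat -> nat -> R) (i j : nat) (s t : C)
    (l n : nat) : C :=
  (c l n * RtoC (lam l n ^ i * mu l n ^ j) * Cexp (lam l n * s + mu l n * t))%C.

Definition expsum c lam mu (i j : nat) (s t : C) : C := dsum (expterm c lam mu i j s t).

Definition expsum_converges (r : R) c (lam mu : nat -> nat -> R) : Prop :=
  (forall l n, 0 <= lam l n /\ 0 <= mu l n) /\
  forall S T, exp S < r -> exp T < r ->
    summable2 (fun l n => (c l n * RtoC (exp (lam l n * S + mu l n * T)))%C).

Lemma pow_exp_bound (d x : R) (p : nat) : 0 < d -> 0 <= x ->
  x ^ p <= (/ d) ^ p * exp (INR p * d * x).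
Proof.
  intros Hd Hx.
  replace (exp (INR p * d * x)) with (exp (d * x) ^ p).
  - rewrite <- Rpow_mult_distr. apply pow_incr. split; auto.
    apply (Rmult_le_reg_l d); auto. rewrite <- Rmult_assoc, Rinv_r, Rmult_1_l by lra.
    destruct (Req_dec (d * x) 0) as [E|N].
    + rewrite E. left; apply exp_pos.
    + pose proof (exp_ineq1 (d * x) N). lra.
  - rewrite <- Rpower_pow by apply exp_pos. unfold Rpower. rewrite ln_exp. f_equal. ring.
Qed.

Lemma cover_margin (r : R) (s : C) (k : R) : cover r s -> 0 < k ->
  exists d, 0 < d /\ exp (fst s + k * d) < r.
Proof.
  unfold cover. intros H Hk.
  assert (Hr : 0 < r) by (pose proof (exp_pos (fst s)); lra).
  assert (Hd : 0 < ln r - fst s).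
  { apply Rlt_0_minus. rewrite <- (ln_exp (fst s)). apply ln_increasing; auto.
    apply exp_pos. }
  exists ((ln r - fst s) / (2 * k)). split.
  - apply Rdiv_lt_0_compat; lra.
  - rewrite <- (exp_ln r) at 2 by auto. apply exp_increasing. 
    replace (k * ((ln r - fst s) / (2 * k))) with ((ln r - fst s) / 2) by (field; lra). lra.
Qed.

Lemma Cmod_expterm_arg (x y : R) (h k : C) : 0 <= x -> 0 <= y ->
  Cmod (x * h + y * k) <= (x + y) * (Cmod h + Cmod k).
Proof.
  intros Hx Hy. eapply Rle_trans; [apply Cmod_triangle|].
  rewrite !Cmod_mult, !Cmod_R, !Rabs_right by lra.
  pose proof (Cmod_ge_0 h). pose proof (Cmod_ge_0 k). nra.
Qed.

(** Powers of the exponents cost only a slight enlargement of the arguments. *)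
Lemma expterm_majorant r c lam mu (p : nat) (q : R) s t :
  expsum_converges r c lam mu -> cover r s -> cover r t -> 0 <= q ->
  exists d u v, 0 < d /\ (forall l, 0 <= u l) /\ (forall n, 0 <= v n) /\
    ex_series u /\ ex_series v /\
    forall l n, Cmod (c l n) * (lam l n + mu l n) ^ p *
      exp (lam l n * fst s + mu l n * fst t) * exp (q * d * (lam l n + mu l n))
      <= u l * v n.
Proof.
  intros [Hpos Hc] Hs Ht Hq.
  assert (Hk : 0 < INR p + q + 1) by (pose proof (pos_INR p); lra).
  destruct (cover_margin r s _ Hs Hk) as (d1 & Hd1 & E1).
  destruct (cover_margin r t _ Ht Hk) as (d2 & Hd2 & E2).
  set (d := Rmin d1 d2).
  assert (Hd : 0 < d) by now apply Rmin_pos.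
  assert (Hd1' : d <= d1) by apply Rmin_l. assert (Hd2' : d <= d2) by apply Rmin_r.
  set (k := INR p + q + 1) in *.
  destruct (Hc (fst s + k * d) (fst t + k * d)) as (u & v & Hu & Hv & Su & Sv & H).
  { eapply Rle_lt_trans; [|exact E1]. apply exp_le. nra. }
  { eapply Rle_lt_trans; [|exact E2]. apply exp_le. nra. }
  exists d, (fun l => (/ d) ^ p * u l), v. repeat split; auto.
  - intros l. apply Rmult_le_pos; auto. apply pow_le. left; now apply Rinv_0_lt_compat.
  - now apply (ex_series_Rmult_l).
  - intros l n. specialize (H l n). destruct (Hpos l n) as [Hx Hy].
    set (x := lam l n) in *. set (y := mu l n) in *.
    rewrite Cmod_mult, Cmod_R, Rabs_right in H by (apply Rle_ge; left; apply exp_pos).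
    rewrite (Rmult_assoc ((/ d) ^ p)).
    eapply Rle_trans; [|apply Rmult_le_compat_l; [|exact H]].
    + pose proof (pow_exp_bound d (x + y) p Hd ltac:(lra)) as B.
      pose proof (Cmod_ge_0 (c l n)) as Hc0.
      apply Rle_trans with (Cmod (c l n) * ((/ d) ^ p * exp (INR p * d * (x + y)) *
        exp (x * fst s + y * fst t) * exp (q * d * (x + y)))).
      * replace (Cmod (c l n) * (x + y) ^ p * exp (x * fst s + y * fst t) *
           exp (q * d * (x + y))) with
          (Cmod (c l n) * ((x + y) ^ p * exp (x * fst s + y * fst t) *
           exp (q * d * (x + y)))) by ring.
        apply Rmult_le_compat_l; auto.
        apply Rmult_le_compat_r; [left; apply exp_pos|].
        apply Rmult_le_compat_r; [left; apply exp_pos|]. exact B.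
      * replace ((/ d) ^ p * (Cmod (c l n) *
          exp (x * (fst s + k * d) + y * (fst t + k * d)))) with
          (Cmod (c l n) * ((/ d) ^ p * exp (x * (fst s + k * d) + y * (fst t + k * d))))
          by ring.
        apply Rmult_le_compat_l; auto. rewrite !Rmult_assoc.
        apply Rmult_le_compat_l; [apply pow_le; left; now apply Rinv_0_lt_compat|].
        rewrite <- !exp_plus. apply exp_le. unfold k. nra.
    + apply pow_le. left; now apply Rinv_0_lt_compat.
Qed.

Lemma pow_le_sum (x y : R) (i j : nat) : 0 <= x -> 0 <= y ->
  x ^ i * y ^ j <= (x + y) ^ (i + j).
Proof.
  intros Hx Hy. rewrite pow_add. apply Rmult_le_compat; try (apply pow_le; lra);
    apply pow_incr; lra.
Qed.

Lemma expterm_summable r c lam mu i j s t :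
  expsum_converges r c lam mu -> cover r s -> cover r t ->
  summable2 (expterm c lam mu i j s t).
Proof.
  intros Hc Hs Ht.
  destruct (expterm_majorant r c lam mu (i + j) 0 s t Hc Hs Ht (Rle_refl 0))
    as (d & u & v & Hd & Hu & Hv & Su & Sv & H).
  exists u, v. repeat split; auto. intros l n. eapply Rle_trans; [|apply H].
  destruct Hc as [Hpos _]. destruct (Hpos l n) as [Hx Hy].
  unfold expterm. rewrite !Cmod_mult, Cmod_Cexp, Cmod_R.
  rewrite Rmult_0_l, Rmult_0_l, exp_0, Rmult_1_r.
  rewrite Rabs_right by (apply Rle_ge, Rmult_le_pos; now apply pow_le).
  replace (fst (lam l n * s + mu l n * t)%C) with (lam l n * fst s + mu l n * fst t)
    by (simpl; ring).
  apply Rmult_le_compat_r; [left; apply exp_pos|].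
  apply Rmult_le_compat_l; [apply Cmod_ge_0|]. now apply pow_le_sum.
Qed.

(** One expansion to second order in both variables gives both partial derivatives
    and the joint continuity. *)
Lemma expsum_second_order r c lam mu i j s t :
  expsum_converges r c lam mu -> cover r s -> cover r t ->
  exists d K, 0 < d /\ forall h k, Cmod h <= d -> Cmod k <= d ->
    cover r (s + h)%C -> cover r (t + k)%C ->
    Cmod (expsum c lam mu i j (s + h) (t + k) - expsum c lam mu i j s t
          - h * expsum c lam mu (S i) j s t - k * expsum c lam mu i (S j) s t)
    <= K * (Cmod h + Cmod k) ^ 2.
Proof.
  intros Hc Hs Ht.
  destruct (expterm_majorant r c lam mu (i + j + 2) 2 s t Hc Hs Ht ltac:(lra))
    as (d & u & v & Hd & Hu & Hv & Su & Sv & H).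
  exists d, (2 * (Series u * Series v)). split; auto. intros h k Hh Hk Hsh Htk.
  assert (S0 := expterm_summable r c lam mu i j s t Hc Hs Ht).
  assert (S1 := expterm_summable r c lam mu (S i) j s t Hc Hs Ht).
  assert (S2 := expterm_summable r c lam mu i (S j) s t Hc Hs Ht).
  assert (S3 := expterm_summable r c lam mu i j _ _ Hc Hsh Htk).
  set (m := Cmod h + Cmod k).
  assert (Hm : 0 <= m <= 2 * d)
    by (pose proof (Cmod_ge_0 h); pose proof (Cmod_ge_0 k); unfold m; lra).
  replace (expsum c lam mu i j (s + h) (t + k) - expsum c lam mu i j s t
          - h * expsum c lam mu (S i) j s t - k * expsum c lam mu i (S j) s t)%C
    with (expsum c lam mu i j (s + h) (t + k) + (-1) * expsum c lam mu i j s t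
          + (- h) * expsum c lam mu (S i) j s t + (- k) * expsum c lam mu i (S j) s t)%C
    by ring.
  unfold expsum. rewrite <- !dsum_mult, <- !dsum_plus
    by repeat first [assumption | apply summable2_plus | apply summable2_mult].
  replace (2 * (Series u * Series v) * m ^ 2) with
    (Series (fun l => 2 * m ^ 2 * u l) * Series v) by (rewrite Series_scal_l; ring).
  apply dsum_bound. repeat split; auto.
  - intros l. apply Rmult_le_pos; auto. nra.
  - now apply (ex_series_Rmult_l).
  - intros l n. destruct Hc as [Hpos _]. destruct (Hpos l n) as [Hx Hy].
    specialize (H l n). unfold expterm.
    set (x := lam l n) in *. set (y := mu l n) in *.
    set (e := (x * h + y * k)%C).
    replace (x * (s + h) + y * (t + k))%C with ((x * s + y * t) + e)%C by (unfold e; ring).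
    rewrite Cexp_add, !RtoC_mult, !RtoC_pow, !Cpow_S.
    match goal with |- Cmod ?a <= _ =>
      replace a with (c l n * (x ^ i * y ^ j) * Cexp (x * s + y * t) * (Cexp e - 1 - e))%C
        by (unfold e; ring) end.
    rewrite <- !RtoC_pow, <- RtoC_mult, !Cmod_mult, Cmod_Cexp, Cmod_R.
    rewrite Rabs_right by (apply Rle_ge, Rmult_le_pos; now apply pow_le).
    replace (fst (x * s + y * t)%C) with (x * fst s + y * fst t) by (simpl; ring).
    pose proof (Cmod_expterm_arg x y h k Hx Hy) as He. fold e m in He.
    apply Rle_trans with
      (Cmod (c l n) * (x + y) ^ (i + j) * exp (x * fst s + y * fst t) *
       (2 * (((x + y) * m) ^ 2 * exp (2 * d * (x + y))))).
    + apply Rmult_le_compat.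
      * repeat apply Rmult_le_pos; try apply Cmod_ge_0; try (apply pow_le; lra).
        left; apply exp_pos.
      * apply Cmod_ge_0.
      * apply Rmult_le_compat_r; [left; apply exp_pos|].
        apply Rmult_le_compat_l; [apply Cmod_ge_0|]. now apply pow_le_sum.
      * eapply Rle_trans; [apply Cexp_second_order|].
        apply Rmult_le_compat_l; [lra|].
        apply Rmult_le_compat.
        -- apply pow_le, Cmod_ge_0.
        -- left; apply exp_pos.
        -- apply pow_incr. split; [apply Cmod_ge_0|exact He].
        -- apply exp_le. eapply Rle_trans; [exact He|]. nra.
    + replace (Cmod (c l n) * (x + y) ^ (i + j) * exp (x * fst s + y * fst t) *
       (2 * (((x + y) * m) ^ 2 * exp (2 * d * (x + y))))) with
       (2 * m ^ 2 * (Cmod (c l n) * (x + y) ^ (i + j + 2) * exp (x * fst s + y * fst t) *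
        exp (2 * d * (x + y)))) by (rewrite (pow_add _ (i + j) 2); ring).
      rewrite (Rmult_assoc (2 * m ^ 2) (u l)). apply Rmult_le_compat_l; [nra|]. exact H.
Qed.

Lemma expsum_jet r c lam mu : expsum_converges r c lam mu -> jet r (expsum c lam mu).
Proof.
  intros Hc i j s t Hs Ht.
  destruct (expsum_second_order r c lam mu i j s t Hc Hs Ht) as (d & K & Hd & H).
  split.
  - destruct (cover_open r s Hs) as [d' Hd'].
    apply (is_C_derive_quadratic _ _ _ K (Rmin d (d' / 2))).
    { apply Rmin_pos; auto. pose proof (cond_pos d'); lra. }
    intros h Hh. pose proof (Rmin_l d (d' / 2)). pose proof (Rmin_r d (d' / 2)).
    pose proof (cond_pos d').
    specialize (H h 0). rewrite Cmod_0, Rplus_0_r, Cplus_0_r in H.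
    eapply Rle_trans; [|apply H; auto; try lra; apply Hd'; lra].
    right. f_equal. ring.
  - destruct (cover_open r t Ht) as [d' Hd'].
    apply (is_C_derive_quadratic _ _ _ K (Rmin d (d' / 2))).
    { apply Rmin_pos; auto. pose proof (cond_pos d'); lra. }
    intros h Hh. pose proof (Rmin_l d (d' / 2)). pose proof (Rmin_r d (d' / 2)).
    pose proof (cond_pos d').
    specialize (H 0 h). rewrite Cmod_0, Rplus_0_l, Cplus_0_r in H.
    eapply Rle_trans; [|apply H; auto; try lra; apply Hd'; lra].
    right. f_equal. ring.
Qed.

Lemma expsum_continuous r c lam mu : expsum_converges r c lam mu ->
  forall i j s t, cover r s -> cover r t ->
  continuous (fun p : C * C => expsum c lam mu i j (fst p) (snd p)) (s, t).
Proof.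
  intros Hc i j s t Hs Ht.
  destruct (expsum_second_order r c lam mu i j s t Hc Hs Ht) as (d & K & Hd & H).
  destruct (cover_open r s Hs) as [ds Hds]. destruct (cover_open r t Ht) as [dt Hdt].
  set (B := Cmod (expsum c lam mu (S i) j s t) + Cmod (expsum c lam mu i (S j) s t)
            + 2 * Rabs K * d + 1).
  assert (HB : 0 < B).
  { unfold B. pose proof (Cmod_ge_0 (expsum c lam mu (S i) j s t)).
    pose proof (Cmod_ge_0 (expsum c lam mu i (S j) s t)). pose proof (Rabs_pos K). nra. }
  unfold continuous. apply (filterlim_locally_ball_norm (U := C_NormedModule)). intros eps.
  set (nf := norm_factor (V := C_NormedModule)).
  assert (Hnf : 0 < nf) by apply norm_factor_gt_0.
  set (e := Rmin (Rmin d (eps / (2 * B))) (Rmin ds dt)).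
  assert (He : 0 < e).
  { unfold e. repeat apply Rmin_pos; auto; try apply cond_pos.
    apply Rdiv_lt_0_compat; [apply cond_pos|lra]. }
  assert (He1 : e <= d) by (unfold e; eapply Rle_trans; [apply Rmin_l|apply Rmin_l]).
  assert (He2 : e <= eps / (2 * B)) by (unfold e; eapply Rle_trans; [apply Rmin_l|apply Rmin_r]).
  assert (He3 : e <= ds) by (unfold e; eapply Rle_trans; [apply Rmin_r|apply Rmin_l]).
  assert (He4 : e <= dt) by (unfold e; eapply Rle_trans; [apply Rmin_r|apply Rmin_r]).
  assert (Key : forall s' t' : C, Cmod (s' - s) < e -> Cmod (t' - t) < e ->
    Cmod (expsum c lam mu i j s' t' - expsum c lam mu i j s t) < eps).
  { intros s' t' B1 B2.
    set (h := (s' - s)%C) in *. set (k := (t' - t)%C) in *.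
    specialize (H h k ltac:(lra) ltac:(lra) (Hds h ltac:(lra)) (Hdt k ltac:(lra))).
    replace (s + h)%C with s' in H by (unfold h; ring).
    replace (t + k)%C with t' in H by (unfold k; ring).
    set (X := (expsum c lam mu i j s' t' - expsum c lam mu i j s t)%C) in *.
    set (P := expsum c lam mu (S i) j s t) in *. set (Q := expsum c lam mu i (S j) s t) in *.
    replace X with ((X - h * P - k * Q) + (h * P + k * Q))%C by ring.
    eapply Rle_lt_trans; [apply Cmod_triangle|].
    pose proof (Cmod_triangle (h * P) (k * Q)) as T. rewrite !Cmod_mult in T.
    pose proof (Cmod_ge_0 h). pose proof (Cmod_ge_0 k).
    pose proof (Cmod_ge_0 P). pose proof (Cmod_ge_0 Q).
    pose proof (Rle_abs K). pose proof (Rabs_pos K).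
    assert (K * (Cmod h + Cmod k) ^ 2 <= Rabs K * (2 * d) * (Cmod h + Cmod k)).
    { apply Rle_trans with (Rabs K * (Cmod h + Cmod k) ^ 2); [apply Rmult_le_compat_r; nra|].
      rewrite Rmult_assoc. apply Rmult_le_compat_l; auto. nra. }
    apply Rle_lt_trans with (B * (Cmod h + Cmod k)).
    - unfold B. nra.
    - apply Rlt_le_trans with (B * (2 * e)).
      + apply Rmult_lt_compat_l; lra.
      + apply (Rmult_le_compat_l (2 * B)) in He2; [|lra].
        replace (2 * B * (eps / (2 * B))) with (pos eps) in He2 by (field; lra). lra. }
  exists (mkposreal _ (Rdiv_lt_0_compat _ _ He Hnf)). intros [s' t'] [B1 B2].
  apply (norm_compat2 (V := C_NormedModule)) in B1, B2. simpl in B1, B2. fold nf in B1, B2.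
  replace (nf * (e / nf)) with e in B1, B2 by (field; lra).
  exact (Key s' t' B1 B2).
Qed.

(** * Two solutions with fractional exponents along x = 0 *)

(** The coefficients of the hypergeometric function 0F1(x + 1; w / z^2). *)
Fixpoint bessel (z : C) (x : R) (n : nat) : C :=
  match n with
  | O => 1
  | S m => (bessel z x m / (z ^ 2 * RtoC (INR (S m) * (x + INR (S m)))))%C
  end.

Lemma bessel_denominator_neq_0 (x : R) (m : nat) : 0 <= x ->
  RtoC (INR (S m) * (x + INR (S m))) <> 0.
Proof.
  intros Hx E. apply RtoC_inj in E. pose proof (lt_0_INR (S m) ltac:(lia)). nra.
Qed.

Lemma bessel_S (z : C) (x : R) (n : nat) : z <> RtoC 0 -> 0 <= x ->
  (bessel z x (S n) * RtoC (INR (S n) * (x + INR (S n))))%C = (bessel z x n / z ^ 2)%C.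
Proof.
  intros Hz Hx. pose proof (bessel_denominator_neq_0 x n Hx) as N.
  cbn [bessel]. field. auto.
Qed.

Lemma bessel_shift (z : C) (x : R) (n : nat) : z <> RtoC 0 -> 0 <= x ->
  (bessel z (x + 1) n * RtoC (x + 1 + INR n))%C = (bessel z x n * RtoC (x + 1))%C.
Proof.
  intros Hz Hx. induction n as [|n IH].
  - simpl. rewrite Rplus_0_r. reflexivity.
  - cbn [bessel]. rewrite !S_INR in *. pose proof (pos_INR n) as Hn.
    set (k := INR n) in *. rewrite !RtoC_mult, !RtoC_plus in *.
    assert (N1 : (RtoC k + 1)%C <> 0).
    { rewrite <- RtoC_plus. intros E; apply RtoC_inj in E; lra. }
    assert (N2 : (RtoC x + (RtoC k + 1))%C <> 0).
    { rewrite <- !RtoC_plus. intros E; apply RtoC_inj in E; lra. }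
    assert (N3 : (RtoC x + 1 + (RtoC k + 1))%C <> 0).
    { rewrite <- !RtoC_plus. intros E; apply RtoC_inj in E; lra. }
    transitivity (bessel z (x + 1) n * (RtoC x + 1 + RtoC k) /
      (z ^ 2 * (RtoC k + 1) * (RtoC x + (RtoC k + 1))))%C.
    + field. auto.
    + rewrite IH. field. auto.
Qed.

Lemma Cmod_bessel (z : C) (x : R) (n : nat) : z <> RtoC 0 -> 0 <= x ->
  Cmod (bessel z x n) <= (/ Cmod z ^ 2) ^ n / INR (fact n).
Proof.
  intros Hz Hx. assert (Hm : 0 < Cmod z) by now apply Cmod_gt_0.
  assert (Hm2 : 0 < Cmod z ^ 2) by now apply pow_lt.
  induction n as [|n IH].
  - simpl. rewrite Cmod_1. lra.
  - cbn [bessel]. pose proof (bessel_denominator_neq_0 x n Hx) as N.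
    rewrite Cmod_div, Cmod_mult, Cmod_pow, Cmod_R
      by (apply Cmult_neq_0; auto; apply Cpow_nz; auto).
    pose proof (lt_0_INR (S n) ltac:(lia)) as Hn.
    assert (H1 : 1 <= INR (S n)) by (apply (le_INR 1); lia).
    rewrite Rabs_right by nra.
    rewrite fact_simpl, mult_INR. cbn [pow].
    pose proof (INR_fact_lt_0 n) as Hf.
    apply Rle_trans with ((/ (Cmod z * (Cmod z * 1))) ^ n / INR (fact n) /
       (Cmod z ^ 2 * INR (S n))).
    + unfold Rdiv. apply Rmult_le_compat.
      * apply Cmod_ge_0.
      * left. apply Rinv_0_lt_compat. apply Rmult_lt_0_compat; auto. nra.
      * exact IH.
      * apply Rinv_le_contravar; [nra|]. apply Rmult_le_compat_l; [lra|]. nra.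
    + right. cbn [pow]. field. repeat split; lra.
Qed.

Definition frob_lam (al : R) (l n : nat) : R := INR l + al + INR n.
Definition frob_mu (l n : nat) : R := INR n.
Definition frob_coef (z : C) (al : R) (a : nat -> R) (l n : nat) : C :=
  (RtoC (a l) * bessel z (INR l + al) n)%C.

(** The recurrence of the equation x D^3 = 3 (3 D + 1) (3 D + 2) (x d/dx) at y = 0,
    where D = - x d/dx, on the exponents al, al + 1, al + 2, and so on. *)
Definition frob_rec (al : R) (a : nat -> R) : Prop :=
  forall l, a (S l) * (3 * (3 * (INR l + 1 + al) - 1) * (3 * (INR l + 1 + al) - 2)
                       * (INR l + 1 + al)) = - (INR l + al) ^ 3 * a l.

Definition frob_restr (al : R) (a : nat -> R) (u : C) : C :=
  Cseries (fun l => (RtoC (a l) * Cexp (RtoC (INR l + al) * u))%C).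

(** Consecutive coefficients have a ratio of modulus at most 1/27. *)
Lemma frob_coef_bound al a : 0 < al -> (3 * al - 1) * (3 * al - 2) = 0 ->
  frob_rec al a -> forall l, Rabs (a l) <= Rabs (a 0%nat) * (/ 27) ^ l.
Proof.
  intros Ha Hi H l. induction l as [|l IH].
  - simpl. lra.
  - specialize (H l). pose proof (pos_INR l) as Hl.
    set (k := INR l) in *. set (x := k + al).
    assert (Hx : 0 < x) by (unfold x; lra).
    assert (Hal : 1 / 3 <= al <= 2 / 3) by (destruct (Rmult_integral _ _ Hi); lra).
    assert (Hx1 : 1 / 3 <= x) by (unfold x; lra).
    set (den := 3 * (3 * (k + 1 + al) - 1) * (3 * (k + 1 + al) - 2) * (k + 1 + al)) in *.
    assert (Ed : den = 27 * x ^ 3 + 3 * (18 * x * x + 11 * x + 2)) by (unfold den, x; ring).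
    assert (Hd : 27 * x ^ 3 <= den) by (rewrite Ed; nra).
    fold x in H.
    assert (Hx3 : 0 < x ^ 3) by now apply pow_lt.
    apply (f_equal Rabs) in H. rewrite !Rabs_mult, Rabs_Ropp in H.
    rewrite (Rabs_right den), (Rabs_right (x ^ 3)) in H by lra.
    cbn [pow]. pose proof (Rabs_pos (a (S l))). pose proof (Rabs_pos (a l)). nra.
Qed.

Lemma ex_series_exp (q : R) : ex_series (fun n => q ^ n / INR (fact n)).
Proof.
  exists (exp q). apply (is_series_ext (fun n => scal (pow_n q n) (/ INR (fact n)))).
  - intros n. rewrite pow_n_pow. reflexivity.
  - exact (is_exp_Reals q).
Qed.

Lemma ex_series_geometric (A q : R) : 0 <= q < 1 -> ex_series (fun n => A * q ^ n).
Proof.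
  intros Hq. apply ex_series_Rmult_l. apply ex_series_geom. rewrite Rabs_right; lra.
Qed.

Lemma exp_INR_mult (n : nat) (x : R) : exp (INR n * x) = exp x ^ n.
Proof. rewrite <- Rpower_pow by apply exp_pos. unfold Rpower. now rewrite ln_exp. Qed.

Lemma frob_term_bound (z : C) al a (S T : R) l n :
  z <> RtoC 0 -> 0 < al -> (3 * al - 1) * (3 * al - 2) = 0 -> frob_rec al a ->
  Cmod (frob_coef z al a l n) * exp (frob_lam al l n * S + frob_mu l n * T) <=
  (Rabs (a 0%nat) * exp (al * S) * (exp S / 27) ^ l) *
  ((exp (S + T) / Cmod z ^ 2) ^ n / INR (fact n)).
Proof.
  intros Hz Ha Hi Hr. unfold frob_coef, frob_lam, frob_mu.
  rewrite Cmod_mult, Cmod_R.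
  replace ((INR l + al + INR n) * S + INR n * T)
    with (al * S + INR l * S + INR n * (S + T)) by ring.
  rewrite !exp_plus, !exp_INR_mult, <- exp_plus.
  pose proof (frob_coef_bound al a Ha Hi Hr l) as B1.
  pose proof (pos_INR l). pose proof (Cmod_bessel z (INR l + al) n Hz ltac:(lra)) as B2.
  unfold Rdiv. rewrite !Rpow_mult_distr. unfold Rdiv in B2.
  set (b := Cmod (bessel z (INR l + al) n)) in *.
  replace (Rabs (a 0%nat) * exp (al * S) * (exp S ^ l * (/ 27) ^ l) *
   (exp (S + T) ^ n * (/ Cmod z ^ 2) ^ n * / INR (fact n))) with
   (Rabs (a 0%nat) * (/ 27) ^ l * ((/ Cmod z ^ 2) ^ n * / INR (fact n)) *
    (exp (al * S) * exp S ^ l * exp (S + T) ^ n)) by ring.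
  apply Rmult_le_compat_r.
  - repeat apply Rmult_le_pos; try apply pow_le; left; apply exp_pos.
  - apply Rmult_le_compat; auto. apply Rabs_pos. apply Cmod_ge_0.
Qed.

Lemma frob_converges (z : C) (r al : R) a : z <> RtoC 0 -> r <= 27 ->
  0 < al -> (3 * al - 1) * (3 * al - 2) = 0 -> frob_rec al a ->
  expsum_converges r (frob_coef z al a) (frob_lam al) frob_mu.
Proof.
  intros Hz Hr Ha Hi Hrec. split.
  - intros l n. unfold frob_lam, frob_mu. pose proof (pos_INR l). pose proof (pos_INR n). lra.
  - intros S T HS HT.
    exists (fun l => Rabs (a 0%nat) * exp (al * S) * (exp S / 27) ^ l),
      (fun n => (exp (S + T) / Cmod z ^ 2) ^ n / INR (fact n)).
    assert (Hm : 0 < Cmod z) by now apply Cmod_gt_0.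
    pose proof (exp_pos S). pose proof (exp_pos (S + T)). pose proof (exp_pos (al * S)).
    repeat split.
    + intros l. repeat apply Rmult_le_pos; try apply pow_le; try apply Rabs_pos; lra.
    + intros n. apply Rmult_le_pos; [|left; apply Rinv_0_lt_compat, INR_fact_lt_0].
      apply pow_le. apply Rmult_le_pos; [lra|]. left. apply Rinv_0_lt_compat. nra.
    + apply ex_series_geometric. lra.
    + apply ex_series_exp.
    + intros l n. rewrite Cmod_mult, Cmod_R, Rabs_right by (left; apply exp_pos).
      now apply frob_term_bound.
Qed.

(** The sum over l of a_l x^(l + al) 0F1(l + al + 1; x y / z^2), and its iterated
    derivatives. *)
Definition frob (z : C) (al : R) (a : nat -> R) : nat -> nat -> C -> C -> C :=
  expsum (frob_coef z al a) (frob_lam al) frob_mu.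

Ltac RtoC_expand :=
  repeat progress rewrite ?RtoC_plus, ?RtoC_mult, ?RtoC_minus, ?RtoC_pow, ?RtoC_opp.

(** Both equations become a shift of one summation index: of the power of xy in
    the second, of the power of x in the first. *)
Lemma frob_system (z : C) (r al : R) a : z <> RtoC 0 -> r <= 27 ->
  0 < al -> (3 * al - 1) * (3 * al - 2) = 0 -> frob_rec al a ->
  jet_system z r (frob z al a).
Proof.
  intros Hz Hr Ha Hi Hrec s t Hs Ht.
  pose proof (frob_converges z r al a Hz Hr Ha Hi Hrec) as Hc.
  set (A := expterm (frob_coef z al a) (frob_lam al) frob_mu).
  assert (HA : forall i j, summable2 (A i j s t))
    by (intros i j; now apply (expterm_summable r)).
  split.
  - transitivity (dsum (fun l n => Cexp s * (A 0%nat 3%nat s t l n + (-3) * A 1%nat 2%nat s t l n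
        + 3 * A 2%nat 1%nat s t l n + (-1) * A 3%nat 0%nat s t l n))%C).
    { repeat first [rewrite dsum_plus | rewrite dsum_mult];
        repeat first [apply HA | apply summable2_plus | apply summable2_mult].
      unfold frob, expsum, A. ring. }
    transitivity (dsum (fun l n => 27 * A 1%nat 2%nat s t l n + (-54) * A 2%nat 1%nat s t l n
        + 27 * A 3%nat 0%nat s t l n + 27 * A 1%nat 1%nat s t l n
        + (-27) * A 2%nat 0%nat s t l n + 6 * A 1%nat 0%nat s t l n)%C).
    2:{ repeat first [rewrite dsum_plus | rewrite dsum_mult];
        repeat first [apply HA | apply summable2_plus | apply summable2_mult].
      unfold frob, expsum, A. ring. }
    assert (E2 : forall l n, (27 * A 1%nat 2%nat s t l n + (-54) * A 2%nat 1%nat s t l n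
        + 27 * A 3%nat 0%nat s t l n + 27 * A 1%nat 1%nat s t l n
        + (-27) * A 2%nat 0%nat s t l n + 6 * A 1%nat 0%nat s t l n)%C =
       (RtoC (3 * (3 * (INR l + al) - 1) * (3 * (INR l + al) - 2) * frob_lam al l n) *
        frob_coef z al a l n * Cexp (frob_lam al l n * s + frob_mu l n * t))%C).
    { intros l n. unfold A, expterm. RtoC_expand. unfold frob_lam, frob_mu.
      RtoC_expand. ring. }
    symmetry.
    rewrite dsum_shift_l.
    + apply dsum_ext. intros l n. rewrite E2.
      assert (EL : (frob_lam al (S l) n * s + frob_mu (S l) n * t)%C =
        (s + (frob_lam al l n * s + frob_mu l n * t))%C).
      { unfold frob_lam, frob_mu. rewrite S_INR. RtoC_expand. ring. }
      rewrite EL, Cexp_add. unfold A, expterm.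
      set (X := Cexp (frob_lam al l n * s + frob_mu l n * t)).
      unfold frob_coef. rewrite S_INR.
      pose proof (pos_INR l) as Hl.
      pose proof (bessel_shift z (INR l + al) n Hz ltac:(lra)) as HB.
      replace (INR l + 1 + al) with (INR l + al + 1) by ring.
      set (B1 := bessel z (INR l + al + 1) n) in *.
      set (B0 := bessel z (INR l + al) n) in *.
      assert (E3 : (RtoC (frob_lam al (S l) n) * B1)%C = (RtoC (INR l + al + 1) * B0)%C).
      { rewrite Cmult_comm, (Cmult_comm (RtoC (_ + _ + _))), <- HB. f_equal. f_equal.
        unfold frob_lam. rewrite S_INR. ring. }
      specialize (Hrec l).
      replace (INR l + 1 + al) with (INR l + al + 1) in Hrec by ring.
      apply (f_equal RtoC) in Hrec.
      transitivity (Cexp s * X * (RtoC (a (S l)) * (RtoC (3 * (3 * (INR l + al + 1) - 1) *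
         (3 * (INR l + al + 1) - 2)) * (RtoC (frob_lam al (S l) n) * B1))))%C.
      { rewrite (RtoC_mult (3 * (3 * (INR l + al + 1) - 1) * (3 * (INR l + al + 1) - 2))). ring. }
      rewrite E3.
      transitivity (Cexp s * X * B0 * RtoC (a (S l) *
        (3 * (3 * (INR l + al + 1) - 1) * (3 * (INR l + al + 1) - 2) * (INR l + al + 1))))%C.
      { RtoC_expand. ring. }
      rewrite Hrec. unfold frob_lam, frob_mu. RtoC_expand. ring.
    + intros n. rewrite E2. simpl INR. rewrite Rplus_0_l.
      replace (3 * (3 * al - 1) * (3 * al - 2) * frob_lam al 0 n) with 0; [ring|].
      rewrite !Rmult_assoc, <- (Rmult_assoc (3 * al - 1)), Hi. ring.
  - transitivity (dsum (fun l n => Cexp s * Cexp t / z ^ 2 * A 0%nat 0%nat s t l n)%C).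
    2:{ rewrite dsum_mult; auto. }
    unfold frob, expsum. fold A. rewrite dsum_shift_n.
    + apply dsum_ext. intros l n. unfold A, expterm.
      assert (EL : (frob_lam al l (S n) * s + frob_mu l (S n) * t)%C =
        (s + t + (frob_lam al l n * s + frob_mu l n * t))%C).
      { unfold frob_lam, frob_mu. rewrite S_INR. RtoC_expand. ring. }
      rewrite EL, (Cexp_add (s + t)), (Cexp_add s t). unfold frob_coef. pose proof (pos_INR l) as Hl.
      pose proof (bessel_S z (INR l + al) n Hz ltac:(lra)) as HB.
      set (X := Cexp (frob_lam al l n * s + frob_mu l n * t)).
      transitivity (RtoC (a l) * Cexp s * Cexp t * X * (bessel z (INR l + al) (S n) *
        RtoC (INR (S n) * (INR l + al + INR (S n)))))%C.
      { unfold frob_lam, frob_mu. cbn [pow]. RtoC_expand. ring. }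
      rewrite HB. cbn [pow]. RtoC_expand. field. auto.
    + intros l. unfold A, expterm, frob_mu. simpl. RtoC_expand. ring.
Qed.

Lemma frob_Hbar (z : C) (r al : R) a : z <> RtoC 0 -> r <= 27 ->
  0 < al -> (3 * al - 1) * (3 * al - 2) = 0 -> frob_rec al a ->
  Hbar z r (frob z al a 0%nat 0%nat).
Proof.
  intros Hz Hr Ha Hi Hrec. pose proof (frob_converges z r al a Hz Hr Ha Hi Hrec) as Hc.
  apply Hbar_jet; auto. exists (frob z al a). split; [|split; [|split]].
  - intros s t _ _. reflexivity.
  - now apply expsum_jet.
  - now apply frob_system.
  - now apply expsum_continuous.
Qed.

Lemma frob_loop_x (z : C) (r al : R) a s t : z <> RtoC 0 -> r <= 27 ->
  0 < al -> (3 * al - 1) * (3 * al - 2) = 0 -> frob_rec al a ->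
  cover r s -> cover r t ->
  frob z al a 0%nat 0%nat (s + two_pi_i)%C t = (Cexp (al * two_pi_i) * frob z al a 0%nat 0%nat s t)%C.
Proof.
  intros Hz Hr Ha Hi Hrec Hs Ht.
  pose proof (frob_converges z r al a Hz Hr Ha Hi Hrec) as Hc.
  unfold frob, expsum. rewrite <- dsum_mult by now apply (expterm_summable r).
  apply dsum_ext. intros l n. unfold expterm.
  replace (frob_lam al l n * (s + two_pi_i) + frob_mu l n * t)%C with
    (al * two_pi_i + (INR l * two_pi_i + INR n * two_pi_i) +
     (frob_lam al l n * s + frob_mu l n * t))%C
    by (unfold frob_lam, frob_mu; RtoC_expand; ring).
  rewrite !Cexp_add, !Cexp_nat_two_pi_i. ring.
Qed.

Lemma frob_loop_y (z : C) al a s t :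
  frob z al a 0%nat 0%nat s (t + two_pi_i)%C = frob z al a 0%nat 0%nat s t.
Proof.
  apply dsum_ext. intros l n. unfold expterm.
  replace (frob_lam al l n * s + frob_mu l n * (t + two_pi_i))%C with
    (INR n * two_pi_i + (frob_lam al l n * s + frob_mu l n * t))%C
    by (unfold frob_mu; ring).
  rewrite Cexp_add, Cexp_nat_two_pi_i. ring.
Qed.

Lemma frob_restr_summable al a u r : r <= 27 ->
  0 < al -> (3 * al - 1) * (3 * al - 2) = 0 -> frob_rec al a -> cover r u ->
  (forall l, Cmod (RtoC (a l) * Cexp (RtoC (INR l + al) * u)) <=
    Rabs (a 0%nat) * exp (al * fst u) * (exp (fst u) / 27) ^ l) /\
  ex_series (fun l => Rabs (a 0%nat) * exp (al * fst u) * (exp (fst u) / 27) ^ l).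
Proof.
  intros Hr Ha Hi Hrec Hu. split.
  - intros l. rewrite Cmod_mult, Cmod_R, Cmod_Cexp.
    replace (fst (RtoC (INR l + al) * u)%C) with (al * fst u + INR l * fst u)
      by (simpl; ring).
    rewrite exp_plus, exp_INR_mult. unfold Rdiv. rewrite Rpow_mult_distr.
    pose proof (frob_coef_bound al a Ha Hi Hrec l).
    replace (Rabs (a 0%nat) * exp (al * fst u) * (exp (fst u) ^ l * (/ 27) ^ l)) with
      (Rabs (a 0%nat) * (/ 27) ^ l * (exp (al * fst u) * exp (fst u) ^ l)) by ring.
    apply Rmult_le_compat_r; auto.
    apply Rmult_le_pos; [|apply pow_le]; left; apply exp_pos.
  - apply ex_series_geometric. unfold cover in Hu. pose proof (exp_pos (fst u)). lra.
Qed.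

Lemma frob_restr_loop al a u r : r <= 27 ->
  0 < al -> (3 * al - 1) * (3 * al - 2) = 0 -> frob_rec al a -> cover r u ->
  frob_restr al a (u + two_pi_i)%C = (Cexp (al * two_pi_i) * frob_restr al a u)%C.
Proof.
  intros Hr Ha Hi Hrec Hu.
  destruct (frob_restr_summable al a u r Hr Ha Hi Hrec Hu) as [B S].
  unfold frob_restr. rewrite <- Cseries_mult by exact (Csummable_le _ _ B S).
  apply Cseries_ext. intros l.
  replace (RtoC (INR l + al) * (u + two_pi_i))%C with
    (al * two_pi_i + INR l * two_pi_i + RtoC (INR l + al) * u)%C by (RtoC_expand; ring).
  rewrite !Cexp_add, Cexp_nat_two_pi_i. ring.
Qed.

(** Near 0 the leading term dominates the rest. *)
Lemma frob_restr_neq_0 (r al : R) a : 0 < r <= 27 ->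
  0 < al -> (3 * al - 1) * (3 * al - 2) = 0 -> frob_rec al a -> a 0%nat <> 0 ->
  exists u, cover r u /\ frob_restr al a u <> 0.
Proof.
  intros Hr Ha Hi Hrec H0.
  set (u := (ln (r / 3), 0) : C).
  assert (Eu : exp (fst u) = r / 3).
  { change (exp (ln (r / 3)) = r / 3). apply exp_ln. lra. }
  assert (Hu : cover r u) by (unfold cover; lra).
  exists u. split; auto.
  destruct (frob_restr_summable al a u r (proj2 Hr) Ha Hi Hrec Hu) as [B S].
  unfold frob_restr. rewrite Cseries_incr_1 by exact (Csummable_le _ _ B S).
  set (X := (RtoC (a 0%nat) * Cexp (RtoC (INR 0 + al) * u))%C).
  set (Y := Cseries (fun n => RtoC (a (Datatypes.S n)) * Cexp (RtoC (INR (Datatypes.S n) + al) * u))%C).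
  intros E.
  assert (EX : Cmod X = Rabs (a 0%nat) * exp (al * fst u)).
  { unfold X. rewrite Cmod_mult, Cmod_R, Cmod_Cexp. simpl. f_equal. f_equal. ring. }
  assert (EY : Cmod Y = Cmod X).
  { replace Y with (X + Y + - X)%C by ring. rewrite E, Cplus_0_l. apply Cmod_opp. }
  set (q := exp (fst u) / 27) in *.
  assert (Hq : 0 <= q <= 1 / 3) by (unfold q; lra).
  assert (HP : 0 < Rabs (a 0%nat) * exp (al * fst u)).
  { apply Rmult_lt_0_compat; [now apply Rabs_pos_lt|apply exp_pos]. }
  set (P := Rabs (a 0%nat) * exp (al * fst u)) in *.
  assert (HY : Cmod Y <= P * q * / (1 - q)).
  { unfold Y. rewrite <- (Series_geom q), <- Series_scal_l by (rewrite Rabs_right; lra).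
    apply Cmod_Cseries_le.
    - intros n. eapply Rle_trans; [apply B|]. right. simpl. ring.
    - apply ex_series_geometric. lra. }
  assert (P * q * / (1 - q) < P).
  { apply (Rmult_lt_reg_r (1 - q)); [lra|]. rewrite Rmult_assoc, Rinv_l by lra. nra. }
  lra.
Qed.

(** Every term with n > 0 carries a factor x y / z^2, which is small near y = 0. *)
Lemma frob_restriction (z : C) (r al : R) a : z <> RtoC 0 -> r <= 27 ->
  0 < al -> (3 * al - 1) * (3 * al - 2) = 0 -> frob_rec al a ->
  is_restriction r div_y (frob z al a 0%nat 0%nat) (frob_restr al a).
Proof.
  intros Hz Hr Ha Hi Hrec u Hu eps Heps.
  destruct (frob_restr_summable al a u r Hr Ha Hi Hrec Hu) as [B Sg].
  set (U := fun l => Rabs (a 0%nat) * exp (al * fst u) * (exp (fst u) / 27) ^ l) in *.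
  assert (HU : forall l, 0 <= U l).
  { intros l. eapply Rle_trans; [apply Cmod_ge_0|apply B]. }
  assert (Hm : 0 < Cmod z ^ 2) by (apply pow_lt; now apply Cmod_gt_0).
  pose proof (ex_series_exp 1) as Se.
  set (M := Series U * Series (fun n => 1 ^ n / INR (fact n))).
  set (q0 := Rmin 1 (eps / (Rabs M + 1))).
  assert (Hq0 : 0 < q0).
  { apply Rmin_pos; [lra|]. apply Rdiv_lt_0_compat; auto. pose proof (Rabs_pos M); lra. }
  exists (Rmin (ln r) (ln (q0 * Cmod z ^ 2) - fst u)). intros v Hv.
  assert (Hr0 : 0 < r) by (unfold cover in Hu; pose proof (exp_pos (fst u)); lra).
  assert (Hv1 : cover r v).
  { unfold cover. rewrite <- (exp_ln r) by auto. apply exp_increasing.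
    eapply Rlt_le_trans; [exact Hv|apply Rmin_l]. }
  set (q := exp (fst u + fst v) / Cmod z ^ 2).
  assert (Hq : 0 < q < q0).
  { split.
    - apply Rdiv_lt_0_compat; auto. apply exp_pos.
    - unfold q. apply (Rmult_lt_reg_r (Cmod z ^ 2)); auto.
      unfold Rdiv. rewrite Rmult_assoc, Rinv_l, Rmult_1_r by lra.
      rewrite <- (exp_ln (q0 * Cmod z ^ 2)) by nra. apply exp_increasing.
      pose proof (Rmin_r (ln r) (ln (q0 * Cmod z ^ 2) - fst u)). lra. }
  assert (Hq1 : q < 1) by (eapply Rlt_le_trans; [apply Hq|apply Rmin_l]).
  pose proof (frob_converges z r al a Hz Hr Ha Hi Hrec) as Hc.
  set (A := expterm (frob_coef z al a) (frob_lam al) frob_mu 0 0 u v).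
  assert (HA : forall l n, Cmod (A l n) <= U l * (q ^ n / INR (fact n))).
  { intros l n. eapply Rle_trans; [|exact (frob_term_bound z al a (fst u) (fst v) l n Hz Ha Hi Hrec)].
    right. unfold A, expterm. simpl (_ ^ 0). rewrite Rmult_1_l, Cmult_1_r.
    rewrite Cmod_mult, Cmod_Cexp. f_equal. f_equal. simpl. ring. }
  assert (PA : product_bound A U (fun n => q ^ n / INR (fact n))).
  { repeat split; auto.
    - intros n. apply Rmult_le_pos; [apply pow_le; lra|].
      left; apply Rinv_0_lt_compat, INR_fact_lt_0.
    - apply ex_series_exp. }
  assert (PB : product_bound (fun l n => A l (S n)) (fun l => q * U l) (fun n => 1 ^ n / INR (fact n))).
  { repeat split; auto.
    - intros l. apply Rmult_le_pos; auto. lra.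
    - intros n. apply Rmult_le_pos; [apply pow_le; lra|].
      left; apply Rinv_0_lt_compat, INR_fact_lt_0.
    - now apply ex_series_Rmult_l.
    - intros l n. eapply Rle_trans; [apply HA|].
      rewrite (Rmult_comm q), Rmult_assoc. apply Rmult_le_compat_l; auto.
      unfold Rdiv. simpl (q ^ S n). rewrite Rmult_assoc. apply Rmult_le_compat_l; [lra|].
      apply Rmult_le_compat.
      + apply pow_le; lra.
      + left; apply Rinv_0_lt_compat, INR_fact_lt_0.
      + apply pow_incr; lra.
      + apply Rinv_le_contravar; [apply INR_fact_lt_0|]. apply le_INR, fact_le. lia. }
  assert (E : coords div_y (frob z al a 0%nat 0%nat) u v =
     (frob_restr al a u + dsum (fun l n => A l (S n)))%C).
  { simpl. unfold frob, expsum. fold A. unfold dsum, frob_restr.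
    rewrite <- Cseries_plus.
    - apply Cseries_ext. intros l. rewrite Cseries_incr_1 by (eapply product_bound_row; eauto).
      f_equal. unfold A, expterm, frob_coef, frob_lam, frob_mu. simpl (bessel _ _ 0).
      simpl (_ ^ 0). simpl (INR 0). rewrite Rmult_1_l, Rplus_0_r.
      replace (RtoC (INR l + al) * u + RtoC 0 * v)%C with (RtoC (INR l + al) * u)%C by ring.
      ring.
    - exact (Csummable_le _ _ B Sg).
    - eapply product_bound_rows; eauto. }
  rewrite E. replace (frob_restr al a u + dsum (fun l n => A l (S n)) - frob_restr al a u)%C
    with (dsum (fun l n => A l (S n))) by ring.
  eapply Rle_lt_trans; [apply (dsum_bound _ _ _ PB)|].
  rewrite Series_scal_l, Rmult_assoc. fold M.
  pose proof (Rle_abs M). pose proof (Rabs_pos M).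
  assert (Hq2 : q < eps / (Rabs M + 1)) by (eapply Rlt_le_trans; [apply Hq|apply Rmin_r]).
  apply (Rmult_lt_compat_r (Rabs M + 1)) in Hq2; [|lra].
  unfold Rdiv in Hq2. rewrite Rmult_assoc, Rinv_l, Rmult_1_r in Hq2 by lra. nra.
Qed.

(** * The Gamma function *)

Definition gamma_integrand (a t : R) : R := Rpower t (a - 1) * exp (- t).

Lemma gamma_integrand_pos a t : 0 < gamma_integrand a t.
Proof. apply Rmult_lt_0_compat; apply exp_pos. Qed.

Lemma gamma_integrand_continuous a t : 0 < t -> continuous (gamma_integrand a) t.
Proof.
  intros Ht. apply (ex_derive_continuous (V := R_NormedModule)).
  unfold gamma_integrand, Rpower. auto_derive. auto.
Qed.

Lemma gamma_integrable a x y : 0 < x -> 0 < y -> ex_RInt (gamma_integrand a) x y.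
Proof.
  intros Hx Hy. apply (ex_RInt_continuous (V := R_CompleteNormedModule)).
  intros t Ht. apply gamma_integrand_continuous.
  assert (0 < Rmin x y) by now apply Rmin_pos. lra.
Qed.

Lemma RInt_of_primitive (f F : R -> R) (x y : R) : 0 < x <= y ->
  (forall t, 0 < t -> is_derive F t (f t)) -> (forall t, 0 < t -> continuous f t) ->
  ex_RInt f x y /\ RInt f x y = F y - F x.
Proof.
  intros Hxy HF Hf.
  assert (H : is_RInt f x y (minus (F y) (F x))).
  { apply (is_RInt_derive (V := R_CompleteNormedModule)); intros t Ht;
      rewrite Rmin_left, Rmax_right in Ht by lra; [apply HF|apply Hf]; lra. }
  split; [now exists (minus (F y) (F x))|]. now apply is_RInt_unique.
Qed.

(** The comparison functions are t^(a - 1) on (0, 1] and e^(-t) beyond. *)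
Lemma gamma_partial_bound a x y : 0 < a <= 1 -> 0 < x <= 1 -> 1 <= y ->
  RInt (gamma_integrand a) x y <= / a + 1.
Proof.
  intros Ha Hx Hy.
  rewrite <- (RInt_Chasles (V := R_CompleteNormedModule) (gamma_integrand a) x 1 y)
    by (apply gamma_integrable; lra).
  assert (B1 : RInt (gamma_integrand a) x 1 <= / a).
  { destruct (RInt_of_primitive (fun t => Rpower t (a - 1)) (fun t => Rpower t a / a) x 1)
      as [E1 E2].
    - lra.
    - intros t Ht. unfold Rpower. auto_derive; auto.
      replace ((a - 1) * ln t) with (a * ln t + - ln t) by ring.
      rewrite exp_plus, exp_Ropp, exp_ln by auto. field. lra.
    - intros t Ht. apply (ex_derive_continuous (V := R_NormedModule)).
      unfold Rpower. auto_derive. auto.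
    - eapply Rle_trans; [apply (RInt_le _ (fun t => Rpower t (a - 1)))|]; try lra; auto.
      + apply gamma_integrable; lra.
      + intros t Ht. unfold gamma_integrand.
        rewrite <- (Rmult_1_r (Rpower t (a - 1))) at 2.
        apply Rmult_le_compat_l; [left; apply exp_pos|].
        rewrite <- exp_0. apply exp_le. lra.
      + rewrite E2. unfold Rpower at 1. rewrite ln_1, Rmult_0_r, exp_0.
        assert (0 < Rpower x a / a) by (apply Rdiv_lt_0_compat; [apply exp_pos|lra]).
        unfold Rdiv at 1. lra. }
  assert (B2 : RInt (gamma_integrand a) 1 y <= 1).
  { destruct (RInt_of_primitive (fun t => exp (- t)) (fun t => - exp (- t)) 1 y)
      as [E1 E2].
    - lra.
    - intros t Ht. auto_derive; auto. ring.
    - intros t Ht. apply (ex_derive_continuous (V := R_NormedModule)). auto_derive. auto.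
    - eapply Rle_trans; [apply (RInt_le _ (fun t => exp (- t)))|]; try lra; auto.
      + apply gamma_integrable; lra.
      + intros t Ht. unfold gamma_integrand.
        rewrite <- (Rmult_1_l (exp (- t))) at 2.
        apply Rmult_le_compat_r; [left; apply exp_pos|].
        assert (0 < ln t) by (rewrite <- ln_1; apply ln_increasing; lra).
        apply Rle_trans with (exp 0); [|rewrite exp_0; lra].
        unfold Rpower. apply exp_le. nra.
      + rewrite E2. pose proof (exp_pos (- y)).
        pose proof (exp_le (- (1)) 0 ltac:(lra)) as E0. rewrite exp_0 in E0. lra. }
  unfold plus; simpl. lra.
Qed.

Lemma gamma_partial_mono a x y x' y' : 0 < x' <= x -> x <= y -> y <= y' ->
  RInt (gamma_integrand a) x y <= RInt (gamma_integrand a) x' y'.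
Proof.
  intros Hx Hxy Hy.
  rewrite <- (RInt_Chasles (V := R_CompleteNormedModule) (gamma_integrand a) x' x y')
    by (apply gamma_integrable; lra).
  rewrite <- (RInt_Chasles (V := R_CompleteNormedModule) (gamma_integrand a) x y y')
    by (apply gamma_integrable; lra).
  assert (P : forall u v, 0 < u <= v -> 0 <= RInt (gamma_integrand a) u v).
  { intros u v Huv. apply RInt_ge_0; [lra|apply gamma_integrable; lra|].
    intros t Ht. left; apply gamma_integrand_pos. }
  pose proof (P x' x ltac:(lra)). pose proof (P y y' ltac:(lra)).
  unfold plus; simpl. lra.
Qed.

(** Monotone bounded partial integrals converge to their supremum. *)
Lemma gamma_base a : 0 < a <= 1 ->
  exists l, 0 < l /\ is_RInt_gen (gamma_integrand a) (at_right 0) (Rbar_locally p_infty) l.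
Proof.
  intros Ha.
  set (E := fun I => exists x y, 0 < x < 1 /\ 1 < y /\ I = RInt (gamma_integrand a) x y).
  assert (HE : E (RInt (gamma_integrand a) (1 / 2) 2)).
  { exists (1 / 2), 2. repeat split; lra. }
  destruct (completeness E) as [l [Hub Hlub]].
  - exists (/ a + 1). intros I (x & y & Hx & Hy & ->). apply gamma_partial_bound; lra.
  - now exists (RInt (gamma_integrand a) (1 / 2) 2).
  - exists l. split.
    + apply Rlt_le_trans with (2 := Hub _ HE).
      apply RInt_gt_0; [lra| |].
      * intros t Ht. apply gamma_integrand_pos.
      * intros t Ht. apply gamma_integrand_continuous. lra.
    + intros P [eps HP].
      assert (Hex : exists x y, 0 < x < 1 /\ 1 < y /\
        l - eps < RInt (gamma_integrand a) x y).
      { apply Classical_Prop.NNPP. intros N.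
        assert (l <= l - eps).
        { apply Hlub. intros I (x & y & Hx & Hy & ->).
          apply Rnot_lt_le. intros K. apply N. exists x, y. auto. }
        pose proof (cond_pos eps). lra. }
      destruct Hex as (x0 & y0 & Hx0 & Hy0 & H0).
      apply (Filter_prod _ _ _ (fun x => 0 < x < x0) (fun y => y0 < y)).
      * exists (mkposreal x0 (proj1 Hx0)). intros x Hx Hx'. split; auto.
        unfold ball in Hx; simpl in Hx. unfold AbsRing_ball, abs, minus, plus, opp in Hx.
        simpl in Hx. rewrite Ropp_0, Rplus_0_r, Rabs_right in Hx by lra. exact Hx.
      * exists y0. auto.
      * intros x y Hx Hy. exists (RInt (gamma_integrand a) x y). split.
        -- apply (RInt_correct (V := R_CompleteNormedModule)). apply gamma_integrable; simpl; lra.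
        -- apply HP. unfold ball; simpl. unfold AbsRing_ball, abs, minus, plus, opp; simpl.
           pose proof (gamma_partial_mono a x0 y0 x y ltac:(lra) ltac:(lra) ltac:(lra)).
           assert (RInt (gamma_integrand a) x y <= l).
           { apply Hub. exists x, y. repeat split; lra. }
           pose proof (cond_pos eps). apply Rabs_def1; lra.
Qed.

Lemma ln_le_2_sqrt t : 0 < t -> ln t <= 2 * sqrt t.
Proof.
  intros Ht. assert (Hs : 0 < sqrt t) by now apply sqrt_lt_R0.
  rewrite <- (sqrt_sqrt t) at 1 by lra. rewrite ln_mult by auto.
  assert (ln (sqrt t) <= sqrt t); [|lra].
  rewrite <- (ln_exp (sqrt t)) at 2. apply ln_le; auto.
  pose proof (exp_ineq1 (sqrt t) ltac:(lra)). lra.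
Qed.

(** The function t^a e^(-t), whose derivative relates the integrands for a and
    a + 1, has no boundary terms. *)
Lemma gamma_primitive_at_infinity a : 0 < a ->
  filterlim (gamma_integrand (a + 1)) (Rbar_locally p_infty) (locally 0).
Proof.
  intros Ha. apply filterlim_locally. intros eps.
  exists (Rmax (16 * a ^ 2) (Rmax 1 (- 2 * ln eps))). intros t Ht.
  pose proof (Rmax_l (16 * a ^ 2) (Rmax 1 (- 2 * ln eps))).
  pose proof (Rmax_r (16 * a ^ 2) (Rmax 1 (- 2 * ln eps))).
  pose proof (Rmax_l 1 (- 2 * ln eps)). pose proof (Rmax_r 1 (- 2 * ln eps)).
  unfold ball; simpl. unfold AbsRing_ball, abs, minus, plus, opp; simpl.
  rewrite Ropp_0, Rplus_0_r, Rabs_right by (left; apply gamma_integrand_pos).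
  unfold gamma_integrand, Rpower. rewrite <- exp_plus.
  replace (a + 1 - 1) with a by ring.
  rewrite <- (exp_ln eps) by apply cond_pos. apply exp_increasing.
  pose proof (ln_le_2_sqrt t ltac:(lra)) as H3.
  assert (H4 : 4 * a <= sqrt t).
  { rewrite <- (sqrt_pow2 (4 * a)) by lra. apply sqrt_le_1_alt. nra. }
  pose proof (sqrt_sqrt t ltac:(lra)). nra.
Qed.

Lemma gamma_primitive_at_zero a : 0 < a ->
  filterlim (gamma_integrand (a + 1)) (at_right 0) (locally 0).
Proof.
  intros Ha. apply filterlim_locally. intros eps.
  exists (mkposreal _ (exp_pos (ln eps / a))). intros t Ht Ht0.
  unfold ball in Ht; simpl in Ht. unfold AbsRing_ball, abs, minus, plus, opp in Ht.
  simpl in Ht. rewrite Ropp_0, Rplus_0_r, Rabs_right in Ht by lra.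
  unfold ball; simpl. unfold AbsRing_ball, abs, minus, plus, opp; simpl.
  rewrite Ropp_0, Rplus_0_r, Rabs_right by (left; apply gamma_integrand_pos).
  unfold gamma_integrand, Rpower. rewrite <- exp_plus.
  replace (a + 1 - 1) with a by ring.
  rewrite <- (exp_ln eps) by apply cond_pos. apply exp_increasing.
  apply ln_increasing in Ht; auto. rewrite ln_exp in Ht.
  apply (Rmult_lt_compat_l a) in Ht; auto.
  replace (a * (ln eps / a)) with (ln eps) in Ht by (field; lra). lra.
Qed.

Lemma gamma_primitive_derive a t : 0 < t ->
  is_derive (gamma_integrand (a + 1)) t (a * gamma_integrand a t - gamma_integrand (a + 1) t).
Proof.
  intros Ht. unfold gamma_integrand, Rpower. auto_derive; auto.
  replace ((a - 1) * ln t) with (a * ln t + - ln t) by ring.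
  replace (a + 1 - 1) with a by ring.
  rewrite exp_plus, (exp_Ropp (ln t)), exp_ln by auto. field. lra.
Qed.

Lemma filter_positive (P : R -> Prop) : (forall t, 0 < t -> P t) ->
  filter_prod (at_right 0) (Rbar_locally p_infty)
    (fun ab => forall t, Rmin (fst ab) (snd ab) <= t <= Rmax (fst ab) (snd ab) -> P t).
Proof.
  intros H. apply (Filter_prod _ _ _ (fun x => 0 < x) (fun y => 0 < y)).
  - exists (mkposreal 1 Rlt_0_1). intros x _ Hx. exact Hx.
  - exists 0. auto.
  - intros x y Hx Hy t [Ht _]. apply H. simpl in Ht.
    assert (0 < Rmin x y) by now apply Rmin_pos. lra.
Qed.

(** Integration by parts. *)
Lemma gamma_step a l : 0 < a ->
  is_RInt_gen (gamma_integrand a) (at_right 0) (Rbar_locally p_infty) l ->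
  is_RInt_gen (gamma_integrand (a + 1)) (at_right 0) (Rbar_locally p_infty) (a * l).
Proof.
  intros Ha H.
  set (G := gamma_integrand (a + 1)).
  assert (HD : forall t, 0 < t -> Derive G t = a * gamma_integrand a t - G t).
  { intros t Ht. apply is_derive_unique. now apply gamma_primitive_derive. }
  assert (H1 : is_RInt_gen (Derive G) (at_right 0) (Rbar_locally p_infty) (0 - 0)).
  { apply is_RInt_gen_Derive.
    - apply filter_positive. intros t Ht. eexists. now apply gamma_primitive_derive.
    - apply filter_positive. intros t Ht.
      apply (continuous_ext_loc _ (fun t => a * gamma_integrand a t - G t)).
      + exists (mkposreal t Ht). intros y Hy. symmetry. apply HD.
        unfold ball in Hy; simpl in Hy. unfold AbsRing_ball, abs, minus, plus, opp in Hy.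
        simpl in Hy. apply Rabs_def2 in Hy. lra.
      + apply (continuous_minus (V := R_NormedModule)).
        * apply (continuous_scal_r (V := R_NormedModule)). now apply gamma_integrand_continuous.
        * now apply gamma_integrand_continuous.
    - now apply gamma_primitive_at_zero.
    - now apply gamma_primitive_at_infinity. }
  pose proof (is_RInt_gen_minus (V := R_NormedModule) _ _ _ _
    (is_RInt_gen_scal (V := R_NormedModule) _ a _ H) H1) as H2.
  replace (a * l) with (minus (scal a l) (0 - 0) : R)
    by (unfold minus, plus, opp, scal; simpl; unfold mult; simpl; ring).
  eapply is_RInt_gen_ext; [|exact H2].
  assert (HE : forall t, 0 < t -> minus (scal a (gamma_integrand a t)) (Derive G t) = G t).
  { intros t Ht. rewrite HD by auto.
    unfold minus, plus, opp, scal; simpl; unfold mult; simpl. ring. }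
  eapply filter_imp; [|exact (filter_positive _ HE)].
  intros ab Hab t [Ht1 Ht2]. apply Hab. split; now left.
Qed.

Lemma Gamma_eq a l :
  is_RInt_gen (gamma_integrand a) (at_right 0) (Rbar_locally p_infty) l -> Gamma a = l.
Proof. intros H. exact (is_RInt_gen_unique (V := R_CompleteNormedModule) _ l H). Qed.

Lemma Gamma_nat_plus a (n : nat) : 0 < a <= 1 ->
  0 < Gamma (INR n + a) /\
  is_RInt_gen (gamma_integrand (INR n + a)) (at_right 0) (Rbar_locally p_infty)
    (Gamma (INR n + a)).
Proof.
  intros Ha. induction n as [|n [IH1 IH2]].
  - simpl. rewrite Rplus_0_l. destruct (gamma_base a Ha) as (l & Hl & H).
    now rewrite (Gamma_eq a l H).
  - rewrite S_INR. replace (INR n + 1 + a) with (INR n + a + 1) by ring.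
    pose proof (pos_INR n).
    pose proof (gamma_step (INR n + a) _ ltac:(lra) IH2) as H1.
    rewrite (Gamma_eq _ _ H1). split; auto. apply Rmult_lt_0_compat; lra.
Qed.

Lemma Gamma_succ a (n : nat) : 0 < a <= 1 ->
  Gamma (INR n + a + 1) = (INR n + a) * Gamma (INR n + a).
Proof.
  intros Ha. destruct (Gamma_nat_plus a n Ha) as [_ H]. pose proof (pos_INR n).
  apply Gamma_eq. apply gamma_step; auto. lra.
Qed.

(** * The regularized FJRW I-function *)

Definition fjrw_coef_0 (l : nat) : R :=
  (-1) ^ (3 * l + 1) * Gamma (INR l + 1 / 3) ^ 4
  / (INR (fact (3 * l)) * Gamma (INR l + 4 / 3) * Gamma (1 / 3) ^ 4).

Definition fjrw_coef_1 (l : nat) : R :=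
  (-1) ^ (3 * l + 2) * Gamma (INR l + 2 / 3) ^ 4
  / (INR (fact (3 * l + 1)) * Gamma (INR l + 5 / 3) * Gamma (2 / 3) ^ 4).

Lemma pow_m1_3 (k : nat) : (-1) ^ (3 + k) = - (-1) ^ k.
Proof. simpl. ring. Qed.

Lemma fact_3 (m : nat) :
  INR (fact (3 + m)) = (INR m + 3) * (INR m + 2) * (INR m + 1) * INR (fact m).
Proof.
  change (3 + m)%nat with (S (S (S m))).
  rewrite !fact_simpl, !mult_INR, !S_INR. ring.
Qed.

Lemma fjrw_rec_0 : frob_rec (1 / 3) fjrw_coef_0.
Proof.
  intros l. unfold fjrw_coef_0.
  replace (3 * S l)%nat with (3 + 3 * l)%nat by lia.
  replace (3 + 3 * l + 1)%nat with (3 + (3 * l + 1))%nat by lia.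
  rewrite pow_m1_3, fact_3, S_INR.
  destruct (Gamma_nat_plus (1 / 3) l ltac:(lra)) as [G1 _].
  destruct (Gamma_nat_plus (1 / 3) 0 ltac:(lra)) as [G0 _].
  simpl (INR 0) in G0. rewrite Rplus_0_l in G0.
  pose proof (Gamma_succ (1 / 3) l ltac:(lra)) as E1.
  pose proof (Gamma_succ (1 / 3) (S l) ltac:(lra)) as E2. rewrite S_INR in E2.
  replace (INR l + 1 + 1 / 3) with (INR l + 1 / 3 + 1) in * by field.
  replace (INR l + 1 + 4 / 3) with (INR l + 1 / 3 + 1 + 1) by field.
  replace (INR l + 4 / 3) with (INR l + 1 / 3 + 1) by field.
  rewrite E2, E1, mult_INR. simpl (INR 3).
  pose proof (pos_INR l) as Hl. pose proof (INR_fact_lt_0 (3 * l)) as Hf.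
  set (k := INR l) in *. set (G := Gamma (k + 1 / 3)) in *. set (H := Gamma (1 / 3)) in *.
  field. repeat split; lra.
Qed.

Lemma fjrw_rec_1 : frob_rec (2 / 3) fjrw_coef_1.
Proof.
  intros l. unfold fjrw_coef_1.
  replace (3 * S l + 1)%nat with (3 + (3 * l + 1))%nat by lia.
  replace (3 * S l + 2)%nat with (3 + (3 * l + 2))%nat by lia.
  rewrite pow_m1_3, fact_3, S_INR.
  destruct (Gamma_nat_plus (2 / 3) l ltac:(lra)) as [G1 _].
  destruct (Gamma_nat_plus (2 / 3) 0 ltac:(lra)) as [G0 _].
  simpl (INR 0) in G0. rewrite Rplus_0_l in G0.
  pose proof (Gamma_succ (2 / 3) l ltac:(lra)) as E1.
  pose proof (Gamma_succ (2 / 3) (S l) ltac:(lra)) as E2. rewrite S_INR in E2.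
  replace (INR l + 1 + 2 / 3) with (INR l + 2 / 3 + 1) in * by field.
  replace (INR l + 1 + 5 / 3) with (INR l + 2 / 3 + 1 + 1) by field.
  replace (INR l + 5 / 3) with (INR l + 2 / 3 + 1) by field.
  rewrite E2, E1, plus_INR, mult_INR. simpl (INR 3). simpl (INR 1).
  pose proof (pos_INR l) as Hl. pose proof (INR_fact_lt_0 (3 * l + 1)) as Hf.
  set (k := INR l) in *. set (G := Gamma (k + 2 / 3)) in *. set (H := Gamma (2 / 3)) in *.
  field. repeat split; lra.
Qed.

Lemma fjrw_coef_0_neq_0 : fjrw_coef_0 0 <> 0.
Proof.
  destruct (Gamma_nat_plus (1 / 3) 0 ltac:(lra)) as [G0 _].
  destruct (Gamma_nat_plus (1 / 3) 1 ltac:(lra)) as [G1 _].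
  unfold fjrw_coef_0. simpl (INR 0) in *. simpl (INR 1) in *. rewrite Rplus_0_l in *.
  replace (1 + 1 / 3) with (4 / 3) in G1 by field.
  unfold Rdiv. apply Rmult_integral_contrapositive_currified;
    [apply Rmult_integral_contrapositive_currified|].
  - apply pow_nonzero; lra.
  - apply pow_nonzero. apply Rgt_not_eq. rewrite ?Rplus_0_l. exact G0.
  - apply Rinv_neq_0_compat. apply Rmult_integral_contrapositive_currified;
      [apply Rmult_integral_contrapositive_currified|].
    + apply INR_fact_neq_0.
    + apply Rgt_not_eq. rewrite Rplus_0_l. exact G1.
    + apply pow_nonzero. apply Rgt_not_eq. rewrite ?Rplus_0_l. exact G0.
Qed.

Lemma fjrw_coef_1_neq_0 : fjrw_coef_1 0 <> 0.
Proof.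
  destruct (Gamma_nat_plus (2 / 3) 0 ltac:(lra)) as [G0 _].
  destruct (Gamma_nat_plus (2 / 3) 1 ltac:(lra)) as [G1 _].
  unfold fjrw_coef_1. simpl (INR 0) in *. simpl (INR 1) in *. rewrite Rplus_0_l in *.
  replace (1 + 2 / 3) with (5 / 3) in G1 by field.
  unfold Rdiv. apply Rmult_integral_contrapositive_currified;
    [apply Rmult_integral_contrapositive_currified|].
  - apply pow_nonzero; lra.
  - apply pow_nonzero. apply Rgt_not_eq. rewrite ?Rplus_0_l. exact G0.
  - apply Rinv_neq_0_compat. apply Rmult_integral_contrapositive_currified;
      [apply Rmult_integral_contrapositive_currified|].
    + apply INR_fact_neq_0.
    + apply Rgt_not_eq. rewrite Rplus_0_l. exact G1.
    + apply pow_nonzero. apply Rgt_not_eq. rewrite ?Rplus_0_l. exact G0.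
Qed.

(** * The cubic threefold: convergence and monodromy of its I-function *)

(** The sum of the moduli of the coefficients is submultiplicative modulo p^5. *)
Definition pnorm (a : nat -> C) : R := sum_n (fun k => Cmod (a k)) 4.

Lemma pnorm_expand a : pnorm a =
  Cmod (a 0%nat) + Cmod (a 1%nat) + Cmod (a 2%nat) + Cmod (a 3%nat) + Cmod (a 4%nat).
Proof. unfold pnorm. rewrite !sum_Sn, sum_O. reflexivity. Qed.

Lemma pnorm_coef a k : (k <= 4)%nat -> Cmod (a k) <= pnorm a.
Proof.
  intros Hk. apply (sum_n_ge_term (fun k => Cmod (a k))); auto.
  intros; apply Cmod_ge_0.
Qed.

Lemma pnorm_ge_0 a : 0 <= pnorm a.
Proof. apply sum_n_nonneg. intros; apply Cmod_ge_0. Qed.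

Lemma Cmod_sum_n (a : nat -> C) n : Cmod (sum_n a n) <= sum_n (fun k => Cmod (a k)) n.
Proof.
  induction n as [|n IH].
  - rewrite !sum_O. lra.
  - rewrite !sum_Sn. eapply Rle_trans; [apply Cmod_triangle|].
    apply Rplus_le_compat_r. exact IH.
Qed.

Lemma pnorm_pmul a b : pnorm (pmul a b) <= pnorm a * pnorm b.
Proof.
  assert (H : forall n, Cmod (pmul a b n) <=
    sum_n (fun k => Cmod (a k) * Cmod (b (n - k)%nat)) n).
  { intros n. unfold pmul. eapply Rle_trans; [apply Cmod_sum_n|].
    apply sum_n_le_loc. intros k _. rewrite Cmod_mult. lra. }
  rewrite !pnorm_expand.
  pose proof (H 0%nat) as H0. pose proof (H 1%nat) as H1. pose proof (H 2%nat) as H2.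
  pose proof (H 3%nat) as H3. pose proof (H 4%nat) as H4.
  rewrite sum_O in H0. rewrite !sum_Sn, sum_O in H1. rewrite !sum_Sn, sum_O in H2.
  rewrite !sum_Sn, sum_O in H3. rewrite !sum_Sn, sum_O in H4. simpl in H0, H1, H2, H3, H4.
  unfold plus in *; simpl in H0, H1, H2, H3, H4.
  pose proof (fun i j => Rmult_le_pos _ _ (Cmod_ge_0 (a i)) (Cmod_ge_0 (b j))) as N.
  pose proof (N 1 4)%nat. pose proof (N 2 3)%nat. pose proof (N 2 4)%nat.
  pose proof (N 3 2)%nat. pose proof (N 3 3)%nat. pose proof (N 3 4)%nat.
  pose proof (N 4 1)%nat. pose proof (N 4 2)%nat. pose proof (N 4 3)%nat.
  pose proof (N 4 4)%nat. lra.
Qed.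

Lemma pnorm_pone : pnorm pone = 1.
Proof. rewrite pnorm_expand. simpl. rewrite Cmod_1, Cmod_0. ring. Qed.

Lemma pnorm_ppow a n : pnorm (ppow a n) <= pnorm a ^ n.
Proof.
  induction n as [|n IH]; simpl.
  - rewrite pnorm_pone. lra.
  - eapply Rle_trans; [apply pnorm_pmul|]. apply Rmult_le_compat_l; auto. apply pnorm_ge_0.
Qed.

Lemma pnorm_plin_factor (z : C) (m : nat) : (1 <= m)%nat ->
  pnorm (plin (RtoC (INR m) * z)%C (RtoC 3)) <= INR m * (Cmod z + 3).
Proof.
  intros Hm. apply le_INR in Hm. simpl in Hm.
  rewrite pnorm_expand. simpl. rewrite Cmod_0, Cmod_mult, !Cmod_R, !Rabs_right by lra.
  nra.
Qed.

Definition inv_bound (z : C) : R := pnorm (plin_inv z).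

Lemma pnorm_plin_inv (z : C) (m : nat) : z <> RtoC 0 -> (1 <= m)%nat ->
  pnorm (plin_inv (RtoC (INR m) * z)%C) <= / INR m * inv_bound z.
Proof.
  intros Hz Hm. apply le_INR in Hm. simpl in Hm.
  unfold inv_bound, pnorm. rewrite <- sum_n_R_mult. apply sum_n_le_loc. intros k _.
  unfold plin_inv. assert (HM : RtoC (INR m) <> 0) by (intros E; apply RtoC_inj in E; lra).
  rewrite !Cmod_div by (apply Cpow_nz; auto using Cmult_neq_0).
  rewrite !Cmod_pow, !Cmod_mult, (Cmod_R (INR m)), (Rabs_right (INR m)), Rpow_mult_distr by lra.
  assert (Hz0 : 0 < Cmod z) by now apply Cmod_gt_0.
  pose proof (pow_lt (Cmod z) (S k) Hz0). pose proof (pow_lt (INR m) (S k) ltac:(lra)).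
  unfold Rdiv. rewrite Rinv_mult.
  set (X := Cmod (RtoC ((-1) ^ k))). assert (0 <= X) by apply Cmod_ge_0.
  rewrite <- (Rmult_assoc (/ INR m)), (Rmult_comm (/ INR m) X), (Rmult_assoc X).
  apply Rmult_le_compat_l; auto. apply Rmult_le_compat_r.
  - left; now apply Rinv_0_lt_compat.
  - apply Rinv_le_contravar; [lra|]. simpl. 
    pose proof (pow_R1_Rle (INR m) k Hm). nra.
Qed.

Lemma fact_3d_le (d : nat) : INR (fact (3 * d)) <= 27 ^ d * INR (fact d) ^ 3.
Proof.
  induction d as [|d IH].
  - simpl. lra.
  - replace (3 * S d)%nat with (S (S (S (3 * d)))) by lia.
    rewrite !fact_simpl, !mult_INR, !S_INR, mult_INR. simpl (INR 3).
    rewrite Rpow_mult_distr. pose proof (pos_INR d). pose proof (INR_fact_lt_0 (3 * d)).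
    set (k := INR d) in *. set (f := INR (fact (3 * d))) in *. set (g := INR (fact d)) in *.
    simpl (27 ^ S d).
    apply Rle_trans with ((27 * (k + 1) ^ 3) * f).
    + rewrite <- !Rmult_assoc. apply Rmult_le_compat_r; [lra|]. nra.
    + replace (27 * 27 ^ d * ((k + 1) ^ 3 * g ^ 3)) with
        (27 * (k + 1) ^ 3 * (27 ^ d * g ^ 3)) by ring.
      apply Rmult_le_compat_l; auto.
      apply Rmult_le_pos; [lra|]. apply pow_le; lra.
Qed.

Definition IY_radius (z : C) : R := 27 * (Cmod z + 3) ^ 3 * inv_bound z ^ 5.

Lemma pprod_numerator (z : C) n :
  pnorm (pprod (fun m => plin (RtoC (INR m) * z)%C (RtoC 3)) n)
  <= INR (fact n) * (Cmod z + 3) ^ n.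
Proof.
  induction n as [|n IH].
  - simpl. rewrite pnorm_pone. lra.
  - cbn [pprod]. eapply Rle_trans; [apply pnorm_pmul|].
    rewrite fact_simpl, mult_INR. simpl (_ ^ S n).
    replace (INR (S n) * INR (fact n) * ((Cmod z + 3) * (Cmod z + 3) ^ n)) with
      ((INR (fact n) * (Cmod z + 3) ^ n) * (INR (S n) * (Cmod z + 3))) by ring.
    apply Rmult_le_compat; auto using pnorm_ge_0.
    apply pnorm_plin_factor. lia.
Qed.

Lemma pprod_denominator (z : C) n : z <> RtoC 0 ->
  pnorm (pprod (fun m => ppow (plin_inv (RtoC (INR m) * z)%C) 5) n)
  <= (/ INR (fact n)) ^ 5 * (inv_bound z ^ 5) ^ n.
Proof.
  intros Hz. induction n as [|n IH].
  - simpl pprod. rewrite pnorm_pone. simpl (fact 0). simpl (INR 1).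
    rewrite Rinv_1, pow1. simpl. lra.
  - cbn [pprod]. eapply Rle_trans; [apply pnorm_pmul|].
    rewrite fact_simpl, mult_INR, Rinv_mult.
    rewrite Rpow_mult_distr. simpl (_ ^ S n).
    apply Rle_trans with (((/ INR (fact n)) ^ 5 * (inv_bound z ^ 5) ^ n) *
       (/ INR (S n) * inv_bound z) ^ 5).
    + apply Rmult_le_compat; auto using pnorm_ge_0.
      eapply Rle_trans; [apply pnorm_ppow|]. apply pow_incr. split; [apply pnorm_ge_0|].
      apply pnorm_plin_inv; auto. lia.
    + right. rewrite Rpow_mult_distr. simpl. ring.
Qed.

(** The quotient (3d)! / d!^5 is at most 27^d / d!^2. *)
Lemma IY_coef_bound (z : C) (d k : nat) : z <> RtoC 0 -> (k <= 4)%nat ->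
  Cmod (IY_coef z d k) <= IY_radius z ^ d / INR (fact d).
Proof.
  intros Hz Hk. eapply Rle_trans; [now apply pnorm_coef|].
  unfold IY_coef. eapply Rle_trans; [apply pnorm_pmul|].
  assert (HB : 0 <= inv_bound z) by apply pnorm_ge_0.
  assert (HA : 0 < Cmod z + 3) by (pose proof (Cmod_ge_0 z); lra).
  pose proof (INR_fact_lt_0 d) as Hf.
  assert (Hf1 : 1 <= INR (fact d)) by (apply (le_INR 1); pose proof (lt_O_fact d); lia).
  apply Rle_trans with ((27 ^ d * INR (fact d) ^ 3 * (Cmod z + 3) ^ (3 * d)) *
     ((/ INR (fact d)) ^ 5 * (inv_bound z ^ 5) ^ d)).
  - apply Rmult_le_compat; auto using pnorm_ge_0.
    + eapply Rle_trans; [apply pprod_numerator|].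
      apply Rmult_le_compat_r; [apply pow_le; lra|]. apply fact_3d_le.
    + now apply pprod_denominator.
  - unfold IY_radius. rewrite pow_mult, !Rpow_mult_distr.
    set (X := 27 ^ d * ((Cmod z + 3) ^ 3) ^ d * (inv_bound z ^ 5) ^ d).
    assert (HX : 0 <= X).
    { unfold X. repeat apply Rmult_le_pos; repeat apply pow_le; lra. }
    apply Rle_trans with (X * / INR (fact d) * / INR (fact d)).
    + right. unfold X. field. lra.
    + unfold Rdiv. rewrite <- (Rmult_1_r (X * / INR (fact d))) at 2.
      apply Rmult_le_compat_l.
      * apply Rmult_le_pos; auto. left; now apply Rinv_0_lt_compat.
      * rewrite <- Rinv_1. apply Rinv_le_contravar; lra.
Qed.

Lemma IY_radius_ge_0 z : 0 <= IY_radius z.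
Proof.
  unfold IY_radius. pose proof (Cmod_ge_0 z). pose proof (pnorm_ge_0 (plin_inv z)).
  apply Rmult_le_pos; [apply Rmult_le_pos; [lra|apply pow_le; lra]|].
  apply pow_le. assumption.
Qed.

Lemma IY_term_bound (z : C) (k d : nat) (t : C) : z <> RtoC 0 -> (k <= 4)%nat ->
  Cmod (Cexp (RtoC (INR d) * t) * IY_coef z d k) <=
  (exp (fst t) * IY_radius z) ^ d / INR (fact d).
Proof.
  intros Hz Hk. rewrite Cmod_mult, Cmod_Cexp.
  replace (fst (RtoC (INR d) * t)%C) with (INR d * fst t) by (simpl; ring).
  rewrite exp_INR_mult, Rpow_mult_distr. unfold Rdiv. rewrite Rmult_assoc.
  apply Rmult_le_compat_l; [apply pow_le; left; apply exp_pos|].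
  now apply IY_coef_bound.
Qed.

(** The coefficient of p^k in the single-valued factor of I^Y / (3p), obtained by
    removing y^(p/z). *)
Definition IY_hol (z : C) (k : nat) (t : C) : C :=
  Cseries (fun d => Cexp (RtoC (INR d) * t) * IY_coef z d k)%C.

Lemma IY_hol_summable (z : C) k t : z <> RtoC 0 -> (k <= 4)%nat ->
  Csummable (fun d => Cexp (RtoC (INR d) * t) * IY_coef z d k)%C.
Proof.
  intros Hz Hk. apply (Csummable_le _ (fun d => (exp (fst t) * IY_radius z) ^ d / INR (fact d))).
  - intros d. now apply IY_term_bound.
  - apply ex_series_exp.
Qed.

Lemma IY_hol_loop z k t : IY_hol z k (t + two_pi_i)%C = IY_hol z k t.
Proof.
  apply Cseries_ext. intros d.
  replace (RtoC (INR d) * (t + two_pi_i))%C with (RtoC (INR d) * t + INR d * two_pi_i)%C by ring.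
  rewrite Cexp_add, Cexp_nat_two_pi_i. ring.
Qed.

(** Near y = 0 the constant term 1 dominates. *)
Lemma IY_hol_neq_0 (z : C) (r : R) : z <> RtoC 0 -> 0 < r ->
  exists t, cover r t /\ IY_hol z 0 t <> 0.
Proof.
  intros Hz Hr. pose proof (IY_radius_ge_0 z) as HR.
  set (e := Rmin (r / 2) (ln 2 / (2 * (IY_radius z + 1)))).
  assert (Hl : 0 < ln 2) by (rewrite <- ln_1; apply ln_increasing; lra).
  assert (He : 0 < e).
  { apply Rmin_pos; [lra|]. apply Rdiv_lt_0_compat; lra. }
  assert (He1 : e <= r / 2) by apply Rmin_l.
  assert (He2 : e <= ln 2 / (2 * (IY_radius z + 1))) by apply Rmin_r.
  set (t := (ln e, 0) : C).
  assert (Et : exp (fst t) = e) by (change (exp (ln e) = e); now apply exp_ln).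
  exists t. split; [unfold cover; rewrite Et; lra|].
  set (q := exp (fst t) * IY_radius z).
  assert (Hq0 : 0 <= q) by (unfold q; rewrite Et; apply Rmult_le_pos; lra).
  assert (Hq : q < ln 2).
  { unfold q. rewrite Et. apply (Rmult_le_compat_r (2 * (IY_radius z + 1))) in He2; [|lra].
    unfold Rdiv in He2. rewrite Rmult_assoc, Rinv_l, Rmult_1_r in He2 by lra. nra. }
  unfold IY_hol. rewrite Cseries_incr_1 by (apply IY_hol_summable; auto; lia).
  set (Y := Cseries (fun n => Cexp (RtoC (INR (S n)) * t) * IY_coef z (S n) 0)%C).
  assert (E0 : (Cexp (RtoC (INR 0) * t) * IY_coef z 0 0)%C = 1).
  { simpl (INR 0). rewrite Cmult_0_l, Cexp_0. unfold IY_coef, pmul. simpl.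
    rewrite sum_O. simpl. ring. }
  rewrite E0. intros E.
  assert (EY : Cmod Y = 1).
  { replace Y with (1 + Y - 1)%C by ring. rewrite E.
    replace (0 - 1)%C with (- (1))%C by ring. apply Cmod_m1. }
  assert (HY : Cmod Y <= exp q - 1).
  { replace (exp q - 1) with (Series (fun n => q ^ S n / INR (fact (S n)))).
    - apply Cmod_Cseries_le.
      + intros n. exact (IY_term_bound z 0 (S n) t Hz (Nat.le_0_l 4)).
      + apply (ex_series_incr_1 (fun n => q ^ n / INR (fact n))). apply ex_series_exp.
    - assert (ES : Series (fun n => q ^ n / INR (fact n)) = exp q).
      { apply is_series_unique.
        apply (is_series_ext (fun n => scal (pow_n q n) (/ INR (fact n)))).
        - intros n. rewrite pow_n_pow. reflexivity.
        - exact (is_exp_Reals q). }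
      rewrite <- ES, (Series_incr_1 _ (ex_series_exp q)). simpl. field. }
  assert (exp q < 2).
  { rewrite <- (exp_ln 2) by lra. now apply exp_increasing. }
  lra.
Qed.

Lemma IY_0 z t : IY z 0 t = 0.
Proof.
  unfold IY. rewrite (Cseries_ext _ (fun _ => RtoC 0)).
  - unfold Cseries. simpl. rewrite (Series_ext _ (fun _ => 0 * 0)) by (intros; ring).
    rewrite Series_scal_l. apply injective_projections; simpl; ring.
  - intros d. unfold pmul at 1. rewrite sum_O. simpl. ring.
Qed.

Lemma pmul_plin_S (b : nat -> C) (a : nat -> C) k :
  (forall i, (2 <= i)%nat -> b i = RtoC 0) -> b 0%nat = RtoC 0 ->
  pmul b a (S k) = (b 1%nat * a k)%C.
Proof.
  intros H2 H0. unfold pmul.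
  rewrite (sum_n_ext_loc _ (fun i => if Nat.eq_dec i 1 then b 1%nat * a k else RtoC 0)%C).
  - assert (E : forall n, sum_n (fun i => if Nat.eq_dec i 1 then b 1%nat * a k else RtoC 0)%C (S n)
       = (b 1%nat * a k)%C).
    { induction n as [|n IH].
      - rewrite sum_n_C_S, sum_O. simpl. toC. ring.
      - rewrite sum_n_C_S, IH. simpl. toC. ring. }
    apply E.
  - intros i Hi. destruct i as [|[|i]]; simpl Nat.eq_dec; cbv iota.
    + rewrite H0. simpl. toC. ring.
    + simpl. rewrite Nat.sub_0_r. reflexivity.
    + rewrite (H2 (S (S i))) by lia. simpl. toC. ring.
Qed.

Lemma IY_S z k t : IY z (S k) t =
  Cseries (fun d => Cexp (RtoC (INR d) * t) * (3 * pmul (pexp (t / z)) (IY_coef z d) k))%C.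
Proof.
  apply Cseries_ext. intros d. f_equal. rewrite pmul_plin_S.
  - simpl. reflexivity.
  - intros [|[|i]] Hi; [lia|lia|reflexivity].
  - reflexivity.
Qed.

Lemma Cseries_comb (a0 a1 a2 a3 : nat -> C) (x1 x2 x3 : C) :
  Csummable a0 -> Csummable a1 -> Csummable a2 -> Csummable a3 ->
  Cseries (fun d => 3 * (a3 d + x1 * a2 d + x2 * a1 d + x3 * a0 d))%C =
  (3 * (Cseries a3 + x1 * Cseries a2 + x2 * Cseries a1 + x3 * Cseries a0))%C.
Proof.
  intros H0 H1 H2 H3.
  pose proof (Csummable_mult x1 _ H2) as M1. pose proof (Csummable_mult x2 _ H1) as M2.
  pose proof (Csummable_mult x3 _ H0) as M3.
  pose proof (Csummable_plus _ _ H3 M1) as A1. pose proof (Csummable_plus _ _ A1 M2) as A2.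
  pose proof (Csummable_plus _ _ A2 M3) as A3.
  rewrite (Cseries_mult 3 _ A3), (Cseries_plus _ _ A2 M3), (Cseries_plus _ _ A1 M2),
    (Cseries_plus _ _ H3 M1), (Cseries_mult x1 _ H2), (Cseries_mult x2 _ H1),
    (Cseries_mult x3 _ H0).
  reflexivity.
Qed.

(** The logarithms of I^Y come from the factor exp (p t / z). *)
Lemma IY_logs (z : C) (t : C) : z <> RtoC 0 ->
  let x := (t / z)%C in
  IY z 1 t = (3 * IY_hol z 0 t)%C /\
  IY z 2 t = (3 * (IY_hol z 1 t + x * IY_hol z 0 t))%C /\
  IY z 3 t = (3 * (IY_hol z 2 t + x * IY_hol z 1 t + x ^ 2 / 2 * IY_hol z 0 t))%C /\
  IY z 4 t = (3 * (IY_hol z 3 t + x * IY_hol z 2 t + x ^ 2 / 2 * IY_hol z 1 t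
                   + x ^ 3 / 6 * IY_hol z 0 t))%C.
Proof.
  intros Hz x.
  assert (S0 := IY_hol_summable z 0 t Hz ltac:(lia)).
  assert (S1 := IY_hol_summable z 1 t Hz ltac:(lia)).
  assert (S2 := IY_hol_summable z 2 t Hz ltac:(lia)).
  assert (S3 := IY_hol_summable z 3 t Hz ltac:(lia)).
  assert (H2 : RtoC 2 <> 0) by (intros E; apply RtoC_inj in E; lra).
  assert (H6 : RtoC 6 <> 0) by (intros E; apply RtoC_inj in E; lra).
  assert (P0 : pexp x 0 = 1) by (unfold pexp; simpl; field; intros E; apply RtoC_inj in E; lra).
  assert (P1 : pexp x 1 = x) by (unfold pexp; simpl; field; intros E; apply RtoC_inj in E; lra).
  assert (P2 : pexp x 2 = (x ^ 2 / 2)%C).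
  { unfold pexp. replace (INR (fact 2)) with 2 by (simpl; ring). reflexivity. }
  assert (P3 : pexp x 3 = (x ^ 3 / 6)%C).
  { unfold pexp. replace (INR (fact 3)) with 6 by (simpl; ring). reflexivity. }
  assert (E : forall k d, pmul (pexp x) (IY_coef z d) k =
     sum_n (fun j => pexp x j * IY_coef z d (k - j)%nat)%C k) by reflexivity.
  unfold IY_hol. rewrite !IY_S. fold x. split; [|split; [|split]].
  - rewrite <- (Cseries_mult _ _ S0).
    apply Cseries_ext; intros d. rewrite E, sum_O, P0. simpl. toC. ring.
  - transitivity (3 * (IY_hol z 1 t + x * IY_hol z 0 t + 0 * IY_hol z 0 t + 0 * IY_hol z 0 t))%C;
      [|unfold IY_hol; ring].
    unfold IY_hol. rewrite <- (Cseries_comb _ _ _ _ x 0 0 S0 S0 S0 S1).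
    apply Cseries_ext; intros d. rewrite E, !sum_n_C_S, sum_O, P0, P1. simpl. toC. ring.
  - transitivity (3 * (IY_hol z 2 t + x * IY_hol z 1 t + x ^ 2 / 2 * IY_hol z 0 t
      + 0 * IY_hol z 0 t))%C; [|unfold IY_hol; ring].
    unfold IY_hol. rewrite <- (Cseries_comb _ _ _ _ x (x ^ 2 / 2)%C 0 S0 S0 S1 S2).
    apply Cseries_ext; intros d. rewrite E, !sum_n_C_S, sum_O, P0, P1, P2. simpl. toC. ring.
  - rewrite <- (Cseries_comb _ _ _ _ x (x ^ 2 / 2)%C (x ^ 3 / 6)%C S0 S1 S2 S3).
    apply Cseries_ext; intros d. rewrite E, !sum_n_C_S, sum_O, P0, P1, P2, P3. simpl. toC. ring.
Qed.

(** The components of I^Y are polynomials in log y of degrees 0 to 3 with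
    single-valued coefficients and the same nonzero leading function, so T g = w g
    is impossible for w different from 1 unless all coefficients vanish. For g = 0
    and w = 2 this is the linear independence of the components. *)
Lemma IY_eigen (z : C) (r : R) (c : nat -> C) (w : C) :
  z <> RtoC 0 -> 0 < r -> w <> RtoC 1 ->
  (forall u, cover r u -> sum_n (fun k => c k * IY z k (u + two_pi_i))%C 4 =
                 (w * sum_n (fun k => c k * IY z k u)%C 4)%C) ->
  forall k, (1 <= k <= 4)%nat -> c k = 0.
Proof.
  intros Hz Hr Hw H.
  destruct (IY_hol_neq_0 z r Hz Hr) as (t0 & Ht0 & N).
  set (h0 := IY_hol z 0 t0) in *. set (h1 := IY_hol z 1 t0).
  set (h2 := IY_hol z 2 t0). set (h3 := IY_hol z 3 t0).
  set (P := fun x : C => (3 * (c 1%nat * h0 + c 2%nat * (h1 + x * h0)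
     + c 3%nat * (h2 + x * h1 + x ^ 2 / 2 * h0)
     + c 4%nat * (h3 + x * h2 + x ^ 2 / 2 * h1 + x ^ 3 / 6 * h0)))%C).
  assert (Hper : forall (m k : nat), IY_hol z k (t0 + INR m * two_pi_i)%C = IY_hol z k t0).
  { intros m k. induction m as [|m IH].
    - f_equal. simpl. ring.
    - rewrite S_INR, RtoC_plus.
      replace (t0 + (INR m + 1) * two_pi_i)%C with (t0 + INR m * two_pi_i + two_pi_i)%C by ring.
      rewrite IY_hol_loop. exact IH. }
  assert (HP : forall m : nat,
    sum_n (fun k => c k * IY z k (t0 + INR m * two_pi_i))%C 4
    = P ((t0 + INR m * two_pi_i) / z)%C).
  { intros m. destruct (IY_logs z (t0 + INR m * two_pi_i)%C Hz) as (E1 & E2 & E3 & E4).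
    rewrite !sum_n_C_S, sum_O, IY_0, E1, E2, E3, E4, !Hper.
    unfold P. fold h0 h1 h2 h3. toC. ring. }
  set (x0 := (t0 / z)%C). set (b := (two_pi_i / z)%C).
  assert (Hb : b <> 0).
  { unfold b, Cdiv. apply Cmult_neq_0.
    - unfold two_pi_i. intros E. apply (f_equal snd) in E. simpl in E.
      pose proof PI_RGT_0. lra.
    - intros E. apply C1_nz. rewrite <- (Cinv_r z Hz), E. ring. }
  assert (HQ : forall m : nat, P (x0 + INR m * b + b)%C = (w * P (x0 + INR m * b))%C).
  { intros m. replace (x0 + INR m * b + b)%C with ((t0 + INR (S m) * two_pi_i) / z)%C
      by (unfold x0, b; rewrite S_INR, RtoC_plus; field; auto).
    replace (x0 + INR m * b)%C with ((t0 + INR m * two_pi_i) / z)%C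
      by (unfold x0, b; field; auto).
    rewrite <- !HP, <- H.
    - apply sum_n_ext. intros k. f_equal. f_equal. rewrite S_INR, RtoC_plus. ring.
    - unfold cover in *. simpl. rewrite Rmult_0_r, Rmult_0_l, Rminus_0_r, Rplus_0_r. exact Ht0. }
  pose proof (HQ 0%nat) as Q0. pose proof (HQ 1%nat) as Q1.
  pose proof (HQ 2%nat) as Q2. pose proof (HQ 3%nat) as Q3.
  simpl INR in Q0, Q1, Q2, Q3. rewrite !RtoC_plus in *.
  apply Ceq_minus in Q0, Q1, Q2, Q3.
  assert (Nw : (1 - w)%C <> 0) by (intros E; apply Hw; symmetry; now apply Ceq_minus).
  assert (H3 : RtoC 3 <> 0) by (intros E; apply RtoC_inj in E; lra).
  assert (Hz0 : forall v m, v <> RtoC 0 -> (v * m)%C = 0 -> m = 0).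
  { intros v m Hv E. destruct (Ceq_dec m 0) as [|Nm]; auto.
    exfalso. exact (Cmult_neq_0 v m Hv Nm E). }
  assert (H2 : RtoC 2 <> 0) by (intros E; apply RtoC_inj in E; lra).
  assert (H6 : RtoC 6 <> 0) by (intros E; apply RtoC_inj in E; lra).
  clear HP HQ. clearbody b x0 h0 h1 h2 h3.
  (* Finite differences of order 3, 2, 1, 0 isolate the leading coefficient of a
     polynomial of degree 3, 2, 1, 0. *)
  assert (C4 : c 4%nat = 0).
  { apply (Hz0 ((1 - w) * 3 * h0 * b * b * b)%C).
    - repeat apply Cmult_neq_0; auto.
    - transitivity ((P (x0 + (1 + 1 + 1) * b + b) - w * P (x0 + (1 + 1 + 1) * b))
        - 3 * (P (x0 + (1 + 1) * b + b) - w * P (x0 + (1 + 1) * b))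
        + 3 * (P (x0 + 1 * b + b) - w * P (x0 + 1 * b))
        - (P (x0 + 0 * b + b) - w * P (x0 + 0 * b)))%C.
      + unfold P. field. auto.
      + rewrite Q0, Q1, Q2, Q3. ring. }
  assert (C3 : c 3%nat = 0).
  { apply (Hz0 ((1 - w) * 3 * h0 * b * b)%C).
    - repeat apply Cmult_neq_0; auto.
    - transitivity ((P (x0 + (1 + 1) * b + b) - w * P (x0 + (1 + 1) * b))
        - 2 * (P (x0 + 1 * b + b) - w * P (x0 + 1 * b))
        + (P (x0 + 0 * b + b) - w * P (x0 + 0 * b)))%C.
      + unfold P. rewrite C4. field. auto.
      + rewrite Q0, Q1, Q2. ring. }
  assert (C2 : c 2%nat = 0).
  { apply (Hz0 ((1 - w) * 3 * h0 * b)%C).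
    - repeat apply Cmult_neq_0; auto.
    - transitivity ((P (x0 + 1 * b + b) - w * P (x0 + 1 * b))
        - (P (x0 + 0 * b + b) - w * P (x0 + 0 * b)))%C.
      + unfold P. rewrite C4, C3. field. auto.
      + rewrite Q0, Q1. ring. }
  assert (C1 : c 1%nat = 0).
  { apply (Hz0 ((1 - w) * 3 * h0)%C).
    - repeat apply Cmult_neq_0; auto.
    - transitivity (P (x0 + 0 * b + b) - w * P (x0 + 0 * b))%C.
      + unfold P. rewrite C4, C3, C2. unfold Cdiv. ring.
      + rewrite Q0. ring. }
  intros k Hk. destruct k as [|[|[|[|[|k]]]]]; auto; lia.
Qed.

(** * Submodules of maximal trivial monodromy *)

Definition invariants (z : C) (r : R) (D : divisor) (f : C -> C -> C) : Prop :=
  Hbar z r f /\ eq2 r (loop D f) f.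

Lemma cover_two_pi_i (r : R) (s : C) : cover r (s + two_pi_i)%C <-> cover r s.
Proof. now apply cover_shift. Qed.

Lemma loop_comm D D' f : loop D (loop D' f) = loop D' (loop D f).
Proof. destruct D, D'; reflexivity. Qed.

Lemma loop_eq2 r D f g : eq2 r (loop D f) (loop D g) <-> eq2 r f g.
Proof.
  destruct D; split; intros H s t Hs Ht.
  - specialize (H (s - two_pi_i)%C t). simpl in H.
    replace (s - two_pi_i + two_pi_i)%C with s in H by ring. apply H; auto.
    apply cover_two_pi_i. now replace (s - two_pi_i + two_pi_i)%C with s by ring.
  - apply H; auto. now apply cover_two_pi_i.
  - specialize (H s (t - two_pi_i)%C). simpl in H.
    replace (t - two_pi_i + two_pi_i)%C with t in H by ring. apply H; auto.
    apply cover_two_pi_i. now replace (t - two_pi_i + two_pi_i)%C with t by ring.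
  - apply H; auto. now apply cover_two_pi_i.
Qed.

Lemma Hbar_loop (z : C) (r : R) D f : z <> RtoC 0 -> Hbar z r f <-> Hbar z r (loop D f).
Proof.
  intros Hz. assert (E0 : Cexp 0 = 1) by apply Cexp_0.
  assert (E1 : Cexp (- two_pi_i) = 1).
  { rewrite <- (Cmult_1_r (Cexp (- two_pi_i))), <- Cexp_two_pi_i at 1.
    rewrite <- Cexp_add. replace (- two_pi_i + two_pi_i)%C with (RtoC 0) by ring. exact E0. }
  assert (F1 : fst (- two_pi_i)%C = 0) by (simpl; ring).
  split; intros H.
  - destruct D.
    + eapply (Hbar_ext z r); [exact Hz| |apply (Hbar_shift z r two_pi_i 0 f Hz eq_refl
        Cexp_two_pi_i eq_refl E0 H)].
      intros s t _ _. simpl. now rewrite Cplus_0_r.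
    + eapply (Hbar_ext z r); [exact Hz| |apply (Hbar_shift z r 0 two_pi_i f Hz eq_refl
        E0 eq_refl Cexp_two_pi_i H)].
      intros s t _ _. simpl. now rewrite Cplus_0_r.
  - destruct D.
    + eapply (Hbar_ext z r); [exact Hz| |apply (Hbar_shift z r (- two_pi_i) 0 _ Hz F1
        E1 eq_refl E0 H)].
      intros s t _ _. simpl. rewrite Cplus_0_r. f_equal. ring.
    + eapply (Hbar_ext z r); [exact Hz| |apply (Hbar_shift z r 0 (- two_pi_i) _ Hz eq_refl
        E0 F1 E1 H)].
      intros s t _ _. simpl. rewrite Cplus_0_r. f_equal. ring.
Qed.

Lemma Hbar_add (z : C) (r : R) f g : z <> RtoC 0 ->
  Hbar z r f -> Hbar z r g -> Hbar z r (add2 f g).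
Proof.
  intros Hz Hf Hg. apply (Hbar_ext z r _ _ Hz) with (2 := Hbar_lincomb z r 1 1 f g Hz Hf Hg).
  intros s t _ _. unfold add2. ring.
Qed.

Lemma Hbar_scal (z : C) (r : R) c f : z <> RtoC 0 ->
  Hbar z r f -> Hbar z r (scal2 c f).
Proof.
  intros Hz Hf. apply (Hbar_ext z r _ _ Hz) with (2 := Hbar_lincomb z r c 0 f f Hz Hf Hf).
  intros s t _ _. unfold scal2. ring.
Qed.

Lemma invariants_sub_local_system (z : C) (r : R) D : z <> RtoC 0 ->
  sub_local_system z r (invariants z r D).
Proof.
  intros Hz. split.
  - intros f [H _]; exact H.
  - intros f g E [H1 H2]. split; [now apply (Hbar_ext z r f)|].
    intros s t Hs Ht. rewrite <- (E s t Hs Ht), <- (H2 s t Hs Ht). symmetry.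
    now apply (proj2 (loop_eq2 r D f g) E).
  - split; [now apply Hbar_zero|]. intros s t _ _. now destruct D.
  - intros f g [Hf Ef] [Hg Eg]. split; [now apply Hbar_add|].
    intros s t Hs Ht. unfold add2 at 2. rewrite <- (Ef s t Hs Ht), <- (Eg s t Hs Ht).
    now destruct D.
  - intros c f [Hf Ef]. split; [now apply Hbar_scal|].
    intros s t Hs Ht. unfold scal2 at 2. rewrite <- (Ef s t Hs Ht). now destruct D.
  - intros D' f. unfold invariants.
    rewrite <- (Hbar_loop z r D' f Hz), loop_comm, loop_eq2. reflexivity.
Qed.

Lemma invariants_max (z : C) (r : R) D : z <> RtoC 0 ->
  max_trivial_monodromy z r D (invariants z r D).
Proof.
  intros Hz. split; [|split].
  - now apply invariants_sub_local_system.
  - intros f [_ H]; exact H.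
  - intros M' HM' HT _ f Hf. split; [now apply (sls_sol _ _ _ HM')|now apply HT].
Qed.

(** The invariants form a sub-local system with trivial monodromy, so a maximal one
    contains them. *)
Lemma max_trivial_invariants (z : C) (r : R) D M : z <> RtoC 0 ->
  max_trivial_monodromy z r D M -> forall f, M f <-> invariants z r D f.
Proof.
  intros Hz (HM & HT & Hmax) f. split.
  - intros Hf. split; [now apply (sls_sol _ _ _ HM)|now apply HT].
  - apply Hmax.
    + now apply invariants_sub_local_system.
    + intros g [_ H]; exact H.
    + intros g Hg. split; [now apply (sls_sol _ _ _ HM)|now apply HT].
Qed.

(** * The two solutions restricting to the FJRW I-function *)

Definition fjrw_sol_0 (z : C) : C -> C -> C := frob z (1 / 3) fjrw_coef_0 0 0.
Definition fjrw_sol_1 (z : C) : C -> C -> C := frob z (2 / 3) fjrw_coef_1 0 0.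
Definition omega_0 : C := Cexp (RtoC (1 / 3) * two_pi_i).
Definition omega_1 : C := Cexp (RtoC (2 / 3) * two_pi_i).

Lemma fjrw_exponents_0 : 0 < 1 / 3 /\ (3 * (1 / 3) - 1) * (3 * (1 / 3) - 2) = 0.
Proof. lra. Qed.

Lemma fjrw_exponents_1 : 0 < 2 / 3 /\ (3 * (2 / 3) - 1) * (3 * (2 / 3) - 2) = 0.
Proof. lra. Qed.

Lemma omega_0_Im : 0 < snd omega_0.
Proof.
  unfold omega_0, Cexp, two_pi_i; simpl. apply Rmult_lt_0_compat; [apply exp_pos|].
  pose proof PI_RGT_0. apply sin_gt_0; lra.
Qed.

Lemma omega_1_Im : snd omega_1 < 0.
Proof.
  unfold omega_1, Cexp, two_pi_i; simpl.
  pose proof PI_RGT_0. assert (sin (2 / 3 * (2 * PI) + 0 * 0) < 0) by (apply sin_lt_0; lra).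
  match goal with |- exp ?a * _ < 0 => pose proof (exp_pos a) end. nra.
Qed.

Lemma omega_0_neq_1 : omega_0 <> 1.
Proof. intros E. pose proof omega_0_Im as H. rewrite E in H. simpl in H. lra. Qed.

Lemma omega_1_neq_1 : omega_1 <> 1.
Proof. intros E. pose proof omega_1_Im as H. rewrite E in H. simpl in H. lra. Qed.

Lemma omega_0_neq_omega_1 : omega_0 <> omega_1.
Proof. intros E. pose proof omega_0_Im as H. pose proof omega_1_Im. rewrite E in H. lra. Qed.

(** The properties of the two fractional solutions, collected so that both are
    treated alike below. *)
Record fjrw_lift (z : C) (r : R) (w : C) (I : C -> C) (G : C -> C -> C) : Prop := {
  fl_sol : Hbar z r G;
  fl_loop_x : forall s t, cover r s -> cover r t -> G (s + two_pi_i)%C t = (w * G s t)%C;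
  fl_loop_y : forall s t, G s (t + two_pi_i)%C = G s t;
  fl_restr : is_restriction r div_y G I;
  fl_restr_loop : forall u, cover r u -> I (u + two_pi_i)%C = (w * I u)%C;
  fl_restr_neq_0 : exists u, cover r u /\ I u <> 0
}.

Lemma fjrw_lift_0 (z : C) (r : R) : z <> RtoC 0 -> 0 < r <= 27 ->
  fjrw_lift z r omega_0 I_FJRW_0 (fjrw_sol_0 z).
Proof.
  intros Hz Hr. destruct fjrw_exponents_0 as [Ha Hi]. pose proof fjrw_rec_0 as Hrec.
  destruct Hr as [Hr0 Hr]. unfold fjrw_sol_0. split.
  - exact (frob_Hbar z r (1 / 3) fjrw_coef_0 Hz Hr Ha Hi Hrec).
  - intros s t Hs Ht. exact (frob_loop_x z r (1 / 3) fjrw_coef_0 s t Hz Hr Ha Hi Hrec Hs Ht).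
  - intros s t. apply frob_loop_y.
  - exact (frob_restriction z r (1 / 3) fjrw_coef_0 Hz Hr Ha Hi Hrec).
  - intros u Hu. exact (frob_restr_loop (1 / 3) fjrw_coef_0 u r Hr Ha Hi Hrec Hu).
  - exact (frob_restr_neq_0 r (1 / 3) fjrw_coef_0 (conj Hr0 Hr) Ha Hi Hrec fjrw_coef_0_neq_0).
Qed.

Lemma fjrw_lift_1 (z : C) (r : R) : z <> RtoC 0 -> 0 < r <= 27 ->
  fjrw_lift z r omega_1 I_FJRW_1 (fjrw_sol_1 z).
Proof.
  intros Hz Hr. destruct fjrw_exponents_1 as [Ha Hi]. pose proof fjrw_rec_1 as Hrec.
  destruct Hr as [Hr0 Hr]. unfold fjrw_sol_1. split.
  - exact (frob_Hbar z r (2 / 3) fjrw_coef_1 Hz Hr Ha Hi Hrec).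
  - intros s t Hs Ht. exact (frob_loop_x z r (2 / 3) fjrw_coef_1 s t Hz Hr Ha Hi Hrec Hs Ht).
  - intros s t. apply frob_loop_y.
  - exact (frob_restriction z r (2 / 3) fjrw_coef_1 Hz Hr Ha Hi Hrec).
  - intros u Hu. exact (frob_restr_loop (2 / 3) fjrw_coef_1 u r Hr Ha Hi Hrec Hu).
  - exact (frob_restr_neq_0 r (2 / 3) fjrw_coef_1 (conj Hr0 Hr) Ha Hi Hrec fjrw_coef_1_neq_0).
Qed.

Lemma fjrw_lift_neq_0 z r w I G : 0 < r -> fjrw_lift z r w I G ->
  exists s t, cover r s /\ cover r t /\ G s t <> 0.
Proof.
  intros Hr L. destruct (fl_restr_neq_0 _ _ _ _ _ L) as (u & Hu & N).
  assert (Hm : 0 < Cmod (I u)) by now apply Cmod_gt_0.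
  destruct (fl_restr _ _ _ _ _ L u Hu (Cmod (I u)) Hm) as [A HA].
  set (v := (Rmin A (ln r) - 1, 0) : C).
  pose proof (Rmin_l A (ln r)). pose proof (Rmin_r A (ln r)).
  exists u, v. split; auto. split.
  - unfold cover, v; simpl. rewrite <- (exp_ln r) at 2 by auto. apply exp_increasing. lra.
  - intros E. specialize (HA v). simpl in HA. rewrite E in HA.
    replace (0 - I u)%C with (- I u)%C in HA by ring. rewrite Cmod_opp in HA.
    assert (Cmod (I u) < Cmod (I u)) by (apply HA; lra). lra.
Qed.

Lemma Cmult_eq_0_r (v m : C) : v <> RtoC 0 -> (v * m)%C = RtoC 0 -> m = RtoC 0.
Proof.
  intros Hv E. destruct (Ceq_dec m 0) as [|N]; auto.
  exfalso. exact (Cmult_neq_0 v m Hv N E).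
Qed.

(** With T the monodromy around x = 0, the operator (T - 1) (T - w1) kills h and G1
    but not G0, and (T - 1) (T - w0) kills h and G0 but not G1. *)
Lemma eigen_independence z r I0 I1 G0 G1 w0 w1 (h : C -> C -> C) (b c : C) :
  0 < r -> w0 <> RtoC 1 -> w1 <> RtoC 1 -> w0 <> w1 ->
  fjrw_lift z r w0 I0 G0 -> fjrw_lift z r w1 I1 G1 ->
  eq2 r (loop div_x h) h ->
  (forall s t, cover r s -> cover r t -> (h s t + b * G0 s t + c * G1 s t)%C = 0) ->
  b = 0 /\ c = 0.
Proof.
  intros Hr N0 N1 N01 L0 L1 Hh H.
  assert (K : forall s t, cover r s -> cover r t ->
    ((w0 - 1) * (w0 - w1) * G0 s t * b)%C = 0 /\ ((w1 - 1) * (w1 - w0) * G1 s t * c)%C = 0).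
  { intros s t Hs Ht.
    assert (Hs1 : cover r (s + two_pi_i)%C) by now apply cover_two_pi_i.
    assert (Hs2 : cover r (s + two_pi_i + two_pi_i)%C) by now apply cover_two_pi_i.
    pose proof (H s t Hs Ht) as E0. pose proof (H _ t Hs1 Ht) as E1.
    pose proof (H _ t Hs2 Ht) as E2.
    pose proof (Hh s t Hs Ht) as P1. pose proof (Hh _ t Hs1 Ht) as P2. simpl in P1, P2.
    rewrite P1 in *. rewrite P2 in *.
    rewrite (fl_loop_x _ _ _ _ _ L0 _ t Hs1 Ht), (fl_loop_x _ _ _ _ _ L1 _ t Hs1 Ht) in E2.
    rewrite (fl_loop_x _ _ _ _ _ L0 s t Hs Ht), (fl_loop_x _ _ _ _ _ L1 s t Hs Ht) in E1, E2.
    split.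
    - transitivity ((h s t + b * (w0 * (w0 * G0 s t)) + c * (w1 * (w1 * G1 s t)))
        - (1 + w1) * (h s t + b * (w0 * G0 s t) + c * (w1 * G1 s t))
        + w1 * (h s t + b * G0 s t + c * G1 s t))%C; [ring|].
      rewrite E0, E1, E2. ring.
    - transitivity ((h s t + b * (w0 * (w0 * G0 s t)) + c * (w1 * (w1 * G1 s t)))
        - (1 + w0) * (h s t + b * (w0 * G0 s t) + c * (w1 * G1 s t))
        + w0 * (h s t + b * G0 s t + c * G1 s t))%C; [ring|].
      rewrite E0, E1, E2. ring. }
  assert (M : forall u v : C, u <> v -> (u - v)%C <> 0)
    by (intros u v Huv E; apply Huv; now apply Ceq_minus).
  split.
  - destruct (fjrw_lift_neq_0 _ _ _ _ _ Hr L0) as (s & t & Hs & Ht & N).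
    apply (Cmult_eq_0_r ((w0 - 1) * (w0 - w1) * G0 s t)%C).
    + repeat apply Cmult_neq_0; auto.
    + now apply K.
  - destruct (fjrw_lift_neq_0 _ _ _ _ _ Hr L1) as (s & t & Hs & Ht & N).
    apply (Cmult_eq_0_r ((w1 - 1) * (w1 - w0) * G1 s t)%C).
    + repeat apply Cmult_neq_0; auto.
    + now apply K.
Qed.

Lemma restr_independence z r I0 I1 G0 G1 w0 w1 (b c : C) :
  w0 <> w1 ->
  fjrw_lift z r w0 I0 G0 -> fjrw_lift z r w1 I1 G1 ->
  (forall u, cover r u -> (b * I0 u + c * I1 u)%C = 0) ->
  b = 0 /\ c = 0.
Proof.
  intros N01 L0 L1 H.
  assert (K : forall u, cover r u ->
    ((w0 - w1) * I0 u * b)%C = 0 /\ ((w1 - w0) * I1 u * c)%C = 0).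
  { intros u Hu. pose proof (H u Hu) as E0.
    pose proof (H (u + two_pi_i)%C (proj2 (cover_two_pi_i r u) Hu)) as E1.
    rewrite (fl_restr_loop _ _ _ _ _ L0), (fl_restr_loop _ _ _ _ _ L1) in E1 by auto.
    split.
    - transitivity ((b * (w0 * I0 u) + c * (w1 * I1 u)) - w1 * (b * I0 u + c * I1 u))%C;
        [ring|]. rewrite E0, E1. ring.
    - transitivity ((b * (w0 * I0 u) + c * (w1 * I1 u)) - w0 * (b * I0 u + c * I1 u))%C;
        [ring|]. rewrite E0, E1. ring. }
  assert (M : forall u v : C, u <> v -> (u - v)%C <> 0)
    by (intros u v Huv E; apply Huv; now apply Ceq_minus).
  split.
  - destruct (fl_restr_neq_0 _ _ _ _ _ L0) as (u & Hu & N).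
    apply (Cmult_eq_0_r ((w0 - w1) * I0 u)%C).
    + apply Cmult_neq_0; auto.
    + now apply K.
  - destruct (fl_restr_neq_0 _ _ _ _ _ L1) as (u & Hu & N).
    apply (Cmult_eq_0_r ((w1 - w0) * I1 u)%C).
    + apply Cmult_neq_0; auto.
    + now apply K.
Qed.

(** * The isomorphism with H(Y) *)

Lemma IY_in_H_Y z r k : (k <= 4)%nat -> H_Y z r (IY z k).
Proof.
  intros Hk. exists (fun i => if Nat.eq_dec i k then RtoC 1 else RtoC 0).
  intros u _. do 5 (destruct k as [|k]; [rewrite !sum_n_C_S, sum_O; simpl; toC; ring|]). lia.
Qed.

Lemma restriction_iso_ext z r E HE W phi f g :
  sub_local_system z r HE -> is_restriction_iso r E HE (vanishing r) W phi ->
  HE f -> HE g -> eq2 r f g -> eq1 r (phi f) (phi g).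
Proof.
  intros HS Hphi Hf Hg E0 u Hu.
  assert (Hg' : HE (scal2 (-1) g)) by now apply (sls_scal _ _ _ HS).
  assert (V : vanishing r (add2 f (scal2 (-1) g))).
  { intros s t Hs Ht. unfold add2, scal2. rewrite (E0 s t Hs Ht). ring. }
  apply (ri_kernel _ _ _ _ _ _ Hphi) in V; [|now apply (sls_add _ _ _ HS)].
  specialize (V u Hu). cbv beta in V.
  rewrite (ri_add _ _ _ _ _ _ Hphi f _ Hf Hg' u Hu) in V.
  rewrite (ri_scal _ _ _ _ _ _ Hphi (-1) g Hg u Hu) in V.
  apply Ceq_minus. rewrite <- V. ring.
Qed.

(** The solution of exponent 1/3 would give an element of H(Y) whose monodromy is
    multiplication by a primitive cube root of unity, whereas the monodromy of H(Y)
    is unipotent. *)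
Lemma not_div_y (z : C) (r : R) (HE : (C -> C -> C) -> Prop) :
  z <> RtoC 0 -> 0 < r <= 27 -> max_trivial_monodromy z r div_y HE ->
  ~ restriction_iso r div_y HE (H_Y z r).
Proof.
  intros Hz Hr Hmax [phi Hphi].
  pose proof (fjrw_lift_0 z r Hz Hr) as L. set (G := fjrw_sol_0 z) in *.
  assert (HS : sub_local_system z r HE) by apply Hmax.
  assert (HG : HE G).
  { apply (max_trivial_invariants z r div_y HE Hz Hmax). split.
    - apply L.
    - intros s t _ _. apply (fl_loop_y _ _ _ _ _ L). }
  assert (HG' : HE (loop div_x G)) by now apply (sls_loop _ _ _ HS).
  assert (Hw : HE (scal2 omega_0 G)) by now apply (sls_scal _ _ _ HS).
  assert (Heig : forall u, cover r u -> phi G (u + two_pi_i)%C = (omega_0 * phi G u)%C).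
  { intros u Hu. rewrite <- (ri_scal _ _ _ _ _ _ Hphi omega_0 G HG u Hu).
    transitivity (phi (loop div_x G) u).
    - symmetry. exact (ri_loop _ _ _ _ _ _ Hphi G HG u Hu).
    - apply (restriction_iso_ext z r div_y HE (H_Y z r) phi _ _ HS Hphi HG' Hw); auto.
      intros s t Hs Ht. exact (fl_loop_x _ _ _ _ _ L s t Hs Ht). }
  destruct (ri_image _ _ _ _ _ _ Hphi G HG) as [c Hc].
  assert (C0 : forall k, (1 <= k <= 4)%nat -> c k = 0).
  { apply (IY_eigen z r c omega_0 Hz (proj1 Hr) omega_0_neq_1).
    intros u Hu. assert (Hu' : cover r (u + two_pi_i)%C) by now apply cover_two_pi_i.
    rewrite <- (Hc u Hu), <- (Hc _ Hu'). now apply Heig. }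
  assert (V : vanishing r G).
  { apply (ri_kernel _ _ _ _ _ _ Hphi G HG). intros u Hu. rewrite (Hc u Hu).
    rewrite !sum_n_C_S, sum_O, IY_0, (C0 1%nat), (C0 2%nat), (C0 3%nat), (C0 4%nat) by lia. toC. ring. }
  destruct (fjrw_lift_neq_0 _ _ _ _ _ (proj1 Hr) L) as (s & t & Hs & Ht & N).
  apply N. now apply V.
Qed.

(** Dimension count: four independent elements of H^E and the two solutions with
    fractional exponents exhaust the solutions, since any seven are dependent. *)
Lemma decomposition (z : C) (r : R) (HE : (C -> C -> C) -> Prop) :
  z <> RtoC 0 -> 0 < r <= 27 -> max_trivial_monodromy z r div_x HE ->
  restriction_iso r div_x HE (H_Y z r) ->
  forall f, Hbar z r f -> exists b c,
    HE (sub2 f (add2 (scal2 b (fjrw_sol_0 z)) (scal2 c (fjrw_sol_1 z)))).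
Proof.
  intros Hz Hr Hmax [phi Hphi] f Hf.
  pose proof (fjrw_lift_0 z r Hz Hr) as L0. pose proof (fjrw_lift_1 z r Hz Hr) as L1.
  set (G0 := fjrw_sol_0 z) in *. set (G1 := fjrw_sol_1 z) in *.
  assert (HS : sub_local_system z r HE) by apply Hmax.
  pose proof (max_trivial_invariants z r div_x HE Hz Hmax) as Hinv.
  destruct (ri_onto _ _ _ _ _ _ Hphi _ (IY_in_H_Y z r 1 ltac:(lia))) as (e1 & He1 & P1).
  destruct (ri_onto _ _ _ _ _ _ Hphi _ (IY_in_H_Y z r 2 ltac:(lia))) as (e2 & He2 & P2).
  destruct (ri_onto _ _ _ _ _ _ Hphi _ (IY_in_H_Y z r 3 ltac:(lia))) as (e3 & He3 & P3).
  destruct (ri_onto _ _ _ _ _ _ Hphi _ (IY_in_H_Y z r 4 ltac:(lia))) as (e4 & He4 & P4).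
  set (fs := fun k : nat => match k with
    | 0%nat => f | 1%nat => e1 | 2%nat => e2 | 3%nat => e3 | 4%nat => e4
    | 5%nat => G0 | _ => G1 end).
  destruct (Hbar_dependence z r fs Hz Hr) as (c & (i & Hi & Hci) & Hc).
  { intros k. do 6 (destruct k as [|k]; [first [exact Hf | apply L0 | now apply (sls_sol _ _ _ HS)]|]).
    apply L1. }
  assert (Hc' : forall s t, cover r s -> cover r t ->
    (c 0%nat * f s t + (c 1%nat * e1 s t + (c 2%nat * e2 s t + (c 3%nat * e3 s t + c 4%nat * e4 s t)))
     + c 5%nat * G0 s t + c 6%nat * G1 s t)%C = 0).
  { intros s t Hs Ht. rewrite <- (Hc s t Hs Ht). rewrite !sum_n_C_S, sum_O. simpl. toC. ring. }
  set (h := add2 (scal2 (c 1%nat) e1) (add2 (scal2 (c 2%nat) e2)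
             (add2 (scal2 (c 3%nat) e3) (scal2 (c 4%nat) e4)))).
  assert (S1 := sls_scal _ _ _ HS (c 1%nat) e1 He1). assert (S2 := sls_scal _ _ _ HS (c 2%nat) e2 He2).
  assert (S3 := sls_scal _ _ _ HS (c 3%nat) e3 He3). assert (S4 := sls_scal _ _ _ HS (c 4%nat) e4 He4).
  assert (A34 := sls_add _ _ _ HS _ _ S3 S4). assert (A234 := sls_add _ _ _ HS _ _ S2 A34).
  assert (Hh : HE h) by exact (sls_add _ _ _ HS _ _ S1 A234).
  destruct (Ceq_dec (c 0%nat) 0) as [Z0|N0].
  - exfalso.
    assert (C56 : c 5%nat = 0 /\ c 6%nat = 0).
    { apply (eigen_independence z r I_FJRW_0 I_FJRW_1 G0 G1 omega_0 omega_1 h); auto using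
        omega_0_neq_1, omega_1_neq_1, omega_0_neq_omega_1.
      - apply Hr.
      - now apply Hinv.
      - intros s t Hs Ht. rewrite <- (Hc' s t Hs Ht), Z0. unfold h, add2, scal2. ring. }
    destruct C56 as [Z5 Z6].
    assert (V : vanishing r h).
    { intros s t Hs Ht. rewrite <- (Hc' s t Hs Ht), Z0, Z5, Z6. unfold h, add2, scal2. ring. }
    apply (ri_kernel _ _ _ _ _ _ Hphi h Hh) in V.
    assert (C14 : forall k, (1 <= k <= 4)%nat -> c k = 0).
    { assert (K : forall u, cover r u -> sum_n (fun k => c k * IY z k u)%C 4 = RtoC 0).
      { intros u Hu. rewrite <- (V u Hu). unfold h.
        rewrite (ri_add _ _ _ _ _ _ Hphi _ _ S1 A234 u Hu),
          (ri_add _ _ _ _ _ _ Hphi _ _ S2 A34 u Hu), (ri_add _ _ _ _ _ _ Hphi _ _ S3 S4 u Hu),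
          (ri_scal _ _ _ _ _ _ Hphi _ _ He1 u Hu), (ri_scal _ _ _ _ _ _ Hphi _ _ He2 u Hu),
          (ri_scal _ _ _ _ _ _ Hphi _ _ He3 u Hu), (ri_scal _ _ _ _ _ _ Hphi _ _ He4 u Hu),
          (P1 u Hu), (P2 u Hu), (P3 u Hu), (P4 u Hu).
        rewrite !sum_n_C_S, sum_O, IY_0. toC. ring. }
      (* Both sides of the eigenvector equation vanish. *)
      apply (IY_eigen z r c 2 Hz (proj1 Hr)).
      - intros E. apply RtoC_inj in E. lra.
      - intros u Hu. assert (Hu' : cover r (u + two_pi_i)%C) by now apply cover_two_pi_i.
        rewrite (K u Hu), (K _ Hu'). toC. ring. }
    apply Hci. destruct (Compare_dec.le_lt_dec i 4) as [Hi4|Hi4].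
    + destruct i as [|i]; [exact Z0|]. apply C14. lia.
    + assert (Hi' : i = 5%nat \/ i = 6%nat) by lia.
      destruct Hi' as [-> | ->]; assumption.
  - exists (- (c 5%nat / c 0%nat))%C, (- (c 6%nat / c 0%nat))%C.
    apply (sls_ext _ _ _ HS (scal2 (- / c 0%nat)%C h)); [|now apply (sls_scal _ _ _ HS)].
    intros s t Hs Ht. specialize (Hc' s t Hs Ht).
    assert (E : (h s t = - (c 0%nat * f s t + c 5%nat * G0 s t + c 6%nat * G1 s t))%C).
    { apply Ceq_minus. rewrite <- Hc'. unfold h, add2, scal2. ring. }
    unfold scal2 at 1. rewrite E. unfold sub2, add2, scal2. field. exact N0.
Qed.

Lemma is_restriction_lincomb r D f g I J (b c : C) :
  is_restriction r D f I -> is_restriction r D g J ->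
  is_restriction r D (add2 (scal2 b f) (scal2 c g)) (fun u => b * I u + c * J u)%C.
Proof.
  intros Hf Hg u Hu eps Heps.
  set (m := Cmod b + Cmod c + 1).
  assert (Hm : 0 < m) by (pose proof (Cmod_ge_0 b); pose proof (Cmod_ge_0 c); unfold m; lra).
  destruct (Hf u Hu (eps / m) (Rdiv_lt_0_compat _ _ Heps Hm)) as [A HA].
  destruct (Hg u Hu (eps / m) (Rdiv_lt_0_compat _ _ Heps Hm)) as [B HB].
  exists (Rmin A B). intros v Hv.
  specialize (HA v (Rlt_le_trans _ _ _ Hv (Rmin_l _ _))).
  specialize (HB v (Rlt_le_trans _ _ _ Hv (Rmin_r _ _))).
  replace (coords D (add2 (scal2 b f) (scal2 c g)) u v - (b * I u + c * J u))%C
    with (b * (coords D f u v - I u) + c * (coords D g u v - J u))%C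
    by (destruct D; unfold coords, add2, scal2; ring).
  eapply Rle_lt_trans; [apply Cmod_triangle|]. rewrite !Cmod_mult.
  set (x := Cmod (coords D f u v - I u)) in *. set (y := Cmod (coords D g u v - J u)) in *.
  pose proof (Cmod_ge_0 b). pose proof (Cmod_ge_0 c).
  assert (E : eps = m * (eps / m)) by (field; lra).
  assert (He : 0 < eps / m) by now apply Rdiv_lt_0_compat.
  set (e := eps / m) in *. rewrite E. unfold m.
  assert (B1 : Cmod b * x <= Cmod b * e) by (apply Rmult_le_compat_l; lra).
  assert (B2 : Cmod c * y <= Cmod c * e) by (apply Rmult_le_compat_l; lra).
  lra.
Qed.

(** The isomorphism reads off the components of a solution along the two solutions
    with fractional exponents, the rest being invariant around x = 0. *)
Theorem theoremC (z : C) (r : R) (E : divisor) (HE : (C -> C -> C) -> Prop) :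
  z <> RtoC 0 ->
  0 < r <= 27 ->
  max_trivial_monodromy z r E HE ->
  restriction_iso r E HE (H_Y z r) ->
  exists (F : divisor) (HF : (C -> C -> C) -> Prop),
    F <> E /\
    max_trivial_monodromy z r F HF /\
    quotient_restriction_iso r F HF HE (L_W r).
Proof.
  intros Hz Hr Hmax Hiso.
  destruct E; [|exfalso; exact (not_div_y z r HE Hz Hr Hmax Hiso)].
  exists div_y, (invariants z r div_y).
  split; [discriminate|]. split; [now apply invariants_max|].
  pose proof (fjrw_lift_0 z r Hz Hr) as L0. pose proof (fjrw_lift_1 z r Hz Hr) as L1.
  pose proof (decomposition z r HE Hz Hr Hmax Hiso) as Hdec.
  set (G0 := fjrw_sol_0 z) in *. set (G1 := fjrw_sol_1 z) in *.
  assert (HS : sub_local_system z r HE) by apply Hmax.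
  pose proof (max_trivial_invariants z r div_x HE Hz Hmax) as Hinv.
  set (dec := fun f (p : C * C) => HE (sub2 f (add2 (scal2 (fst p) G0) (scal2 (snd p) G1)))).
  assert (Huniq : forall f p q, dec f p -> dec f q -> p = q).
  { intros f [b c] [b' c'] Hp Hq.
    destruct (eigen_independence z r I_FJRW_0 I_FJRW_1 G0 G1 omega_0 omega_1
      (add2 (sub2 f (add2 (scal2 b G0) (scal2 c G1)))
         (scal2 (-1) (sub2 f (add2 (scal2 b' G0) (scal2 c' G1))))) (b - b') (c - c'))
      as [E1 E2]; auto using omega_0_neq_1, omega_1_neq_1, omega_0_neq_omega_1.
    - apply Hr.
    - apply Hinv. apply (sls_add _ _ _ HS); [exact Hp|]. now apply (sls_scal _ _ _ HS).
    - intros s t _ _. unfold add2, sub2, scal2. ring.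
    - apply Ceq_minus in E1, E2. congruence. }
  (* The components along G0 and G1 exist and are unique, hence are a function. *)
  set (comp := fun f => epsilon (inhabits (RtoC 0, RtoC 0)) (dec f)).
  assert (Hcomp : forall f, Hbar z r f -> dec f (comp f)).
  { intros f Hf. apply epsilon_spec. destruct (Hdec f Hf) as (b & c & H). now exists (b, c). }
  assert (Hval : forall f p, Hbar z r f -> dec f p -> comp f = p).
  { intros f p Hf Hp. apply (Huniq f); auto. }
  pose proof (invariants_sub_local_system z r div_y Hz) as HSF.
  assert (HG0 : invariants z r div_y G0).
  { split; [apply L0|]. intros s t _ _. apply (fl_loop_y _ _ _ _ _ L0). }
  assert (HG1 : invariants z r div_y G1).
  { split; [apply L1|]. intros s t _ _. apply (fl_loop_y _ _ _ _ _ L1). }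
  exists (fun f u => fst (comp f) * I_FJRW_0 u + snd (comp f) * I_FJRW_1 u)%C.
  split.
  - intros f _. exists (fst (comp f)), (snd (comp f)). intros u _. reflexivity.
  - intros f g [Hf _] [Hg _] u _.
    rewrite (Hval (add2 f g) (fst (comp f) + fst (comp g), snd (comp f) + snd (comp g))%C).
    + simpl. ring.
    + now apply Hbar_add.
    + unfold dec. eapply (sls_ext _ _ _ HS);
        [|exact (sls_add _ _ _ HS _ _ (Hcomp f Hf) (Hcomp g Hg))].
      intros s t _ _. unfold add2, sub2, scal2. simpl. ring.
  - intros a f [Hf _] u _.
    rewrite (Hval (scal2 a f) (a * fst (comp f), a * snd (comp f))%C).
    + simpl. ring.
    + now apply Hbar_scal.
    + unfold dec. eapply (sls_ext _ _ _ HS); [|exact (sls_scal _ _ _ HS a _ (Hcomp f Hf))].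
      intros s t _ _. unfold add2, sub2, scal2. simpl. ring.
  - intros f [Hf _] u Hu. simpl transverse. unfold loop1.
    rewrite (Hval (loop div_x f) (omega_0 * fst (comp f), omega_1 * snd (comp f))%C).
    + rewrite (fl_restr_loop _ _ _ _ _ L0 u Hu), (fl_restr_loop _ _ _ _ _ L1 u Hu).
      simpl. ring.
    + now apply Hbar_loop.
    + unfold dec. eapply (sls_ext _ _ _ HS);
        [|exact (proj1 (sls_loop _ _ _ HS div_x _) (Hcomp f Hf))].
      intros s t Hs Ht. unfold loop, add2, sub2, scal2. simpl.
      rewrite (fl_loop_x _ _ _ _ _ L0 s t Hs Ht), (fl_loop_x _ _ _ _ _ L1 s t Hs Ht). ring.
  - intros f [Hf _]. split.
    + intros H0. destruct (restr_independence z r I_FJRW_0 I_FJRW_1 G0 G1 omega_0 omega_1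
        (fst (comp f)) (snd (comp f)) omega_0_neq_omega_1 L0 L1 H0) as [E1 E2].
      eapply (sls_ext _ _ _ HS); [|exact (Hcomp f Hf)].
      intros s t _ _. unfold add2, sub2, scal2. rewrite E1, E2. ring.
    + intros H u _. rewrite (Hval f (RtoC 0, RtoC 0)); auto.
      * simpl. ring.
      * unfold dec. eapply (sls_ext _ _ _ HS); [|exact H].
        intros s t _ _. unfold add2, sub2, scal2. simpl. ring.
  - intros g (a & b & Hg). exists (add2 (scal2 a G0) (scal2 b G1)).
    assert (HI : invariants z r div_y (add2 (scal2 a G0) (scal2 b G1))).
    { apply (sls_add _ _ _ HSF); now apply (sls_scal _ _ _ HSF). }
    split; auto. intros u Hu. rewrite (Hg u Hu), (Hval _ (a, b)); auto.
    + apply HI.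
    + unfold dec. eapply (sls_ext _ _ _ HS); [|exact (sls_zero _ _ _ HS)].
      intros s t _ _. unfold add2, sub2, scal2. simpl. ring.
  - intros f Hf. set (p := comp f).
    exists (sub2 f (add2 (scal2 (fst p) G0) (scal2 (snd p) G1))). split; [|split].
    + eapply (sls_ext _ _ _ HSF);
        [|exact (sls_add _ _ _ HSF _ _ Hf (sls_scal _ _ _ HSF (-1)
           _ (sls_add _ _ _ HSF _ _ (sls_scal _ _ _ HSF (fst p) _ HG0)
              (sls_scal _ _ _ HSF (snd p) _ HG1))))].
      intros s t _ _. unfold add2, sub2, scal2. ring.
    + apply Hcomp. apply Hf.
    + intros u Hu eps Heps.
      destruct (is_restriction_lincomb r div_y G0 G1 I_FJRW_0 I_FJRW_1 (fst p) (snd p)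
        (fl_restr _ _ _ _ _ L0) (fl_restr _ _ _ _ _ L1) u Hu eps Heps) as [A HA].
      exists A. intros v Hv. specialize (HA v Hv). simpl in HA |- *.
      replace (sub2 f (sub2 f (add2 (scal2 (fst p) G0) (scal2 (snd p) G1))) u v)
        with (add2 (scal2 (fst p) G0) (scal2 (snd p) G1) u v)
        by (unfold sub2; ring).
      exact HA.
Qed.
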